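(* Let $d\ge 1$ and let $\mu \colon \mathbb{R}^d\setminus\{0\} \to \mathbb{R}$ be a smooth function which is positively homogeneous of degree $m \ge 2$ (i.e. $\mu(\lambda x)=\lambda^m\mu(x)$ for all $\lambda>0$, $x\neq 0$), and which satisfies \[ \det \nabla^2 \mu (x) \ne 0 \quad \text{whenever } |x|=1. \] Let $F_\mu(x)=e^{2\pi i \mu(x)}$ (a bounded function, hence a tempered distribution) and set $E_\mu = \mathcal{F}^{-1} F_\mu$. Then for every $g \in \mathcal{S}(\mathbb{R}^d)$, \[ \sup_{y \in \mathbb{R}^d} \| g(\cdot - y)\, E_\mu \|_{\mathcal{F} L^1} < \infty. \]
   Context: The Fourier transform is $\widehat{f}(\xi)=\mathcal{F} f(\xi)=\int_{\mathbb{R}^d} e^{-2\pi i \xi\cdot x} f(x)\,dx$, extended to tempered distributions $\mathcal{S}'(\mathbb{R}^d)$. $\mathcal{S}(\mathbb{R}^d)$ is the Schwartz class. For $1\le p\le\infty$, $\mathcal{F} L^p(\mathbb{R}^d)$ is the space of tempered distributions $f$ with $\widehat f\in L^p(\mathbb{R}^d)$, normed by $\|f\|_{\mathcal{F} L^p}=\|\widehat f\|_{L^p}$. *)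

(* Defs.v *)
From HB Require Import structures.
From mathcomp Require Import all_boot all_order all_algebra.
From mathcomp Require Import all_classical all_reals all_analysis.
From mathcomp Require Import complex.

Set Implicit Arguments.
Unset Strict Implicit.
Unset Printing Implicit Defensive.

Import Order.TTheory GRing.Theory Num.Theory.
Import numFieldNormedType.Exports.

Local Open Scope classical_set_scope.
Local Open Scope ring_scope.

(* R^d is modelled as d.-tuple R, which carries the product (Borel)
   sigma-algebra of MathComp-Analysis (measurable_structure.v). *)

Section Defs.
Variable R : realType.

Definition coord (d : nat) (x : d.-tuple R) (i : 'I_d) : R := tnth x i.

Definition dotp (d : nat) (x y : d.-tuple R) : R :=
  \sum_(i < d) tnth x i * tnth y i.
Definition enorm (d : nat) (x : d.-tuple R) : R := Num.sqrt (dotp x x).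

Definition vsub (d : nat) (x y : d.-tuple R) : d.-tuple R :=
  [tuple tnth x i - tnth y i | i < d].
Definition vscale (d : nat) (c : R) (x : d.-tuple R) : d.-tuple R :=
  [tuple c * tnth x i | i < d].
Definition vzero (d : nat) : d.-tuple R := [tuple (0 : R) | i < d].

Definition vupd (d : nat) (x : d.-tuple R) (i : 'I_d) (t : R) : d.-tuple R :=
  [tuple (if j == i then tnth x j + t else tnth x j) | j < d].

(* d-dimensional Lebesgue measure (on the Borel sets of R^d), defined
   by iterated integration (Cavalieri):
   leb_{n+1}(A) = \int leb_n({x | (t,x) \in A}) dt. *)
Fixpoint leb (n : nat) : set (n.-tuple R) -> \bar R :=
  match n return set (n.-tuple R) -> \bar R with
  | 0 => fun A => if `[< A [tuple] >] then 1%E else 0%E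
  | n'.+1 => fun A =>
      (\int[@lebesgue_measure R]_t (@leb n' [set x : n'.-tuple R | A (cons_tuple (t : R) x)]))%E
  end.

Definition cabs (z : R[i]) : R := Num.sqrt (complex.Re z ^+ 2 + complex.Im z ^+ 2).

Definition cintegrable (d : nat) (f : d.-tuple R -> R[i]) : Prop :=
  measurable_fun setT (fun x => complex.Re (f x)) /\
  measurable_fun setT (fun x => complex.Im (f x)) /\
  (\int[@leb d]_x (cabs (f x))%:E < +oo)%E.

Definition cint (d : nat) (f : d.-tuple R -> R[i]) : R[i] :=
  Complex (fine (\int[@leb d]_x (complex.Re (f x))%:E)%E)
          (fine (\int[@leb d]_x (complex.Im (f x))%:E)%E).

Definition expi (t : R) : R[i] := Complex (cos t) (sin t).

Definition fourier (d : nat) (f : d.-tuple R -> R[i]) (xi : d.-tuple R) : R[i] :=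
  cint (fun x => expi (- (2 * pi * dotp xi x)) * f x).
Definition ifourier (d : nat) (f : d.-tuple R -> R[i]) (x : d.-tuple R) : R[i] :=
  cint (fun xi => expi (2 * pi * dotp xi x) * f xi).

Definition rpartial (d : nat) (i : 'I_d) (f : d.-tuple R -> R) (x : d.-tuple R) : R :=
  derive1 (fun t => f (vupd x i t)) 0.
Definition rpartial_ex (d : nat) (i : 'I_d) (f : d.-tuple R -> R) (x : d.-tuple R) : Prop :=
  derivable (fun t => f (vupd x i t)) 0 1.
Definition rdpart (d : nat) (s : seq 'I_d) (f : d.-tuple R -> R) : d.-tuple R -> R :=
  foldr (fun i g => rpartial i g) f s.

Definition cpartial (d : nat) (i : 'I_d) (f : d.-tuple R -> R[i]) (x : d.-tuple R) : R[i] :=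
  Complex (rpartial i (fun y => complex.Re (f y)) x) (rpartial i (fun y => complex.Im (f y)) x).
Definition cdpart (d : nat) (s : seq 'I_d) (f : d.-tuple R -> R[i]) : d.-tuple R -> R[i] :=
  foldr (fun i g => cpartial i g) f s.

Definition schwartz (d : nat) (f : d.-tuple R -> R[i]) : Prop :=
  (forall (s : seq 'I_d) (i : 'I_d) (x : d.-tuple R),
      rpartial_ex i (fun y => complex.Re (cdpart s f y)) x /\
      rpartial_ex i (fun y => complex.Im (cdpart s f y)) x) /\
  (forall (s : seq 'I_d) (N : nat), exists C : R, forall x : d.-tuple R,
      (1 + enorm x) ^+ N * cabs (cdpart s f x) <= C).

Definition rcont_at (d : nat) (f : d.-tuple R -> R) (x : d.-tuple R) : Prop :=
  forall e : R, 0 < e -> exists2 del : R, 0 < del &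
    forall z, enorm (vsub z x) < del -> `|f z - f x| < e.

Definition smooth_off0 (d : nat) (f : d.-tuple R -> R) : Prop :=
  forall (s : seq 'I_d) (x : d.-tuple R), x <> vzero d ->
    rcont_at (rdpart s f) x /\ forall i : 'I_d, rpartial_ex i (rdpart s f) x.

Definition hessian (d : nat) (f : d.-tuple R -> R) (x : d.-tuple R) : 'M[R]_d :=
  \matrix_(i < d, j < d) rpartial i (rpartial j f) x.

(* Tempered distributions are represented by their action on Schwartz
   test functions (only the values on Schwartz functions matter). *)
Definition tdist (d : nat) := (d.-tuple R -> R[i]) -> R[i].

Definition tdist_of_fun (d : nat) (F : d.-tuple R -> R[i]) : tdist d :=
  fun psi => cint (fun x => F x * psi x).
Definition tfourier (d : nat) (u : tdist d) : tdist d :=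
  fun phi => u (fourier phi).
Definition tifourier (d : nat) (u : tdist d) : tdist d :=
  fun psi => u (ifourier psi).
Definition tmul (d : nat) (g : d.-tuple R -> R[i]) (u : tdist d) : tdist d :=
  fun psi => u (fun x => g x * psi x).

(* ||u||_{FL^1} = ||\hat u||_{L^1}, equal to +oo when \hat u is not
   (represented by) an L^1 function. *)
Definition FL1norm (d : nat) (u : tdist d) : \bar R :=
  ereal_inf [set (\int[@leb d]_x (cabs (h x))%:E)%E | h in
    [set h : d.-tuple R -> R[i] | cintegrable h /\
       forall phi, schwartz phi ->
         tfourier u phi = cint (fun x => h x * phi x)]].

Definition Fmu (d : nat) (mu : d.-tuple R -> R) (x : d.-tuple R) : R[i] :=
  expi (2 * pi * mu x).
Definition Emu (d : nat) (mu : d.-tuple R -> R) : tdist d :=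
  tifourier (tdist_of_fun (Fmu mu)).

End Defs.

(* Main.v *)
(** For fixed [y] the Fourier transform of [g(. - y) E_mu] is the function
    [h_y(z) = \int e^{2 pi i (mu(w) + y.(w - z))} G(w - z) dw], where
    [G = F^{-1} g], and its L^1 norm has to be bounded uniformly in [y].

    Let [u = |w|^{2-m} (grad mu(w) + y)].  The identity
    [1 = 1/(1+|u|^2) + \sum_j u_j u_j/(1+|u|^2)], where [u_j e^{2 pi i Phi}]
    is a multiple of [|w|^{2-m} d_j e^{2 pi i Phi}] for the phase
    [Phi = mu + y.w], allows one to integrate by parts; each step gains a factor
    [r = (1+|u|^2)^{-1/2}] in the amplitude, with constants independent of [y]
    because [y] enters only through [u] and [d_k u_j = p_jk + q_k u_j] for
    [p], [q] homogeneous of degree [0] and [-1], hence bounded away from the origin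
    (a neighbourhood of which is cut off).  After [2n] steps the integrand is
    [O(r^{2n} |G(w - z)|)].

    The Hessian being invertible on the sphere, finitely many cones cover the
    space on each of which [grad mu] expands distances by at least
    [c |w|^{m-2}]; there [r <= C/(1+|w - w*|)] with [w*] an almost minimizer of
    [|u|] on the cone.  Hence [|h_y(z)|] is bounded by a finite sum of
    convolutions of integrable weights centred at points depending on [y], whose
    total integral does not depend on [y]. *)

Require Import Defs.
From HB Require Import structures.
From mathcomp Require Import all_boot all_order all_algebra.
From mathcomp Require Import all_classical all_reals all_analysis.
From mathcomp Require Import measurable_realfun complex.
From mathcomp Require Import ring lra.

Set Implicit Arguments.
Unset Strict Implicit.
Unset Printing Implicit Defensive.

Import Order.TTheory GRing.Theory Num.Theory.
Import numFieldNormedType.Exports.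

Local Open Scope classical_set_scope.
Local Open Scope ring_scope.

(** * Lebesgue measure on tuples *)

(** [grad mu] need be neither injective nor onto, so the phase may have no critical point, or
    several; an almost minimizer of |u| on each cone exists for every y and replaces it. Its
    position is not controlled, which is harmless: only the integral over z of the resulting
    convolutions matters.

    The factor |w|^(2-m) is the one that turns the Hessian, of degree m-2, into a coefficient of
    degree 0. The assumption m >= 2 keeps |w|^(2-m) bounded away from the origin and lets the larger
    of two scales govern the expansion estimate.

    The count 2n is that of the product weight [wt]: two powers per coordinate. As 2n steps consume
    only 2n derivatives, finitely differentiable classes suffice and the cutoff can be an explicit
    power. Its complement is not compactly supported but decays like |w|^(-2n), so that part needs
    no integration by parts and costs one more convolution, centred at the origin.

    Exponentials are replaced by cosines with a phase shift [tau]: a shift by pi/2 stands for a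
    multiplication by i, so real calculus suffices, and uniformity in [tau] absorbs the factor e^(-2
    pi i y.z). *)

Section LebesgueStep.
Variables (R : realType) (n : nat).

Local Notation mu1 := (@lebesgue_measure R).

Definition tcons (p : R * n.-tuple R) : n.+1.-tuple R := cons_tuple p.1 p.2.
Definition tuncons (x : n.+1.-tuple R) : R * n.-tuple R :=
  (tnth x ord0, [tuple of behead x]).

Lemma tunconsK : cancel tuncons tcons.
Proof. by move=> x; apply/val_inj; rewrite /= [in RHS](tuple_eta x). Qed.

Lemma tconsK : cancel tcons tuncons.
Proof.
by move=> [a x]; rewrite /tuncons /tcons/=; congr pair; apply/val_inj.
Qed.

Lemma tnth_tcons0 p : tnth (tcons p) ord0 = p.1. Proof. by []. Qed.

Lemma tnth_tconsS p i : tnth (tcons p) (lift ord0 i) = tnth p.2 i.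
Proof. by rewrite /tcons tnthS. Qed.

Lemma measurable_tcons : measurable_fun [set: R * n.-tuple R] tcons.
Proof. exact: measurable_cons. Qed.

Lemma measurable_tuncons : measurable_fun [set: n.+1.-tuple R] tuncons.
Proof.
apply/measurable_fun_pairP; split; first exact: measurable_tnth.
exact: measurable_behead.
Qed.

Variable m : {sigma_finite_measure set (n.-tuple R) -> \bar R}.

(** Transporting a product measure makes Tonelli and Fubini available in every dimension. *)
Definition lebS := pushforward (@lebesgue_measure R \x m)%E tcons.

Let mtcons := measurable_tcons.

Let lebS0 : lebS set0 = 0%E.
Proof. by rewrite /lebS /pushforward preimage_set0 measure0. Qed.

Let lebS_ge0 A : (0 <= lebS A)%E.
Proof. exact: measure_ge0. Qed.

Let lebS_sigma_additive : semi_sigma_additive lebS.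
Proof. exact: measure_semi_sigma_additive. Qed.

HB.instance Definition _ := isMeasure.Build _ _ _ lebS
  lebS0 lebS_ge0 lebS_sigma_additive.

Let lebS_sigma_finite : sigma_finite setT lebS.
Proof.
have /sigma_finiteP[F [FT ndF Foo]] := sigma_finiteT (@lebesgue_measure R).
have /sigma_finiteP[G [GT ndG Goo]] := sigma_finiteT m.
(* Both exhaustions are increasing, so a point caught at indices i and j lies in the rectangle of
   index [maxn i j]. *)
exists (fun k => tuncons @^-1` (F k `*` G k)).
  apply/seteqP; split=> // x _.
  have [i _ Fi] : (\bigcup_i F i) (tuncons x).1 by rewrite -FT.
  have [j _ Gj] : (\bigcup_i G i) (tuncons x).2 by rewrite -GT.
  exists (maxn i j) => //; split.
    by have /subsetPset := ndF _ _ (leq_maxl i j); apply.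
  by have /subsetPset := ndG _ _ (leq_maxr i j); apply.
move=> k; have [mF Fk] := Foo k; have [mG Gk] := Goo k; split.
  by rewrite -[X in measurable X]setTI; apply: measurable_tuncons => //;
    exact: measurableX.
rewrite [X in (X < _)%E](_ : _ = (@lebesgue_measure R \x m)%E (F k `*` G k)).
  by rewrite product_measure1E// lte_mul_pinfty// ge0_fin_numE.
rewrite /lebS /pushforward; congr (_ _).
by apply/seteqP; split=> p; rewrite /preimage/mkset tconsK.
Qed.

HB.instance Definition _ := Measure_isSigmaFinite.Build _ _ _ lebS
  lebS_sigma_finite.

Lemma ge0_integral_lebS (f : n.+1.-tuple R -> \bar R) :
  measurable_fun [set: n.+1.-tuple R] f -> (forall x, 0 <= f x)%E ->
  (\int[lebS]_x f x = \int[@lebesgue_measure R]_t \int[m]_x f (tcons (t, x)))%E.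
Proof.
move=> mf f0; rewrite /lebS ge0_integral_pushforward//= preimage_setT.
have mft : measurable_fun [set: measurableTypeR R * n.-tuple R] (f \o tcons).
  exact: measurableT_comp.
have := @fubini_tonelli1 _ _ (measurableTypeR R) _ R mu1 m (f \o tcons) mft.
by move=> -> // p; exact: f0.
Qed.

Lemma integral_lebS (f : n.+1.-tuple R -> \bar R) :
  lebS.-integrable setT f ->
  (lebesgue_measure \x m)%E.-integrable setT (f \o tcons).
Proof.
move=> /integrableP[mf foo]; apply/integrableP; split.
  exact: measurableT_comp.
move: foo; rewrite /lebS ge0_integral_pushforward//=.
exact: measurableT_comp.
Qed.

End LebesgueStep.
Arguments lebS {R n} m.
Arguments tcons {R n} p.

Section Lebesgue.
Variable R : realType.
Local Notation mu1 := (@lebesgue_measure R).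

Fixpoint mleb n : {sigma_finite_measure set (n.-tuple R) -> \bar R} :=
  match n with
  | 0 => @dirac _ (0.-tuple R) [tuple] R
  | n'.+1 => lebS (mleb n')
  end.

(** The recursion defining [leb] only yields a set function; this identification supplies the
    measure structure on which all integration theorems rest. *)
Lemma lebE n : @leb R n = mleb n :> (set (n.-tuple R) -> \bar R).
Proof.
elim: n => [|n IH].
  apply/funext => A; rewrite /= diracE.
  by case: asboolP => hA; [rewrite mem_set | rewrite memNset].
apply/funext => A; rewrite /= /lebS /pushforward /product_measure1.
apply: eq_integral => t _; rewrite /= -IH; congr (leb _).
by apply/seteqP; split=> x /=; rewrite xsectionE/=.
Qed.

Lemma ge0_integral_mlebS n (f : n.+1.-tuple R -> \bar R) :
  measurable_fun [set: n.+1.-tuple R] f -> (forall x, 0 <= f x)%E ->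
  (\int[mleb n.+1]_x f x =
   \int[mu1]_t \int[mleb n]_x f (tcons (t, x)))%E.
Proof. exact: ge0_integral_lebS. Qed.

(** Translation invariance comes from uniqueness of Lebesgue measure: its image under a translation
    gives half-open intervals their length. *)
Lemma ge0_integral_shift1 (f : R -> \bar R) (a : R) :
  measurable_fun setT f -> (forall x, 0 <= f x)%E ->
  (\int[mu1]_t f (t - a)%R = \int[mu1]_t f t)%E.
Proof.
move=> mf f0.
have ms : measurable_fun [set: measurableTypeR R]
    ((fun t => t - a) : measurableTypeR R -> measurableTypeR R).
  exact: measurable_funB.
have pE (A : set (measurableTypeR R)) : measurable A ->
    mu1 A = pushforward mu1 (fun t : measurableTypeR R => t - a : measurableTypeR R) A.
  move=> mA; apply: lebesgue_measure_unique => //= _ [[b c]] _ <-.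
  rewrite /pushforward.
  rewrite (_ : _ @^-1` _ = `]b + a, c + a]%classic); last first.
    by apply/seteqP; split=> x /=; rewrite !in_itv/= ltrBrDr lerBlDr.
  rewrite !lebesgue_measure_itv/= !lte_fin ltrD2r.
  by rewrite -!EFinD; case: ifP => // _; congr EFin; ring.
rewrite [RHS](eq_measure_integral _ (fun A mA _ => pE A mA)).
by rewrite ge0_integral_pushforward//= preimage_setT.
Qed.

End Lebesgue.

Section Translation.
Variable R : realType.
Local Notation mu1 := (@lebesgue_measure R).

Lemma tuple0E (x y : 0.-tuple R) : x = y.
Proof. by rewrite (tuple0 x) (tuple0 y). Qed.

Lemma tnth_vsub n (x a : n.-tuple R) i : tnth (vsub x a) i = tnth x i - tnth a i.
Proof. by rewrite tnth_mktuple. Qed.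

Lemma eq_tuple n (x y : n.-tuple R) : (forall i, tnth x i = tnth y i) -> x = y.
Proof. by move=> h; apply/eq_from_tnth. Qed.

Lemma vsub_tcons n (p q : R * n.-tuple R) :
  vsub (tcons p) (tcons q) = tcons (p.1 - q.1, vsub p.2 q.2).
Proof.
apply/eq_tuple => i; rewrite tnth_vsub.
case: (unliftP ord0 i) => [j ->|->]; last by rewrite !tnth_tcons0.
by rewrite !tnth_tconsS tnth_vsub.
Qed.

Lemma measurable_vsub n (a : n.-tuple R) :
  measurable_fun [set: n.-tuple R] (fun x : n.-tuple R => vsub x a).
Proof.
apply/measurable_fun_tnthP => i.
rewrite (_ : _ \o _ = fun x : n.-tuple R => tnth x i - tnth a i); last first.
  by apply/funext => x /=; rewrite tnth_vsub.
by apply: measurable_funB => //; exact: measurable_tnth.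
Qed.

Lemma measurable_slice n (f : n.+1.-tuple R -> \bar R) (t : R) :
  measurable_fun [set: n.+1.-tuple R] f ->
  measurable_fun [set: n.-tuple R] (fun x => f (tcons (t, x))).
Proof.
move=> mf; apply: (measurableT_comp mf).
exact: (measurableT_comp (@measurable_tcons R n) (measurable_pair1 t)).
Qed.

Lemma ge0_integral_shift n (f : n.-tuple R -> \bar R) (a : n.-tuple R) :
  measurable_fun [set: n.-tuple R] f -> (forall x, 0 <= f x)%E ->
  (\int[mleb R n]_x f (vsub x a) = \int[mleb R n]_x f x)%E.
Proof.
elim: n f a => [|n IH] f a mf f0.
  by apply: eq_integral => x _; rewrite (tuple0E (vsub x a) x).
rewrite !ge0_integral_mlebS//; last first.
  exact: (measurableT_comp mf (measurable_vsub a)).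
rewrite -[a]tunconsK.
pose F (t : R) := (\int[mleb R n]_x f (tcons (t, x)))%E.
rewrite -/(F _) -[RHS](@ge0_integral_shift1 _ _ (tuncons a).1).
- apply: eq_integral => t _; rewrite /F.
  rewrite -(IH (fun x => f (tcons (t - (tuncons a).1, x))) (tuncons a).2)//.
    by apply: eq_integral => x _; rewrite vsub_tcons.
  exact: (measurable_slice _ mf).
- have mft : measurable_fun [set: measurableTypeR R * n.-tuple R] (f \o tcons).
    by apply: measurableT_comp => //; exact: measurable_tcons.
  exact: (measurable_fun_fubini_tonelli_F (m2 := mleb R n) (f \o tcons) mft (fun p => f0 _)).
- by move=> t; apply: integral_ge0 => x _; exact: f0.
Qed.

Lemma integral_shift n (f : n.-tuple R -> \bar R) (a : n.-tuple R) :
  measurable_fun [set: n.-tuple R] f ->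
  (\int[mleb R n]_x f (vsub x a) = \int[mleb R n]_x f x)%E.
Proof.
move=> mf; rewrite integralE [RHS]integralE; congr (_ - _)%E.
  rewrite -(ge0_integral_shift a (measurable_funepos mf) (funepos_ge0 _)).
  by apply: eq_integral => x _; rewrite !unlock.
rewrite -(ge0_integral_shift a (measurable_funeneg mf) (funeneg_ge0 _)).
by apply: eq_integral => x _; rewrite !unlock.
Qed.

End Translation.

Section Weight.
Variable R : realType.
Local Notation mu1 := (@lebesgue_measure R).

(** The derivative of arctan, whence an explicit total mass. *)
Definition wt1 (t : R) : R := (1 + t ^+ 2)^-1.

Lemma wt1_gt0 t : 0 < wt1 t.
Proof. by rewrite invr_gt0 ltr_pwDl// sqr_ge0. Qed.

Lemma wt1_le1 t : wt1 t <= 1.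
Proof. by rewrite invf_le1 ?lerDl ?sqr_ge0// ltr_pwDl// sqr_ge0. Qed.

Lemma wt1N t : wt1 (- t) = wt1 t.
Proof. by rewrite /wt1 sqrrN. Qed.

Lemma continuous_wt1 : continuous wt1.
Proof.
move=> t; apply: cvgV; first by rewrite gt_eqF// ltr_pwDl// sqr_ge0.
by apply: cvgD; [exact: cvg_cst|exact: exprn_continuous].
Qed.

Lemma integral_wt1 : (\int[mu1]_t (wt1 t)%:E = pi%:E)%E.
Proof.
rewrite ge0_symfun_integralT.
- rewrite (_ : [set x | 0 <= x] = `[0, +oo[%classic); last first.
    by apply/seteqP; split=> x /=; rewrite in_itv/= andbT.
  rewrite (ge0_continuous_FTC2y (F := @atan R) (l := pi / 2)).
  + by rewrite atan0 sube0 -EFinM mulrCA divff ?mulr1.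
  + by move=> x _; exact/ltW/wt1_gt0.
  + by apply: continuous_subspaceT; exact: continuous_wt1.
  + exact: cvgy_atan.
  + by move=> x _; exact: derivable_atan.
  + by apply: cvg_at_right_filter; exact: continuous_atan.
  + by move=> x _; rewrite derive1_atan.
- by move=> t; exact/ltW/wt1_gt0.
- exact: continuous_wt1.
- by move=> t; rewrite /= wt1N.
Qed.

(* Dominates [(1 + |x|)^-2n], and factorizes, so that its integral is explicit. *)
Definition wt n (x : n.-tuple R) : R := \prod_(i < n) wt1 (tnth x i).

Lemma wt_tcons n (p : R * n.-tuple R) : wt (tcons p) = wt1 p.1 * wt p.2.
Proof.
rewrite /wt big_ord_recl tnth_tcons0; congr (_ * _).
by apply: eq_bigr => i _; rewrite tnth_tconsS.
Qed.

Lemma wt_gt0 n (x : n.-tuple R) : 0 < wt x.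
Proof. by apply: prodr_gt0 => i _; exact: wt1_gt0. Qed.

Lemma wt_ge0 n (x : n.-tuple R) : 0 <= wt x.
Proof. exact/ltW/wt_gt0. Qed.

Lemma wt_le1 n (x : n.-tuple R) : wt x <= 1.
Proof. by apply: prodr_ile1 => j _; rewrite wt1_le1 ltW// wt1_gt0. Qed.

Lemma measurable_wt1 : measurable_fun [set: R] wt1.
Proof. by apply: continuous_measurable_fun => x; exact: continuous_wt1. Qed.

Lemma measurable_wt n : measurable_fun [set: n.-tuple R] (@wt n).
Proof.
rewrite /wt; apply: measurable_prod => i _.
apply: (measurableT_comp measurable_wt1); exact: measurable_tnth.
Qed.

Lemma integral_wt n : (\int[mleb R n]_x (wt x)%:E = (pi ^+ n)%:E)%E.
Proof.
elim: n => [|n IH].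
  rewrite /= integral_dirac//=; last by apply/measurable_EFinP; apply: measurable_wt.
  by rewrite diracT mul1e /wt big_ord0 expr0.
rewrite (ge0_integral_mlebS (f := EFin \o @wt n.+1)); last 2 first.
- by apply/measurable_EFinP; apply: measurable_wt.
- by move=> x; rewrite lee_fin wt_ge0.
under eq_integral => t _.
  under eq_integral => x _ do rewrite /= wt_tcons/= EFinM.
  rewrite ge0_integralZl_EFin//; last 3 first.
  - by move=> x _; rewrite lee_fin wt_ge0.
  - by apply/measurable_EFinP; apply: measurable_wt.
  - exact/ltW/wt1_gt0.
  rewrite IH muleC.
  over.
rewrite ge0_integralZl_EFin//.
- by rewrite integral_wt1 -EFinM exprSr.
- by move=> t _; rewrite lee_fin ltW// wt1_gt0.
- by apply/measurable_EFinP; apply: measurable_wt1.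
- by rewrite exprn_ge0// pi_ge0.
Qed.

Lemma integral_wt_shift n (a : n.-tuple R) :
  (\int[mleb R n]_x (wt (vsub x a))%:E = (pi ^+ n)%:E)%E.
Proof.
rewrite (@ge0_integral_shift _ _ (EFin \o @wt n)) ?integral_wt//.
- by apply/measurable_EFinP; apply: measurable_wt.
- by move=> x; rewrite lee_fin wt_ge0.
Qed.

Lemma wt_sym n (x y : n.-tuple R) : wt (vsub x y) = wt (vsub y x).
Proof.
by apply: eq_bigr => i _; rewrite !tnth_vsub -wt1N opprB.
Qed.

Lemma measurable_wt_shift n (a : n.-tuple R) :
  measurable_fun [set: n.-tuple R] (fun x => wt (vsub x a)).
Proof. exact: (measurableT_comp (@measurable_wt n) (measurable_vsub a)). Qed.

Lemma integrable_wt_shift n (C : R) (a : n.-tuple R) (f : n.-tuple R -> R) :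
  measurable_fun [set: n.-tuple R] f ->
  (forall x, `|f x| <= C * wt (vsub x a)) ->
  (mleb R n).-integrable setT (EFin \o f).
Proof.
move=> mf fC; apply: (@le_integrable _ _ _ (mleb R n) setT _ _
  (fun x => (C * wt (vsub x a))%:E)) => //.
- exact/measurable_EFinP.
- move=> x _; rewrite /= lee_fin (le_trans (fC x))//.
  by rewrite ler_norm.
- under eq_fun do rewrite EFinM.
  apply: integrableZl => //; apply/integrableP; split.
    by apply/measurable_EFinP; apply: measurable_wt_shift.
  under eq_integral => x _ do rewrite gee0_abs ?lee_fin ?wt_ge0//.
  by rewrite integral_wt_shift ltry.
Qed.

End Weight.

(** * Partial derivatives and continuity *)

Section Partial.
Variable R : realType.
Local Notation mu1 := (@lebesgue_measure R).

Lemma is_derive_shift (f : R -> R) (a D : R) :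
  is_derive (0 : R) 1 (fun s => f (a + s)) D -> is_derive a 1 f D.
Proof.
move=> h.
have -> : f = (fun s => f (a + s)) \o (fun t => t - a).
  by apply/funext => t /=; rewrite addrC subrK.
have g : is_derive a 1 (fun t : R => t - a) 1.
  by rewrite -[X in is_derive _ _ _ X]subr0; apply: is_deriveB.
have := @is_derive1_comp _ (fun s => f (a + s)) (fun t => t - a) a D 1.
by rewrite subrr mulr1; apply.
Qed.

Lemma wt1_small (C e z : R) : 0 < e ->
  \forall n \near \oo, C * wt1 (n.+1%:R - z) < e.
Proof.
move=> e0; near=> n.
have n1 : 0 < n.+1%:R - z.
  rewrite subr_gt0 (@lt_trans _ _ n%:R) ?ltr_nat//.
  by near: n; exact: nbhs_infty_gtr.
(* For positive t one has [wt1 t] <= 1/t, so comparing C with e * t is enough. *)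
have n2 : C < e * (n.+1%:R - z).
  rewrite -ltr_pdivrMl// ltrBrDr (@lt_trans _ _ n%:R) ?ltr_nat//.
  by near: n; exact: nbhs_infty_gtr.
rewrite /wt1 ltr_pdivrMr ?ltr_pwDl ?sqr_ge0// (lt_le_trans n2)//.
rewrite ler_pM2l//; move: n1 => {n2}; move: (_ - z) => t t0.
by have := sqr_ge0 (t - 1); nra.
Unshelve. all: by end_near. Qed.

(** The fundamental theorem on growing symmetric intervals: the bound on [F] kills the boundary
    terms, the bound on [F'] permits dominated convergence. *)
Lemma integral_derivative0 (F F' : R -> R) (C z : R) :
  (forall t : R, is_derive t 1 F (F' t)) -> continuous F' ->
  (forall t, `|F t| <= C * wt1 (t - z)) ->
  (forall t, `|F' t| <= C * wt1 (t - z)) ->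
  (\int[mu1]_t (F' t)%:E = 0)%E.
Proof.
move=> dF cF' bF bF'.
have mF' : measurable_fun [set: R] F' by apply: continuous_measurable_fun.
(* Radius [n.+1] keeps the interval nondegenerate at n = 0, as [continuous_FTC2] demands. *)
pose A (n : nat) : set R := `[- n.+1%:R, n.+1%:R]%classic.
pose f (n : nat) (t : R) : \bar R := ((EFin \o F') \_ (A n)) t.
have mf n : measurable_fun [set: R] (f n).
  apply/(measurable_restrictT _ _).1 => //; first exact: measurable_itv.
  by apply: measurable_funTS; exact/measurable_EFinP.
have iG : mu1.-integrable [set: R] (fun t => (C * wt1 (t - z))%:E).
  have mw : measurable_fun [set: R] (fun t : R => wt1 (t - z)).
    apply: (measurableT_comp (@measurable_wt1 R)).
    exact: measurable_funB.
  under eq_fun do rewrite EFinM.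
  apply: integrableZl => //; apply/integrableP; split.
    exact/measurable_EFinP.
  under eq_integral => x _ do rewrite gee0_abs ?lee_fin ?(ltW (wt1_gt0 _))//.
  rewrite (@ge0_integral_shift1 R (EFin \o @wt1 R) z).
  - by rewrite /= integral_wt1 ltry.
  - by apply/measurable_EFinP; apply: measurable_wt1.
  - by move=> t; rewrite lee_fin ltW// wt1_gt0.
have fF t : f n t @[n --> \oo] --> (F' t)%:E.
  apply: cvg_near_cst; near=> n; rewrite /f patchE ifT// inE /A/= in_itv/=.
  rewrite -ler_norml ltW// (@lt_trans _ _ n%:R)//.
    by near: n; exact: nbhs_infty_gtr.
  by rewrite ltr_nat.
have fE n : (\int[mu1]_t f n t = (F n.+1%:R - F (- n.+1%:R))%:E)%E.
  rewrite /f -integral_mkcond EFinB (@continuous_FTC2 _ F' F)//.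
  - by rewrite gtrN// ltr0n.
  - by apply: continuous_subspaceT.
  - split.
    + by move=> x _; exact: ex_derive.
    + by apply: cvg_at_right_filter; apply: differentiable_continuous;
        apply/derivable1_diffP; exact: ex_derive.
    + by apply: cvg_at_left_filter; apply: differentiable_continuous;
        apply/derivable1_diffP; exact: ex_derive.
  - by move=> x _; rewrite derive1E; exact: derive_val.
have [] := @dominated_convergence _ _ _ mu1 [set: R] measurableT f (EFin \o F')
   (fun t => (C * wt1 (t - z))%:E) mf.
- exact/measurable_EFinP.
- by apply: aeW => t _; exact: fF.
- exact: iG.
- apply: aeW => t n _; rewrite /f patchE.
  case: ifP => _; first by rewrite lee_fin.
  by rewrite abse0 lee_fin (le_trans _ (bF' t)).
move=> _ _ h.
have h0 : (\int[mu1]_t f n t)%E @[n --> \oo] --> 0%:E.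
  under eq_fun do rewrite fE.
  apply: cvg_EFin; first exact: nearW.
  apply/cvgrPdist_lt => e e0; near=> n.
  rewrite sub0r normrN (le_lt_trans (ler_normB _ _))//.
  rewrite [e]splitr ltrD// (le_lt_trans (bF _))//.
  - by near: n; apply: wt1_small; rewrite divr_gt0.
  - rewrite -wt1N opprD opprK.
    by near: n; apply: wt1_small; rewrite divr_gt0.
exact: (cvg_unique _ h h0).
Unshelve. all: by end_near. Qed.

End Partial.

Section PartialN.
Variable R : realType.
Local Notation mu1 := (@lebesgue_measure R).

Lemma tnth_vupd n (x : n.-tuple R) i t j :
  tnth (vupd x i t) j = if j == i then tnth x j + t else tnth x j.
Proof. by rewrite tnth_mktuple. Qed.

Lemma vupd0 n (x : n.-tuple R) i : vupd x i 0 = x.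
Proof. by apply/eq_tuple => j; rewrite tnth_vupd addr0 if_same. Qed.

Lemma vupdD n (x : n.-tuple R) i s t : vupd (vupd x i s) i t = vupd x i (s + t).
Proof. by apply/eq_tuple => j; rewrite !tnth_vupd; case: eqP => // _; rewrite addrA. Qed.

Lemma vupd_tcons0 n (p : R * n.-tuple R) s :
  vupd (tcons p) ord0 s = tcons (p.1 + s, p.2).
Proof.
apply/eq_tuple => j; rewrite tnth_vupd.
by case: (unliftP ord0 j) => [k ->|->] /=; rewrite ?tnth_tconsS ?tnth_tcons0.
Qed.

Lemma vupd_tconsS n (p : R * n.-tuple R) i s :
  vupd (tcons p) (lift ord0 i) s = tcons (p.1, vupd p.2 i s).
Proof.
apply/eq_tuple => j; rewrite tnth_vupd.
case: (unliftP ord0 j) => [k ->|->]; last by rewrite !tnth_tcons0.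
by rewrite !tnth_tconsS tnth_vupd (inj_eq lift_inj).
Qed.

Lemma integrable_tcons n (f : n.+1.-tuple R -> \bar R) :
  (mleb R n.+1).-integrable setT f ->
  (mu1 \x mleb R n)%E.-integrable setT (f \o tcons).
Proof. exact: integral_lebS. Qed.

Lemma integral_tcons n (f : n.+1.-tuple R -> \bar R) :
  (mleb R n.+1).-integrable setT f ->
  (\int[mleb R n.+1]_x f x = \int[mu1 \x mleb R n]_p f (tcons p))%E.
Proof.
move=> fi; have fi' := integrable_tcons fi.
have mf : measurable_fun [set: n.+1.-tuple R] f by case/integrableP : fi.
by rewrite /= /lebS integral_pushforward//=; exact: measurable_tcons.
Qed.

Lemma integral_tcons12 n (f : n.+1.-tuple R -> \bar R) :
  (mleb R n.+1).-integrable setT f ->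
  (\int[mleb R n.+1]_x f x = \int[mu1]_t \int[mleb R n]_x f (tcons (t, x)))%E.
Proof.
move=> fi; rewrite integral_tcons//.
by rewrite -(integral12_prod_meas1 (integrable_tcons fi)).
Qed.

Lemma integral_tcons21 n (f : n.+1.-tuple R -> \bar R) :
  (mleb R n.+1).-integrable setT f ->
  (\int[mleb R n.+1]_x f x = \int[mleb R n]_x \int[mu1]_t f (tcons (t, x)))%E.
Proof.
move=> fi; rewrite integral_tcons//.
by rewrite -(integral21_prod_meas1 (integrable_tcons fi)).
Qed.

(** A relation carries existence and value of the partial derivative together, whereas [rpartial] is
    a total function with a default value. *)
Definition haspd n (i : 'I_n) (F : n.-tuple R -> R) (x : n.-tuple R) (D : R) :=
  is_derive (0 : R) 1 (fun t => F (vupd x i t)) D.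

Lemma haspd_line n (i : 'I_n) F F' (x : n.-tuple R) :
  (forall x, haspd i F x (F' x)) ->
  forall t : R, is_derive t 1 (fun t => F (vupd x i t)) (F' (vupd x i t)).
Proof.
move=> h t; apply: is_derive_shift.
have := h (vupd x i t); rewrite /haspd.
by under eq_fun do rewrite vupdD.
Qed.

(** This underlies every integration by parts below. By Fubini the variable of differentiation is
    placed innermost: if it is the head coordinate the one-dimensional case applies on each line,
    otherwise the induction hypothesis applies on each slice. *)
Lemma integral_haspd0 n (i : 'I_n) (F F' : n.-tuple R -> R) (C : R) z :
  (forall x, haspd i F x (F' x)) ->
  (forall x, continuous (fun t => F' (vupd x i t))) ->
  measurable_fun [set: n.-tuple R] F' ->
  (forall x, `|F x| <= C * wt (vsub x z)) ->
  (forall x, `|F' x| <= C * wt (vsub x z)) ->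
  (\int[mleb R n]_x (F' x)%:E = 0)%E.
Proof.
elim: n i F F' z => [|n IH] i F F' z dF cF' mF' bF bF'; first by case: i {dF cF'}.
have iF' := integrable_wt_shift mF' bF'.
have C0 : 0 <= C.
  have := le_trans (normr_ge0 _) (bF z); rewrite pmulr_lge0// wt_gt0//.
have wz1 (u : n.-tuple R) : wt u <= 1 by exact: wt_le1.
have wt1z (u : R) : wt1 u <= 1 by exact: wt1_le1.
rewrite -(tunconsK z) in bF bF'; move: (tuncons z) => [z1 z2] in bF bF'.
case: (unliftP ord0 i) => [j ij|i0].
- rewrite integral_tcons12//.
  rewrite integral0_eq// => t _.
  apply: (IH j (fun x => F (tcons (t, x))) (fun x => F' (tcons (t, x))) z2).
  + move=> x; have := dF (tcons (t, x)); rewrite /haspd ij.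
    by under eq_fun do rewrite vupd_tconsS/=.
  + move=> x; have := cF' (tcons (t, x)); rewrite ij.
    by under eq_fun do rewrite vupd_tconsS/=.
  + apply/measurable_EFinP.
    by apply: (@measurable_slice _ _ (EFin \o F')); exact/measurable_EFinP.
  + move=> x; rewrite (le_trans (bF _))// vsub_tcons wt_tcons/=.
    by rewrite ler_wpM2l// ler_piMl// wt_ge0.
  + move=> x; rewrite (le_trans (bF' _))// vsub_tcons wt_tcons/=.
    by rewrite ler_wpM2l// ler_piMl// wt_ge0.
- rewrite integral_tcons21//.
  rewrite integral0_eq// => x _.
  have line t : tcons (t, x) = vupd (tcons (0, x)) i t.
    by rewrite i0 vupd_tcons0 add0r.
  apply: (@integral_derivative0 _ (fun t => F (tcons (t, x))) (fun t => F' (tcons (t, x))) C z1).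
  + move=> t; under eq_fun do rewrite line.
    by rewrite line; exact: (haspd_line (tcons (0, x)) dF t).
  + by move=> t; under eq_fun do rewrite line; exact: cF'.
  + move=> t; rewrite (le_trans (bF _))// vsub_tcons wt_tcons/=.
    by rewrite ler_wpM2l// ler_piMr// ltW// wt1_gt0.
  + move=> t; rewrite (le_trans (bF' _))// vsub_tcons wt_tcons/=.
    by rewrite ler_wpM2l// ler_piMr// ltW// wt1_gt0.
Qed.

End PartialN.

Section Euclid.
Variables (R : realType) (n : nat).
Implicit Types x z : n.-tuple R.

Lemma dotpC x z : dotp x z = dotp z x.
Proof. by apply: eq_bigr => i _; rewrite mulrC. Qed.

Lemma dotp_ge0 x : 0 <= dotp x x.
Proof. by apply: sumr_ge0 => i _; rewrite -expr2 sqr_ge0. Qed.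

Lemma sqr_enorm x : enorm x ^+ 2 = dotp x x.
Proof. by rewrite sqr_sqrtr// dotp_ge0. Qed.

Lemma enorm_ge0 x : 0 <= enorm x.
Proof. exact: sqrtr_ge0. Qed.

Lemma coord_le_enorm x i : `|tnth x i| <= enorm x.
Proof.
rewrite -sqrtr_sqr ler_wsqrtr// /dotp (bigD1 i)//= -expr2 lerDl.
by apply: sumr_ge0 => j _; rewrite -expr2 sqr_ge0.
Qed.

Definition norm1 x : R := \sum_(i < n) `|tnth x i|.

Lemma norm1_ge0 x : 0 <= norm1 x.
Proof. exact: sumr_ge0. Qed.

Lemma coord_le_norm1 x i : `|tnth x i| <= norm1 x.
Proof. by rewrite /norm1 (bigD1 i)//= lerDl sumr_ge0. Qed.

Lemma enorm_le_norm1 x : enorm x <= norm1 x.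
Proof.
rewrite -(ler_pXn2r (n := 2)) ?nnegrE ?enorm_ge0 ?norm1_ge0// sqr_enorm.
rewrite /dotp expr2 {1}/norm1 mulr_suml; apply: ler_sum => i _.
rewrite -expr2 -real_normK ?num_real// expr2.
by rewrite ler_wpM2l// coord_le_norm1.
Qed.

Lemma norm1_le_enorm x : norm1 x <= n%:R * enorm x.
Proof.
rewrite /norm1 (le_trans (ler_sum _ (fun i _ => coord_le_enorm x i)))//.
by rewrite sumr_const card_ord mulr_natl.
Qed.

Lemma enorm_eq0 x : (enorm x == 0) = (x == vzero R n).
Proof.
apply/eqP/eqP => [x0|->].
  apply: eq_tuple => i; rewrite tnth_mktuple.
  by apply/eqP; rewrite -normr_le0 -x0 coord_le_enorm.
rewrite /enorm /dotp big1 ?sqrtr0// => i _.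
by rewrite tnth_mktuple mul0r.
Qed.

Lemma enorm_gt0 x : x <> vzero R n -> 0 < enorm x.
Proof. by move=> x0; rewrite lt_neqAle enorm_ge0 andbT eq_sym enorm_eq0; apply/eqP. Qed.

(* The neighbourhood filter of [x] for the Euclidean norm, in which
   [rcont_at] is convergence. *)
Definition nbt x : set_system (n.-tuple R) :=
  [set A | exists2 e : R, 0 < e & forall z, enorm (vsub z x) < e -> A z].

Lemma nbtP x (A : set (n.-tuple R)) :
  (exists2 e : R, 0 < e & forall z, (forall i, `|tnth z i - tnth x i| < e) -> A z)
  <-> nbt x A.
Proof.
split=> -[e e0 eA].
  exists e => // z zx; apply: eA => i; rewrite -tnth_vsub.
  exact: le_lt_trans (coord_le_enorm _ _) zx.
(* Dividing by [n.+1] makes the sum of n terms strictly smaller than e, also in dimension 0. *)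
exists (e / n.+1%:R); first by rewrite divr_gt0// ltr0n.
move=> z zx; apply: eA; rewrite (le_lt_trans (enorm_le_norm1 _))//.
rewrite (@le_lt_trans _ _ (\sum_(i < n) e / n.+1%:R))//.
  by apply: ler_sum => i _; rewrite tnth_vsub ltW.
rewrite sumr_const card_ord -[_ *+ n]mulr_natr -mulrA gtr_pMr//.
by rewrite mulrC ltr_pdivrMr ?ltr0n// mul1r ltr_nat.
Qed.

Global Instance nbt_filter x : ProperFilter (nbt x).
Proof.
apply: Build_ProperFilter_ex.
  move=> P [e e0 eP]; exists x; apply: eP; rewrite (_ : vsub x x = vzero R n).
    by move/eqP: (erefl (vzero R n)); rewrite -enorm_eq0 => /eqP ->.
  by apply: eq_tuple => i; rewrite tnth_vsub subrr tnth_mktuple.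
split.
- by exists 1.
- move=> A B [a a0 aA] [b b0 bB]; exists (Num.min a b); first by rewrite lt_min a0.
  by move=> z; rewrite lt_min => /andP[za zb]; split; [exact: aA|exact: bB].
- by move=> A B AB [a a0 aA]; exists a => // z /aA /AB.
Qed.

Lemma rcontP (f : n.-tuple R -> R) x : rcont_at f x <-> f @ nbt x --> f x.
Proof.
split=> [h|/cvgrPdist_lt h].
  apply/cvgrPdist_lt => e e0; have [d d0 hd] := h _ e0.
  by exists d => // z /hd; rewrite distrC.
by move=> e /h [d d0 hd]; exists d => // z /hd; rewrite /= distrC.
Qed.

Lemma tnth_cvg i x : (fun z => tnth z i) @ nbt x --> tnth x i.
Proof.
apply/cvgrPdist_lt => e e0; exists e => // z zx; rewrite /= distrC -tnth_vsub.
exact: le_lt_trans (coord_le_enorm _ _) zx.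
Qed.

Lemma nbt_self x A : nbt x A -> A x.
Proof.
move=> /nbtP[e e0]; apply => i; by rewrite subrr normr0.
Qed.

Lemma cvg_tuple {T} (F : set_system T) {FF : Filter F} (g : T -> n.-tuple R) x :
  (forall i, (fun t => tnth (g t) i) @ F --> tnth x i) -> g @ F --> nbt x.
Proof.
move=> gx A /nbtP[e e0 eA].
have : \forall t \near F, forall i, `|tnth (g t) i - tnth x i| < e.
  apply: filter_forall => i.
  by have /cvgrPdist_lt/(_ e e0) := gx i; apply: filterS => t; rewrite distrC.
by apply: filterS => t /eA.
Qed.

Lemma vupd_cvg x i (t : R) : vupd x i @ t --> nbt (vupd x i t).
Proof.
apply: cvg_tuple => j; under eq_fun do rewrite tnth_vupd; rewrite tnth_vupd.
case: eqP => _; last exact: cvg_cst.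
by apply: cvgD; [exact: cvg_cst|exact: cvg_id].
Qed.

Lemma vsub_cvg x y : (fun z => vsub z y) @ nbt x --> nbt (vsub x y).
Proof.
apply: cvg_tuple => j; under eq_fun do rewrite tnth_vsub; rewrite tnth_vsub.
by apply: cvgB; [exact: tnth_cvg|exact: cvg_cst].
Qed.

Lemma cvg_sumr {T I} (F : set_system T) {FF : Filter F} (s : seq I)
    (f : I -> T -> R) (l : I -> R) :
  (forall i, f i @ F --> l i) ->
  (fun t => \sum_(i <- s) f i t) @ F --> \sum_(i <- s) l i.
Proof.
move=> fl; elim: s => [|i s IH].
  by under eq_fun do rewrite big_nil; rewrite big_nil; exact: cvg_cst.
by under eq_fun do rewrite big_cons; rewrite big_cons; exact: cvgD.
Qed.

Lemma dotp_cvg x y : dotp y @ nbt x --> dotp y x.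
Proof.
by apply: cvg_sumr => i; apply: cvgM; [exact: cvg_cst|exact: tnth_cvg].
Qed.

Lemma sqr_cvg x : (fun z => dotp z z) @ nbt x --> dotp x x.
Proof.
by apply: cvg_sumr => i; apply: cvgM; exact: tnth_cvg.
Qed.

Lemma enorm_cvg x : (fun z => enorm z) @ nbt x --> enorm x.
Proof.
apply: (cvg_comp _ _ (sqr_cvg (x := x))); exact: sqrt_continuous.
Qed.

End Euclid.

Section Measurability.
Variables (R : realType) (n : nat).
Implicit Types (x z : n.-tuple R) (f : n.-tuple R -> R).

Definition grid (k : nat) (p : n.-tuple int) : n.-tuple R :=
  [tuple (tnth p i)%:~R / k.+1%:R | i < n].
Definition gridpt (k : nat) x : n.-tuple int :=
  [tuple Num.floor (k.+1%:R * tnth x i) | i < n].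

Lemma measurable_gridpt k (p : n.-tuple int) :
  measurable [set x : n.-tuple R | gridpt k x = p].
Proof.
rewrite (_ : [set x | _] = \bigcap_(i in [set: 'I_n])
  ((fun x : n.-tuple R => tnth x i) @^-1`
    `[(tnth p i)%:~R / k.+1%:R, (tnth p i + 1)%:~R / k.+1%:R[)); last first.
  apply/seteqP; split=> [x <- i _|x h].
    rewrite /= in_itv/= tnth_mktuple ler_pdivrMr ?ltr_pdivlMr ?ltr0n//.
    by rewrite ![_ * k.+1%:R]mulrC floor_itv.
  apply: eq_from_tnth => i; rewrite tnth_mktuple; apply: floor_def.
  have /= := h i I; rewrite in_itv/= ler_pdivrMr ?ltr_pdivlMr ?ltr0n//.
  by rewrite ![_ * k.+1%:R]mulrC.
apply: fin_bigcap_measurable => [|i _]; first exact: finite_finset.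
rewrite -[X in measurable X]setTI; apply: measurable_tnth => //.
Qed.

(* f is the pointwise limit of its values at the nodes of finer and finer
   grids; the origin is a node of every grid, so it needs no continuity. *)
Lemma measurable_rcont_off0 f :
  (forall x, x <> vzero R n -> rcont_at f x) ->
  measurable_fun [set: n.-tuple R] f.
Proof.
move=> cf; pose h k x := f (grid k (gridpt k x)).
apply: (@measurable_fun_cvg _ _ _ _ h) => [k|x _].
  move=> _ Y mY; rewrite setTI.
  rewrite (_ : _ @^-1` Y = \bigcup_(p in [set: n.-tuple int])
    if `[< Y (f (grid k p)) >] then [set x | gridpt k x = p] else set0).
    apply: countable_bigcupT_measurable => // p.
    by case: ifP => _ //; exact: measurable_gridpt.
  apply/seteqP; split=> [x Yx|x [p _]].
    exists (gridpt k x) => //; case: asboolP => // h'; exact: h'.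
  by case: asboolP => //= Yp gp; rewrite /preimage/= /h gp.
have gx : (fun k => grid k (gridpt k x)) @ \oo --> nbt x.
  apply: cvg_tuple => i; apply/cvgrPdist_lt => e e0; near=> k.
  rewrite !tnth_mktuple.
  have k0 : 0 < k.+1%:R :> R by rewrite ltr0n.
  have := floor_itv (k.+1%:R * tnth x i); set u := (Num.floor _); move=> /andP[a b].
  have ke : 1 < k.+1%:R * e.
    rewrite -ltr_pdivrMr// mul1r (@lt_trans _ _ k%:R) ?ltr_nat//.
    by near: k; exact: nbhs_infty_gtr.
  rewrite -(ltr_pM2l k0) -[X in X * `|_|]gtr0_norm// -normrM mulrBr.
  rewrite [k.+1%:R * (u%:~R / _)]mulrC divfK ?gt_eqF//.
  move: b; rewrite intrD => b; rewrite ger0_norm ?subr_ge0//; lra.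
have [x0|x0] := pselect (x = vzero R n); last first.
  by have /rcontP := cf _ x0; apply: cvg_comp.
rewrite (_ : h ^~ x = cst (f x)); first exact: cvg_cst.
apply/funext => k; congr f; apply: eq_tuple => i.
by rewrite x0 !tnth_mktuple mulr0 floor0 mul0r.
Unshelve. all: by end_near. Qed.

Lemma measurable_rcont f : (forall x, rcont_at f x) ->
  measurable_fun [set: n.-tuple R] f.
Proof. by move=> cf; apply: measurable_rcont_off0 => x _. Qed.

End Measurability.

Section Telescoping.
Variables (R : realType) (n : nat).
Implicit Types (x z p : n.-tuple R) (f : n.-tuple R -> R).

Lemma mvt_sym (f df : R -> R) (h : R) :
  (forall t : R, `|t| <= `|h| -> is_derive t 1 f (df t)) ->
  exists2 c, `|c| <= `|h| & f h - f 0 = df c * h.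
Proof.
move=> dff.
have cf a b : (forall t, t \in `[a, b] -> `|t| <= `|h|) ->
    {within `[a, b], continuous f}.
  by move=> abh; apply: derivable_within_continuous => t /abh /dff [].
have [h0|h0|h0] := ltgtP h 0.
- have hh t : t \in `[h, 0] -> `|t| <= `|h|.
    by rewrite in_itv/= => /andP[ht t0]; rewrite !ler0_norm ?lerN2// ltW.
  have [||c] := @MVT _ f df h 0 h0.
  + by move=> t /subset_itv_oo_cc/hh; exact: dff.
  + exact: cf.
  + move=> /subset_itv_oo_cc/hh ch; rewrite sub0r mulrN => e.
    by exists c => //; rewrite -opprB e opprK.
- have hh t : t \in `[0, h] -> `|t| <= `|h|.
    by rewrite in_itv/= => /andP[ht t0]; rewrite !ger0_norm// ltW.
  have [||c] := @MVT _ f df 0 h h0.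
  + by move=> t /subset_itv_oo_cc/hh; exact: dff.
  + exact: cf.
  + by move=> /subset_itv_oo_cc/hh ch; rewrite subr0 => e; exists c.
- by exists 0; rewrite h0 ?normr0// mulr0 subrr.
Qed.

(** Go from x to z one coordinate at a time and apply the mean value theorem on each edge; the path
    stays in the box spanned by x and z. With [L] zero this yields continuity, with [L] the gradient
    at x it yields differentiability. *)
Lemma telescope_bound f x z (D : 'I_n -> n.-tuple R -> R) (L eta : 'I_n -> R) :
  (forall p, (forall j, `|tnth p j - tnth x j| <= `|tnth z j - tnth x j|) ->
     forall i, haspd i f p (D i p) /\ `|D i p - L i| <= eta i) ->
  `|f z - f x - \sum_(i < n) L i * (tnth z i - tnth x i)| <=
  \sum_(i < n) eta i * `|tnth z i - tnth x i|.
Proof.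
move=> hD.
(* The k-th vertex of the path: the first k coordinates have already moved to z. *)
pose w k : n.-tuple R := [tuple if (j < k)%N then tnth z j else tnth x j | j < n].
have w0 : w 0%N = x by apply: eq_tuple => i; rewrite tnth_mktuple.
have wn : w n = z by apply: eq_tuple => i; rewrite tnth_mktuple ltn_ord.
rewrite -{1}wn -{1}w0 -(telescope_sumr (f \o w))// big_mkord -sumrB.
rewrite (le_trans (ler_norm_sum _ _ _))//; apply: ler_sum => k _ /=.
pose h := tnth z k - tnth x k.
have wS : w k.+1 = vupd (w k) k h.
  apply: eq_tuple => j; rewrite tnth_vupd !tnth_mktuple ltnS leq_eqVlt.
  have [->|jk] := eqVneq j k; first by rewrite eqxx/= ltnn /h addrC subrK.
  by rewrite -val_eqE in jk; rewrite (negbTE jk).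
have box t : `|t| <= `|h| ->
    forall j, `|tnth (vupd (w k) k t) j - tnth x j| <= `|tnth z j - tnth x j|.
  move=> th j; rewrite tnth_vupd tnth_mktuple.
  have [->|jk] := eqVneq j k; first by rewrite ltnn addrAC subrr add0r.
  by case: ifP => // _; rewrite subrr normr0.
have [t th|c ch] := @mvt_sym (fun t => f (vupd (w k) k t))
    (fun t => D k (vupd (w k) k t)) h.
  apply: is_derive_shift; have [+ _] := hD _ (box t th) k; rewrite /haspd.
  by under eq_fun do rewrite vupdD.
rewrite vupd0 -wS -/h => ->; rewrite -mulrBl normrM ler_wpM2r//.
by have [] := hD _ (box c ch) k.
Qed.

(** [schwartz] has no continuity clause; continuity of the derivatives is recovered from the
    boundedness of the next ones. *)
Lemma rcont_bounded_partials f (D : 'I_n -> n.-tuple R -> R) (C : R) :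
  (forall i x, haspd i f x (D i x)) -> (forall i x, `|D i x| <= C) ->
  forall x, rcont_at f x.
Proof.
move=> hD bD x e e0; pose M := (`|C| + 1) * n.+1%:R.
have M0 : 0 < M by rewrite mulr_gt0// ltr_wpDl.
exists (e / M) => [|z zx]; first by rewrite divr_gt0.
have := @telescope_bound f x z D (fun=> 0) (fun=> `|C| + 1).
have -> : \sum_(i < n) 0 * (tnth z i - tnth x i) = 0 by apply: big1 => i _; rewrite mul0r.
rewrite subr0 => h; rewrite (le_lt_trans (h _))//.
  move=> p _ i; split=> //; rewrite subr0 (le_trans (bD _ _))//.
  by rewrite (le_trans (ler_norm _))// lerDl.
rewrite -mulr_sumr.
under eq_bigr do rewrite -tnth_vsub.
rewrite -/(norm1 _) -ltr_pdivlMl ?ltr_wpDl// (le_lt_trans (norm1_le_enorm _))//.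
rewrite (@le_lt_trans _ _ (n.+1%:R * enorm (vsub z x)))//.
  by rewrite ler_wpM2r ?enorm_ge0// ler_nat.
by rewrite -ltr_pdivlMl// (lt_le_trans zx)// /M invfM mulrC -mulrA mulrCA.
Qed.

End Telescoping.

Section PartialCalculus.
Variables (R : realType) (n : nat) (i : 'I_n).
Implicit Types (x : n.-tuple R) (f g : n.-tuple R -> R).

Lemma haspd_eq f x D D' : haspd i f x D -> D = D' -> haspd i f x D'.
Proof. by move=> h <-. Qed.

Lemma haspd_cst (c : R) x : haspd i (fun=> c) x 0.
Proof. exact: is_derive_cst. Qed.

Lemma haspdD f g x D D' : haspd i f x D -> haspd i g x D' ->
  haspd i (fun z => f z + g z) x (D + D').
Proof. by move=> hf hg; exact: is_deriveD. Qed.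

Lemma haspdM f g x D D' : haspd i f x D -> haspd i g x D' ->
  haspd i (fun z => f z * g z) x (D * g x + f x * D').
Proof.
move=> hf hg; have := @is_deriveM _ _ _ _ (0 : R) (1 : R) D D' hf hg.
by rewrite /haspd vupd0 addrC /GRing.scale/= [g x * D]mulrC.
Qed.

Lemma haspdZ c f x D : haspd i f x D -> haspd i (fun z => c * f z) x (c * D).
Proof.
by move=> hf; apply: haspd_eq (haspdM (haspd_cst c x) hf) _; rewrite mul0r add0r.
Qed.

Lemma haspd_comp (phi : R -> R) f x D D' :
  is_derive (f x) 1 phi D -> haspd i f x D' ->
  haspd i (fun z => phi (f z)) x (D * D').
Proof.
move=> hphi hf.
by apply: (@is_derive1_comp _ phi (fun t => f (vupd x i t))); rewrite ?vupd0.
Qed.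

Lemma haspd_sum I (s : seq I) (f : I -> n.-tuple R -> R) x (D : I -> R) :
  (forall j, haspd i (f j) x (D j)) ->
  haspd i (fun z => \sum_(j <- s) f j z) x (\sum_(j <- s) D j).
Proof.
move=> h; elim: s => [|j s IH].
  rewrite big_nil; under eq_fun do rewrite big_nil; exact: haspd_cst.
by rewrite big_cons; under eq_fun do rewrite big_cons; exact: haspdD.
Qed.

Lemma haspd_tnth j x : haspd i (fun z => tnth z j) x (j == i)%:R.
Proof.
rewrite /haspd; under eq_fun do rewrite tnth_vupd.
case: eqP => _; last exact: is_derive_cst.
rewrite -[X in is_derive _ _ _ X]add0r; apply: is_deriveD.
Qed.

Lemma haspd_near f g x D : (\forall z \near nbt x, f z = g z) ->
  haspd i f x D -> haspd i g x D.
Proof.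
move=> fg; apply: near_eq_is_derive.
have := vupd_cvg (x := x) (i := i) (t := 0); rewrite vupd0 => h; exact: (h _ fg).
Qed.

Lemma haspd_unique f x D D' : haspd i f x D -> haspd i f x D' -> D = D'.
Proof. by move=> [_ <-] [_ <-]. Qed.

Lemma rpartial_haspd f x : rpartial_ex i f x -> haspd i f x (rpartial i f x).
Proof. by move=> h; apply: DeriveDef => //; rewrite /rpartial derive1E. Qed.

Lemma haspd_shift f a x D :
  haspd i f (vsub x a) D -> haspd i (fun z => f (vsub z a)) x D.
Proof.
rewrite /haspd (_ : (fun t => f (vsub (vupd x i t) a)) =
  (fun t => f (vupd (vsub x a) i t)))//; apply/funext => t; congr f.
apply: eq_tuple => j; rewrite !(tnth_vsub, tnth_vupd).
by case: eqP => // _; rewrite addrAC.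
Qed.

Lemma haspd_dotp y x : haspd i (fun z => dotp y z) x (tnth y i).
Proof.
apply: (haspd_eq (D := \sum_(j < n) tnth y j * (j == i)%:R)).
  by apply: haspd_sum => j; exact/haspdZ/haspd_tnth.
rewrite (bigD1 i)//= eqxx mulr1 big1 ?addr0// => j /negbTE ->.
by rewrite mulr0.
Qed.

Lemma haspd_sqr x : haspd i (fun z => dotp z z) x (2 * tnth x i).
Proof.
apply: (haspd_eq (D := \sum_(j < n) ((j == i)%:R * tnth x j + tnth x j * (j == i)%:R))).
  by apply: haspd_sum => j; apply: haspdM; exact: haspd_tnth.
rewrite (bigD1 i)//= eqxx mulr1 mul1r big1 ?addr0 ?mulr_natl// => j /negbTE ->.
by rewrite mulr0 mul0r addr0.
Qed.

End PartialCalculus.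

Section RContinuity.
Variables (R : realType) (n : nat).
Implicit Types (x : n.-tuple R) (f g : n.-tuple R -> R).

Lemma rcontD f g x : rcont_at f x -> rcont_at g x -> rcont_at (fun z => f z + g z) x.
Proof. by move=> /rcontP hf /rcontP hg; apply/rcontP; exact: cvgD. Qed.

Lemma rcontM f g x : rcont_at f x -> rcont_at g x -> rcont_at (fun z => f z * g z) x.
Proof. by move=> /rcontP hf /rcontP hg; apply/rcontP; exact: cvgM. Qed.

Lemma rcont_cst (c : R) x : rcont_at (fun=> c) x.
Proof. by apply/rcontP; exact: cvg_cst. Qed.

Lemma rcont_comp (phi : R -> R) f x :
  {for f x, continuous phi} -> rcont_at f x -> rcont_at (fun z => phi (f z)) x.
Proof. by move=> hp /rcontP hf; apply/rcontP; exact: (cvg_comp _ _ hf hp). Qed.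

Lemma rcont_tnth j x : rcont_at (fun z => tnth z j) x.
Proof. by apply/rcontP; exact: tnth_cvg. Qed.

Lemma rcont_shift f a x : rcont_at f (vsub x a) -> rcont_at (fun z => f (vsub z a)) x.
Proof. by move=> /rcontP hf; apply/rcontP; exact: (cvg_comp _ _ (@vsub_cvg _ _ _ _) hf). Qed.

Lemma rcont_line f i x (t : R) : rcont_at f (vupd x i t) ->
  {for t, continuous (fun t => f (vupd x i t))}.
Proof. by move=> /rcontP hf; exact: (cvg_comp _ _ (@vupd_cvg _ _ _ _ _) hf). Qed.

Lemma rcont_near f g x : (\forall z \near nbt x, f z = g z) ->
  rcont_at f x -> rcont_at g x.
Proof.
move=> fg /rcontP hf; apply/rcontP; rewrite -(nbt_self fg).
by apply: cvg_trans hf; apply: near_eq_cvg; apply: filterS fg => z.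
Qed.

Lemma rcont_dotp y x : rcont_at (fun z => dotp y z) x.
Proof. by apply/rcontP; exact: dotp_cvg. Qed.

Lemma rcont_sqr x : rcont_at (fun z => dotp z z) x.
Proof. by apply/rcontP; exact: sqr_cvg. Qed.

Lemma rcont_sum I (s : seq I) (f : I -> n.-tuple R -> R) x :
  (forall j, rcont_at (f j) x) -> rcont_at (fun z => \sum_(j <- s) f j z) x.
Proof. by move=> h; apply/rcontP; apply: cvg_sumr => j; exact/rcontP. Qed.

End RContinuity.

(** * Finitely differentiable families with estimates on all derivatives *)

Section Regularity.
Variables (R : realType) (n : nat) (Y : Type) (dom : set (n.-tuple R)).
Local Notation fam := (Y -> n.-tuple R -> R).
Implicit Types (B : nat -> fam -> Prop) (f g : fam).

(* f has k continuous derivatives on dom, each derivative of order l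
   satisfying the estimate B (j + l), uniformly in the parameter. *)
Fixpoint Reg B k j f : Prop :=
  [/\ B j f, (forall y w, dom w -> rcont_at (f y) w) &
   match k with
   | 0 => True
   | k'.+1 => forall i, exists f' : fam,
      (forall y w, dom w -> haspd i (f y) w (f' y w)) /\ Reg B k' j.+1 f'
   end].

Lemma Reg_bound B k j f : Reg B k j f -> B j f.
Proof. by case: k => [|k] []. Qed.

Lemma Reg_cont B k j f : Reg B k j f -> forall y w, dom w -> rcont_at (f y) w.
Proof. by case: k => [|k] []. Qed.

Lemma Reg_sub B B' k j f : (forall j f, B j f -> B' j f) -> Reg B k j f -> Reg B' k j f.
Proof.
move=> BB'; elim: k j f => [|k IH] j f [bf cf df]; split=> //; try exact: BB'.
by move=> i; have [f' [df' rf']] := df i; exists f'; split=> //; exact: IH.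
Qed.

Lemma Reg_le B k k' j f : (k' <= k)%N -> Reg B k j f -> Reg B k' j f.
Proof.
elim: k k' j f => [|k IH] [|k'] j f //; last first.
  rewrite ltnS => kk' [bf cf df]; split=> // i.
  by have [f' [df' rf']] := df i; exists f'; split=> //; exact: IH kk' rf'.
by move=> _ [bf cf df]; split.
Qed.

Lemma Reg_idx B k j l f : (forall j l f, B j f -> B l f) -> Reg B k j f -> Reg B k l f.
Proof.
move=> Bi; elim: k j l f => [|k IH] j l f [bf cf df]; split=> //; try exact: Bi bf.
by move=> i; have [f' [df' rf']] := df i; exists f'; split=> //; exact: IH rf'.
Qed.

(** The domain has to be open because continuity and derivatives at a point see a whole
    neighbourhood. *)
Lemma Reg_eq B k j f g :
  (forall w, dom w -> nbt w dom) ->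
  (forall j f g, (forall y w, dom w -> f y w = g y w) -> B j f -> B j g) ->
  (forall y w, dom w -> f y w = g y w) -> Reg B k j f -> Reg B k j g.
Proof.
move=> odom Be fg rf.
have nfg y w : dom w -> \forall z \near nbt w, f y z = g y z.
  by move=> dw; apply: filterS (odom w dw) => z dz; exact: fg.
case: k rf => [|k] [bf cf df]; split=> //; try exact: Be bf;
  try by move=> y w dw; exact: rcont_near (nfg y w dw) (cf y w dw).
move=> i; have [f' [df' rf']] := df i; exists f'; split=> // y w dw.
exact: haspd_near (nfg y w dw) (df' y w dw).
Qed.

Lemma RegD B k j f g :
  (forall j f g, B j f -> B j g -> B j (fun y w => f y w + g y w)) ->
  Reg B k j f -> Reg B k j g -> Reg B k j (fun y w => f y w + g y w).
Proof.
move=> BD; elim: k j f g => [|k IH] j f g [bf cf df] [bg cg dg]; split=> //;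
  try exact: BD; try by move=> y w dw; apply: rcontD; [exact: cf|exact: cg].
move=> i; have [f' [df' rf']] := df i; have [g' [dg' rg']] := dg i.
exists (fun y w => f' y w + g' y w); split; last exact: IH.
by move=> y w dw; apply: haspdD; [exact: df'|exact: dg'].
Qed.

(** In the Leibniz rule each summand differentiates exactly one factor, so the order [j + l] rises
    by one in both. *)
Lemma RegM B1 B2 B3 k j l f g :
  (forall j f g, B3 j f -> B3 j g -> B3 j (fun y w => f y w + g y w)) ->
  (forall j l f g, B1 j f -> B2 l g -> B3 (j + l)%N (fun y w => f y w * g y w)) ->
  Reg B1 k j f -> Reg B2 k l g -> Reg B3 k (j + l) (fun y w => f y w * g y w).
Proof.
move=> BD BM; elim: k j l f g => [|k IH] j l f g rf rg.
  case: (rf) (rg) => [bf cf _] [bg cg _]; split=> //; first exact: BM.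
  by move=> y w dw; apply: rcontM; [exact: cf|exact: cg].
case: (rf) (rg) => [bf cf df] [bg cg dg]; split=> //; first exact: BM.
  by move=> y w dw; apply: rcontM; [exact: cf|exact: cg].
move=> i; have [f' [df' rf']] := df i; have [g' [dg' rg']] := dg i.
exists (fun y w => f' y w * g y w + f y w * g' y w); split.
  by move=> y w dw; apply: haspdM; [exact: df'|exact: dg'].
apply: RegD => //.
  by rewrite -addSn; apply: IH => //; exact: Reg_le rg.
by rewrite -addnS; apply: IH => //; exact: Reg_le rf.
Qed.

Lemma Reg_cst B k j (c : R) : (forall j, B j (fun _ _ => 0)) ->
  B j (fun _ _ => c) -> Reg B k j (fun _ _ => c).
Proof.
move=> B0; elim: k j c => [|k IH] j c Bc; split=> //;
  try by move=> y w _; exact: rcont_cst.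
move=> i; exists (fun _ _ => 0); split; last exact: IH.
by move=> y w _; exact: haspd_cst.
Qed.

Lemma Reg_sum B k j I (s : seq I) (f : I -> fam) :
  (forall j, B j (fun _ _ => 0)) ->
  (forall j f g, B j f -> B j g -> B j (fun y w => f y w + g y w)) ->
  (forall a, Reg B k j (f a)) -> Reg B k j (fun y w => \sum_(a <- s) f a y w).
Proof.
move=> B0 BD rf; elim: s => [|a s IH].
  by under eq_fun do under eq_fun do rewrite big_nil; exact: Reg_cst.
by under eq_fun do under eq_fun do rewrite big_cons; exact: RegD.
Qed.

End Regularity.

(** * Rapidly decreasing functions and the cosine transform *)

Section RapidDecay.
Variables (R : realType) (n : nat).
Implicit Types (x z : n.-tuple R) (f g : n.-tuple R -> R).

(** The order index is ignored: all derivatives obey the same kind of bound. The parameter type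
    [unit] makes a single function a family, so that [Reg] applies. *)
Definition rapid (_ : nat) (f : unit -> n.-tuple R -> R) :=
  forall N : nat, exists C, forall u x, (1 + norm1 x) ^+ N * `|f u x| <= C.
Definition wbound (_ : nat) (f : unit -> n.-tuple R -> R) :=
  exists C, forall u x, `|f u x| <= C * wt x.

Definition Rap k g := Reg setT rapid k 0 (fun=> g).
Definition Wreg k g := Reg setT wbound k 0 (fun=> g).

Lemma unit_fam (f : unit -> n.-tuple R -> R) : f = (fun=> f tt).
Proof. by apply/funext => -[]. Qed.

Lemma Rap_deriv k g i : Rap k.+1 g -> exists g',
  (forall x, haspd i g x (g' x)) /\ Rap k g'.
Proof.
move=> [_ _ /(_ i)[g' [dg rg]]]; exists (g' tt); split=> [x|].
  exact: dg tt x I.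
by rewrite /Rap -unit_fam; exact: Reg_idx rg.
Qed.

Lemma Wreg_deriv k g i : Wreg k.+1 g -> exists g',
  (forall x, haspd i g x (g' x)) /\ Wreg k g'.
Proof.
move=> [_ _ /(_ i)[g' [dg rg]]]; exists (g' tt); split=> [x|].
  exact: dg tt x I.
by rewrite /Wreg -unit_fam; exact: Reg_idx rg.
Qed.

Lemma Wreg_bound k g : Wreg k g -> exists C, forall x, `|g x| <= C * wt x.
Proof. by move=> /Reg_bound[C h]; exists C => x; exact: h tt x. Qed.

Lemma Rap_cont k g : Rap k g -> forall x, rcont_at g x.
Proof. by move=> h x; exact: (Reg_cont h tt (w := x) I). Qed.

Lemma Wreg_cont k g : Wreg k g -> forall x, rcont_at g x.
Proof. by move=> h x; exact: (Reg_cont h tt (w := x) I). Qed.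

(** Each of the n factors 1 + x_i^2 is at most (1 + |x|_1)^2; this is the source of the exponent
    2n. *)
Lemma inv_wt_le x : (wt x)^-1 <= (1 + norm1 x) ^+ (2 * n).
Proof.
rewrite /wt -prodfV exprM -[X in _ ^+ X](card_ord n) -prodr_const.
apply: ler_prod => i _; rewrite /wt1 invrK addr_ge0 ?sqr_ge0//=.
have /(_ i) := coord_le_norm1 x; have := norm1_ge0 x; set a := norm1 x.
rewrite -[tnth x i ^+ 2]real_normK ?num_real// => a0 xa.
rewrite (@le_trans _ _ (1 + a ^+ 2))//; first by rewrite lerD2l lerXn2r ?nnegrE.
by nra.
Qed.

Lemma rapid_wbound j (f : unit -> n.-tuple R -> R) : rapid j f -> wbound j f.
Proof.
move=> /(_ (2 * n)%N)[C hC]; exists C => u x.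
rewrite -ler_pdivrMr ?wt_gt0// (le_trans _ (hC u x))// mulrC.
by rewrite ler_wpM2r// inv_wt_le.
Qed.

Lemma Rap_Wreg k g : Rap k g -> Wreg k g.
Proof. exact: Reg_sub rapid_wbound. Qed.

Lemma Rap_le k k' g : (k' <= k)%N -> Rap k g -> Rap k' g.
Proof. exact: Reg_le. Qed.

Lemma rapid_add j (f g : unit -> n.-tuple R -> R) : rapid j f -> rapid j g ->
  rapid j (fun y w => f y w + g y w).
Proof.
move=> hf hg N; have [C hC] := hf N; have [D hD] := hg N.
exists (C + D) => u x; rewrite (le_trans _ (lerD (hC u x) (hD u x)))//.
by rewrite -mulrDr ler_wpM2l ?ler_normD// exprn_ge0// addr_ge0// norm1_ge0.
Qed.

Lemma RapD k f g : Rap k f -> Rap k g -> Rap k (fun x => f x + g x).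
Proof. exact: RegD rapid_add. Qed.

Lemma RapZ k (c : R) g : Rap k g -> Rap k (fun x => c * g x).
Proof.
pose B (_ : nat) (f : unit -> n.-tuple R -> R) := exists2 D, 0 <= D & forall u x, `|f u x| <= D.
rewrite /Rap -[X in Reg _ _ _ X _](addn0 0%N) => rg.
apply: (@RegM _ _ _ _ B rapid rapid k 0 0 (fun _ _ => c)) => //.
- exact: rapid_add.
- move=> j l f h [D D0 bf] rh N; have [C hC] := rh N; exists (D * C) => u x.
  rewrite normrM mulrCA ler_pM// mulr_ge0// exprn_ge0// addr_ge0// norm1_ge0//.
- apply: Reg_cst => [j|]; first by exists 0 => // u x; rewrite normr0.
  by exists `|c|.
Qed.

Lemma Rap_coord k i g : Rap k g -> Rap k (fun x => tnth x i * g x).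
Proof.
have rx j (f : unit -> n.-tuple R -> R) :
    rapid j f -> rapid j (fun u x => tnth x i * f u x).
  move=> hf N; have [C hC] := hf N.+1; exists C => u x.
  rewrite (le_trans _ (hC u x))// exprSr -mulrA ler_wpM2l//.
    by rewrite exprn_ge0// addr_ge0// norm1_ge0.
  rewrite normrM ler_wpM2r// (le_trans (coord_le_norm1 x i))//.
  by rewrite lerDr.
elim: k g => [|k IH] g rg; move: (rg) => [bg cg dg]; split=> //; try exact: rx;
  try by move=> y w _; apply: rcontM; [exact: rcont_tnth|exact: Rap_cont rg _].
move=> a; have [g' [dg' rg']] := Rap_deriv a rg.
exists (fun _ x => (i == a)%:R * g x + tnth x i * g' x); split.
  by move=> y w _; apply: haspdM; [exact: haspd_tnth|exact: dg'].
apply: (@Reg_idx _ _ _ _ _ _ 0) => //.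
by apply: RapD; [apply: RapZ; exact: Rap_le rg|exact: IH].
Qed.

End RapidDecay.

Section SchwartzRapid.
Variables (R : realType) (n : nat).

Lemma Re_le_cabs (z : R[i]) : `|complex.Re z| <= cabs z.
Proof. by rewrite -sqrtr_sqr ler_wsqrtr// lerDl sqr_ge0. Qed.

Lemma Im_le_cabs (z : R[i]) : `|complex.Im z| <= cabs z.
Proof. by rewrite -sqrtr_sqr ler_wsqrtr// lerDr sqr_ge0. Qed.

Lemma cabs_le (z : R[i]) : cabs z <= `|complex.Re z| + `|complex.Im z|.
Proof.
rewrite -(ler_pXn2r (n := 2)) ?nnegrE ?addr_ge0 ?sqrtr_ge0// sqr_sqrtr.
  rewrite sqrrD !real_normK ?num_real// -addrA lerD2l lerDr.
  by rewrite mulrn_wge0// mulr_ge0.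
by rewrite addr_ge0// sqr_ge0.
Qed.

Lemma schwartz_Rap (g : n.-tuple R -> R[i]) k : schwartz g ->
  Rap k (fun x => complex.Re (g x)) /\ Rap k (fun x => complex.Im (g x)).
Proof.
move=> [ex bd].
have rb s (h : R[i] -> R) : (forall z, `|h z| <= cabs z) ->
    rapid 0 (fun (_ : unit) x => h (cdpart s g x)).
  move=> hc N; have [C hC] := bd s N; exists ((n%:R + 1) ^+ N * C) => _ x.
  rewrite (@le_trans _ _ ((n%:R + 1) ^+ N * ((1 + enorm x) ^+ N * cabs (cdpart s g x))))//.
    rewrite mulrA ler_pM// ?exprn_ge0// ?addr_ge0 ?norm1_ge0// -exprMn.
    rewrite lerXn2r ?nnegrE ?addr_ge0 ?norm1_ge0 ?mulr_ge0// ?addr_ge0 ?enorm_ge0//.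
    have := norm1_le_enorm x; have := enorm_ge0 x; have := ler0n R n; nra.
  by rewrite ler_wpM2l// exprn_ge0// addr_ge0.
have bdd s (h : R[i] -> R) : (forall z, `|h z| <= cabs z) ->
    exists C, forall x, `|h (cdpart s g x)| <= C.
  move=> hc; have [C hC] := rb s h hc 0%N; exists C => x.
  by have := hC tt x; rewrite expr0 mul1r.
(* Each derivative is continuous because those of the next order are bounded. *)
have Re_c s x : rcont_at (fun y => complex.Re (cdpart s g y)) x.
  have /choice[C hC] : forall i, exists C, forall x, `|complex.Re (cdpart (i :: s) g x)| <= C.
    by move=> i; exact: (bdd (i :: s) _ Re_le_cabs).
  apply: (@rcont_bounded_partials _ _ _
      (fun i x => complex.Re (cdpart (i :: s) g x)) (\sum_i `|C i|)).
    by move=> i {}x; apply: rpartial_haspd; have [] := ex s i x.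
  move=> i {}x; rewrite (le_trans (hC i x))// (le_trans (ler_norm _))//.
  by rewrite (bigD1 i)//= lerDl sumr_ge0.
have Im_c s x : rcont_at (fun y => complex.Im (cdpart s g y)) x.
  have /choice[C hC] : forall i, exists C, forall x, `|complex.Im (cdpart (i :: s) g x)| <= C.
    by move=> i; exact: (bdd (i :: s) _ Im_le_cabs).
  apply: (@rcont_bounded_partials _ _ _
      (fun i x => complex.Im (cdpart (i :: s) g x)) (\sum_i `|C i|)).
    by move=> i {}x; apply: rpartial_haspd; have [] := ex s i x.
  move=> i {}x; rewrite (le_trans (hC i x))// (le_trans (ler_norm _))//.
  by rewrite (bigD1 i)//= lerDl sumr_ge0.
suff H s : Rap k (fun x => complex.Re (cdpart s g x)) /\
           Rap k (fun x => complex.Im (cdpart s g x)) by exact: (H [::]).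
elim: k s => [|k IH] s; split; split=> //;
  try exact: (rb _ _ Re_le_cabs); try exact: (rb _ _ Im_le_cabs);
  try (by move=> _ x _; exact: Re_c); try (by move=> _ x _; exact: Im_c).
- move=> i; exists (fun (_ : unit) (x : n.-tuple R) => complex.Re (cdpart (i :: s) g x)); split.
    by move=> _ x _; apply: rpartial_haspd; have [] := ex s i x.
  by apply: (@Reg_idx _ _ _ _ _ _ 0) => //; have [] := IH (i :: s).
- move=> i; exists (fun (_ : unit) (x : n.-tuple R) => complex.Im (cdpart (i :: s) g x)); split.
    by move=> _ x _; apply: rpartial_haspd; have [] := ex s i x.
  by apply: (@Reg_idx _ _ _ _ _ _ 0) => //; have [] := IH (i :: s).
Qed.

End SchwartzRapid.

Section Oscillation.
Variables (R : realType) (n : nat).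
Local Notation T := (n.-tuple R).
Implicit Types (x xi : T) (f g : T -> R) (tau : R).

(* The phase [tau] makes this class closed under differentiation and covers the
   sine transform as well. *)
Definition FT tau g x : R :=
  (\int[mleb R n]_xi (cos (2 * pi * dotp xi x + tau) * g xi))%R.

Lemma haspd_cos f a b x i D : haspd i f x D ->
  haspd i (fun z => cos (a * f z + b)) x (- (a * D) * sin (a * f x + b)).
Proof.
move=> hf; have hp : haspd i (fun z => a * f z + b) x (a * D).
  by apply: haspd_eq (haspdD (haspdZ a hf) (haspd_cst i b x)) _; rewrite addr0.
apply: haspd_eq (haspd_comp (is_derive_cos _) hp) _.
by rewrite !mulNr mulrC.
Qed.

Lemma haspd_sin f a b x i D : haspd i f x D ->
  haspd i (fun z => sin (a * f z + b)) x (a * D * cos (a * f x + b)).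
Proof.
move=> hf; have hp : haspd i (fun z => a * f z + b) x (a * D).
  by apply: haspd_eq (haspdD (haspdZ a hf) (haspd_cst i b x)) _; rewrite addr0.
by apply: haspd_eq (haspd_comp (is_derive_sin _) hp) _; rewrite mulrC.
Qed.

Lemma rcont_cos f a b x : rcont_at f x -> rcont_at (fun z => cos (a * f z + b)) x.
Proof.
move=> cf; apply: (rcont_comp (f := fun z => a * f z + b)).
  exact: continuous_cos.
by apply: rcontD; [apply: rcontM => //|]; exact: rcont_cst.
Qed.

Lemma rcont_dotpl y x : rcont_at (fun z => dotp z y) x.
Proof.
rewrite (_ : (fun z => dotp z y) = dotp y); first exact: rcont_dotp.
by apply/funext => z; rewrite dotpC.
Qed.

Lemma norm_cos_le1 (t : R) : `|cos t| <= 1.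
Proof. by rewrite ler_norml cos_geN1 cos_le1. Qed.

Lemma norm_sin_le1 (t : R) : `|sin t| <= 1.
Proof. by rewrite ler_norml sin_geN1 sin_le1. Qed.

Lemma le_norm_Rintegral_wt f C a : measurable_fun [set: T] f ->
  (forall x, `|f x| <= C * wt (vsub x a)) ->
  `|\int[mleb R n]_x f x|%R <= C * pi ^+ n.
Proof.
move=> mf bf; have fi := integrable_wt_shift mf bf.
rewrite (le_trans (le_normr_Rintegral _ fi))//.
rewrite -lee_fin /Rintegral fineK; last first.
  apply: integrable_fin_num => //.
  exact: (integrable_norm fi).
have -> : (C * pi ^+ n)%:E = (\int[mleb R n]_x (C * wt (vsub x a))%:E)%E.
  under eq_integral do rewrite EFinM.
  rewrite integralZl//; first by rewrite integral_wt_shift EFinM.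
  apply: (@integrable_wt_shift _ _ 1 a) => [|x].
    exact: measurable_wt_shift.
  by rewrite mul1r ger0_norm// wt_ge0.
apply: ge0_le_integral => //.
- by apply/measurable_EFinP; exact: measurableT_comp.
- apply/measurable_EFinP; apply: measurable_funM => //.
  exact: measurable_wt_shift.
- by move=> x _; rewrite lee_fin.
Qed.

End Oscillation.

Section CosineTransform.
Variables (R : realType) (n : nat).
Local Notation T := (n.-tuple R).
Implicit Types (x xi : T) (f g : T -> R) (tau : R).

Lemma vsub0 x : vsub x (vzero R n) = x.
Proof. by apply: eq_tuple => i; rewrite tnth_vsub tnth_mktuple subr0. Qed.

Lemma measurable_cosM tau x g : (forall xi, rcont_at g xi) ->
  measurable_fun [set: T] (fun xi => cos (2 * pi * dotp xi x + tau) * g xi).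
Proof.
move=> cg; apply: measurable_rcont => xi; apply: rcontM => //.
exact/rcont_cos/rcont_dotpl.
Qed.

Lemma cosM_le tau x g xi C : `|g xi| <= C ->
  `|cos (2 * pi * dotp xi x + tau) * g xi| <= C.
Proof.
by move=> gC; rewrite normrM (le_trans _ gC)// ler_piMl// norm_cos_le1.
Qed.

Lemma integrable_cosM k tau x g : Wreg k g ->
  (mleb R n).-integrable setT
    (EFin \o (fun xi => cos (2 * pi * dotp xi x + tau) * g xi)).
Proof.
move=> wg; have [C bg] := Wreg_bound wg.
apply: (@integrable_wt_shift _ _ C (vzero R n)).
  exact: measurable_cosM (Wreg_cont wg).
by move=> xi; rewrite vsub0 cosM_le.
Qed.

Lemma FT_bounded k g : Wreg k g -> exists C, forall tau x, `|FT tau g x| <= C.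
Proof.
move=> wg; have [C bg] := Wreg_bound wg; exists (C * pi ^+ n) => tau x.
apply: (@le_norm_Rintegral_wt _ _
  (fun xi => cos (2 * pi * dotp xi x + tau) * g xi) _ (vzero R n)).
  exact: measurable_cosM (Wreg_cont wg).
by move=> xi; rewrite vsub0 cosM_le.
Qed.

(** Differentiation under the integral sign, dominated by means of the weight bound on
    [tnth xi i * g xi]; the resulting -sin is a cosine advanced by pi/2. *)
Lemma FT_haspd k tau g i x : Rap k g ->
  haspd i (FT tau g) x (FT (tau + pi / 2) (fun xi => 2 * pi * (tnth xi i * g xi)) x).
Proof.
move=> rg; pose f (t : R) (xi : T) := cos (2 * pi * dotp xi (vupd x i t) + tau) * g xi.
pose D (t : R) (xi : T) :=
  - (2 * pi * tnth xi i) * sin (2 * pi * dotp xi (vupd x i t) + tau) * g xi.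
have df (t : R) xi : is_derive t 1 (f^~ xi) (D t xi).
  have hd z : haspd i (fun z => cos (2 * pi * dotp xi z + tau) * g xi) z
      (- (2 * pi * tnth xi i) * sin (2 * pi * dotp xi z + tau) * g xi).
    apply: haspd_eq (haspdM (haspd_cos _ _ (haspd_dotp i xi z)) (haspd_cst i (g xi) z)) _.
    by rewrite mulr0 addr0.
  exact: (haspd_line x hd t).
have wg := Rap_Wreg (Rap_coord i rg).
have [C bC] := Wreg_bound wg.
have C0 : 0 <= C.
  by have := le_trans (normr_ge0 _) (bC x); rewrite pmulr_lge0// wt_gt0.
have pi20 : 0 <= 2 * pi :> R by rewrite mulr_ge0// pi_ge0.
(* Only the derivative at 0 along the i-th direction is wanted, so any open interval around 0
   serves. *)
have I0 : (`]-1, 1[%classic : set R) 0.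
  by rewrite /= in_itv/= ltrN10 ltr01.
have fi (t : R) : `]-1, 1[%classic t -> (mleb R n).-integrable setT (EFin \o f t).
  by move=> _; exact: integrable_cosM (Rap_Wreg rg).
pose G (xi : T) := 2 * pi * (C * wt xi).
have G0 xi : 0 <= G xi by rewrite /G mulr_ge0// mulr_ge0// wt_ge0.
have iG : (mleb R n).-integrable setT (EFin \o G).
  apply: (@integrable_wt_shift _ _ (2 * pi * C) (vzero R n)).
    apply: measurable_funM => //; apply: measurable_funM => //.
    exact: measurable_wt.
  by move=> xi; rewrite vsub0 ger0_norm// /G mulrA.
have fG (t : R) xi : `]-1, 1[%classic t -> setT xi -> `|partial1of2 f t xi| <= G xi.
  move=> _ _; rewrite partial1of2E (@derive_val _ _ _ _ _ _ _ (df t xi)).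
  have -> : D t xi = 2 * pi * (tnth xi i * g xi) *
      - sin (2 * pi * dotp xi (vupd x i t) + tau) by rewrite /D; ring.
  rewrite normrM normrN [X in X * _]normrM [`|2 * pi|]ger0_norm// /G.
  apply: le_trans (ler_piMr _ (norm_sin_le1 _)) _; first by rewrite mulr_ge0.
  by rewrite ler_wpM2l.
have fd (t : R) xi : `]-1, 1[%classic t -> setT xi -> derivable (f^~ xi) t 1.
  by move=> _ _; case: (df t xi).
have := derivable_under_integral measurableT I0 fi fd G0 iG fG.
have := differentiation_under_integral measurableT I0 fi fd G0 iG fG.
rewrite derive1E => dE ex; apply: DeriveDef => //.
rewrite [LHS]dE; apply: eq_Rintegral => xi _.
rewrite partial1of2E (@derive_val _ _ _ _ _ _ _ (df 0 xi)) /D vupd0.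
by rewrite addrA cosDpihalf; ring.
Qed.

(** Dual to differentiation: the i-th derivative of sin(2 pi xi.x + tau) g(xi) in xi has integral
    zero, and its two terms are the two sides. *)
Lemma FT_coord k k' tau g g' i x : (forall xi, haspd i g xi (g' xi)) ->
  Wreg k g -> Wreg k' g' ->
  2 * pi * tnth x i * FT tau g x = FT (tau + pi / 2) g' x.
Proof.
move=> dg wg wg'.
have [C bC] := Wreg_bound wg; have [C' bC'] := Wreg_bound wg'.
have pos f D : (forall xi, `|f xi| <= D * wt xi) -> 0 <= D.
  by move=> b; have := le_trans (normr_ge0 _) (b x); rewrite pmulr_lge0// wt_gt0.
have C0 := pos _ _ bC; have C'0 := pos _ _ bC'.
pose F xi := sin (2 * pi * dotp xi x + tau) * g xi.
pose F1 xi := 2 * pi * tnth x i * (cos (2 * pi * dotp xi x + tau) * g xi).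
pose F2 xi := cos (2 * pi * dotp xi x + (tau + pi / 2)) * g' xi.
have hdotp xi : haspd i (fun z => dotp z x) xi (tnth x i).
  rewrite (_ : (fun z => dotp z x) = dotp x); first exact: haspd_dotp.
  by apply/funext => z; rewrite dotpC.
have dF xi : haspd i F xi (F1 xi - F2 xi).
  apply: haspd_eq (haspdM (haspd_sin _ _ (hdotp xi)) (dg xi)) _.
  by rewrite /F1 /F2 addrA cosDpihalf; ring.
have cF xi : rcont_at (fun xi => F1 xi - F2 xi) xi.
  apply: rcontD; first apply: rcontM; first exact: rcont_cst.
    by apply: rcontM; [exact/rcont_cos/rcont_dotpl|exact: (Wreg_cont wg)].
  apply: (rcont_comp (phi := -%R)); first exact: oppr_continuous.
  by apply: rcontM; [exact/rcont_cos/rcont_dotpl|exact: (Wreg_cont wg')].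
pose M := `|2 * pi * tnth x i| * C + C + C'.
have := @integral_haspd0 _ _ i F (fun xi => F1 xi - F2 xi) M (vzero R n) dF.
have -> : (\int[mleb R n]_xi (F1 xi - F2 xi)%:E)%E =
    (2 * pi * tnth x i * FT tau g x - FT (tau + pi / 2) g' x)%:E.
  have i1 := integrable_cosM tau x wg; have i2 := integrable_cosM (tau + pi / 2) x wg'.
  have i1' : (mleb R n).-integrable setT (EFin \o F1).
    rewrite (_ : EFin \o F1 = fun xi => ((2 * pi * tnth x i)%:E *
      (EFin \o (fun xi => cos (2 * pi * dotp xi x + tau) * g xi)%R) xi)%E).
      exact: integrableZl.
    by apply/funext => xi; rewrite /F1 /= EFinM.
  rewrite integralB_EFin//.
  rewrite /F1; under eq_integral do rewrite EFinM.
  rewrite integralZl// EFinB; congr (_ - _)%E.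
    rewrite [RHS]EFinM /FT /Rintegral fineK//.
    exact: (integrable_fin_num measurableT i1).
  by rewrite /FT /Rintegral fineK//; exact: (integrable_fin_num measurableT i2).
move=> h; apply/eqP; rewrite -subr_eq0; apply/eqP.
apply: EFin_inj; apply: h.
- by move=> y t; apply: (@rcont_line _ _ (fun xi => F1 xi - F2 xi)); exact: cF.
- exact: measurable_rcont.
- move=> xi; rewrite vsub0 (@le_trans _ _ (C * wt xi))//.
    by rewrite normrM (le_trans _ (bC xi))// ler_piMl// norm_sin_le1.
  rewrite ler_wpM2r ?wt_ge0// /M -addrA addrCA lerDl addr_ge0//.
  by rewrite mulr_ge0.
- move=> xi; rewrite vsub0 (le_trans (ler_normB _ _))//.
  rewrite (@le_trans _ _ (`|2 * pi * tnth x i| * (C * wt xi) + C' * wt xi))//.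
    rewrite lerD//; last exact: cosM_le.
    by rewrite normrM ler_wpM2l// cosM_le.
  rewrite mulrA -mulrDl ler_wpM2r ?wt_ge0// /M.
  by rewrite lerD2r lerDl.
Qed.

Lemma FTD k tau f g x : Wreg k f -> Wreg k g ->
  FT tau (fun xi => f xi + g xi) x = FT tau f x + FT tau g x.
Proof.
move=> wf wg.
rewrite /FT -(RintegralD measurableT (integrable_cosM _ _ wf) (integrable_cosM _ _ wg)).
by apply: eq_Rintegral => xi _; rewrite mulrDr.
Qed.

Lemma FTZ k tau c g x : Wreg k g -> FT tau (fun xi => c * g xi) x = c * FT tau g x.
Proof.
move=> wg; rewrite /FT -RintegralZl//; last exact: (integrable_cosM _ _ wg).
by apply: eq_Rintegral => xi _; rewrite mulrCA.
Qed.

Lemma FT_pi k tau g x : Wreg k g -> FT (tau + pi) g x = - FT tau g x.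
Proof.
move=> wg; rewrite -mulN1r /FT -(RintegralZl _ measurableT (integrable_cosM _ _ wg)).
by apply: eq_Rintegral => xi _; rewrite addrA cosDpi mulN1r mulNr.
Qed.

(** Two applications of [FT_coord] advance the phase by pi, which is a change of sign. Hence x_i^2
    acts as -(2 pi)^(-2) times a second derivative, and the phase [tau] is restored. *)
Lemma FT_sqr_coord k g i : Rap k.+2 g -> exists g', Rap k g' /\
  forall tau x, (1 + tnth x i ^+ 2) * FT tau g x = FT tau g' x.
Proof.
move=> rg; have [g1 [dg1 rg1]] := Rap_deriv i rg; have [g2 [dg2 rg2]] := Rap_deriv i rg1.
have kk : (k <= k.+2)%N by rewrite leqW.
pose c : R := - ((2 * pi) ^+ 2)^-1.
exists (fun xi => g xi + c * g2 xi); split.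
  by apply: RapD; [exact: Rap_le kk rg|exact: RapZ].
move=> tau x.
have wg := Rap_Wreg rg; have wg1 := Rap_Wreg rg1; have wg2 := Rap_Wreg rg2.
rewrite (FTD _ _ (Rap_Wreg (Rap_le kk rg)) (Rap_Wreg (RapZ c rg2))) (FTZ _ _ _ wg2).
rewrite -[FT tau g2 x]opprK -(FT_pi _ _ wg2) [in FT (tau + _)](splitr pi) addrA.
rewrite -(FT_coord _ _ dg2 wg1 wg2) -(FT_coord _ _ dg1 wg wg1) /c.
rewrite mulrNN (_ : _^-1 * _ = tnth x i ^+ 2 * FT tau g x).
  by rewrite mulrDl mul1r.
have pi0 : pi != 0 :> R by rewrite gt_eqF// pi_gt0.
by move: (FT tau g x) (pi : R) pi0 => F p p0; field.
Qed.

Lemma FT_prod_coord (l : seq 'I_n) k g : Rap ((size l).*2 + k) g ->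
  exists g', Rap k g' /\ forall tau x,
  \prod_(i <- l) (1 + tnth x i ^+ 2) * FT tau g x = FT tau g' x.
Proof.
elim: l k g => [|i l IH] k g rg.
  by exists g; split=> // tau x; rewrite big_nil mul1r.
have [g1 [rg1 e1]] := IH k.+2 g ltac:(by rewrite !addnS -!addSn -doubleS).
have [g2 [rg2 e2]] := FT_sqr_coord i rg1.
exists g2; split=> // tau x.
by rewrite big_cons -mulrA e1 e2.
Qed.

(** The inverse of [wt] is the product of the factors 1 + x_i^2, each of which costs two derivatives
    of g: hence [n.*2]. *)
Lemma FT_Wbound k g : Rap (n.*2 + k) g ->
  exists C, forall tau x, `|FT tau g x| <= C * wt x.
Proof.
move=> rg; have [|g' [rg' e]] := @FT_prod_coord (enum 'I_n) k g.
  by rewrite size_enum_ord.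
have [C hC] := FT_bounded (Rap_Wreg rg').
exists C => tau x; rewrite -ler_pdivrMr ?wt_gt0// (le_trans _ (hC tau x))//.
rewrite -e normrM mulrC ler_wpM2r// (le_trans _ (ler_norm _))//.
by rewrite /wt -prodfV big_enum/= le_eqVlt; apply/orP; left; apply/eqP;
  apply: eq_bigr => i _; rewrite /wt1 invrK.
Qed.

(** The order k is arbitrary although the smoothness of g is fixed: differentiating the transform
    multiplies g by coordinates, which costs decay and no derivatives. *)
Lemma FT_Wreg k tau g : Rap n.*2.+1 g -> Wreg k (FT tau g).
Proof.
move=> rg.
have cF t h : Rap n.*2.+1 h -> forall x, rcont_at (FT t h) x.
  move=> rh.
  have /choice[C hC] : forall i, exists C, forall t x,
      `|FT t (fun xi => 2 * pi * (tnth xi i * h xi)) x| <= C.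
    by move=> i; exact: FT_bounded (Rap_Wreg (RapZ _ (Rap_coord i rh))).
  apply: (@rcont_bounded_partials _ _ _ (fun i x =>
    FT (t + pi / 2) (fun xi => 2 * pi * (tnth xi i * h xi)) x) (\sum_i `|C i|)).
    by move=> i x; exact: FT_haspd rh.
  move=> i x; rewrite (le_trans (hC i _ x))// (le_trans (ler_norm _))//.
  by rewrite (bigD1 i)//= lerDl sumr_ge0.
have bF t (h : T -> R) : Rap n.*2.+1 h -> wbound 0 (fun _ : unit => FT t h).
  rewrite -addn1 => rh; have [C hC] := FT_Wbound rh.
  by exists C => _ x; exact: hC.
rewrite /Wreg; elim: k tau g rg => [|k IH] tau g rg; split=> //;
  try (by move=> _ x _; exact: cF); try exact: bF.
move=> i; exists (fun=> FT (tau + pi / 2) (fun xi => 2 * pi * (tnth xi i * g xi))).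
split; first by move=> _ x _; exact: FT_haspd rg.
apply: (@Reg_idx _ _ _ _ _ _ 0) => //; apply: IH.
exact/RapZ/Rap_coord.
Qed.

End CosineTransform.

(** * Homogeneous functions and symbols *)

Section Sphere.
Variables (R : realType) (n : nat).
Local Notation T := (n.-tuple R).

(* Large finite sets of centres: compactness in its near-covering form along
   this filter yields a finite subcover. *)
Definition supseq (A : eqType) : set_system (seq A) :=
  [set P : set (seq A) | exists s0 : seq A, forall s : seq A, {subset s0 <= s} -> P s].

Global Instance supseq_filter (A : eqType) : Filter (@supseq A).
Proof.
split.
- by exists [::].
- move=> P Q [s hs] [t ht]; exists (s ++ t) => u stu; split.
    by apply: hs => x xs; apply: stu; rewrite mem_cat xs.
  by apply: ht => x xs; apply: stu; rewrite mem_cat xs orbT.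
- by move=> P Q PQ [s hs]; exists s => u /hs /PQ.
Qed.

(** Tuples are transported to row vectors, where cubes are known to be compact. *)
Lemma sphere_cover (P : T -> set T) :
  (forall om, enorm om = 1 -> nbt om (P om)) ->
  exists s : seq T, (forall om, om \in s -> enorm om = 1) /\
    forall w, enorm w = 1 -> exists2 om, om \in s & P om w.
Proof.
move=> hP.
pose tov (v : 'rV[R]_n) : T := [tuple v ord0 i | i < n].
have ctov v : tov @ nbhs v --> nbt (tov v).
  apply: cvg_tuple => i; rewrite tnth_mktuple.
  under eq_fun do rewrite tnth_mktuple; exact: coord_continuous.
pose K := [set v : 'rV[R]_n | enorm (tov v) = 1].
have cK : compact K.
  apply: (@subclosed_compact _ _ [set v : 'rV[R]_n | forall i, (`[-1, 1]%classic : set R) (v ord0 i)]).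
  - rewrite (_ : K = (fun v => enorm (tov v)) @^-1` [set 1])//.
    apply: closed_comp; last exact: closed_eq.
    by move=> v _; exact: (cvg_comp _ _ (ctov v) (@enorm_cvg _ _ (tov v))).
  - apply: (@rV_compact R n (fun=> (`[-1, 1]%classic : set R))) => _.
    exact: segment_compact.
  - move=> v Kv i; rewrite /= in_itv/= -ler_norml -Kv.
    by have := coord_le_enorm (tov v) i; rewrite tnth_mktuple.
have /compact_near_coveringP nK := cK.
(* Near-covering ranges over all large finite sequences, so their entries are filtered back to the
   sphere. *)
pose Q (s : seq T) (v : 'rV[R]_n) :=
  exists2 om, om \in [seq x <- s | enorm x == 1] & P om (tov v).
have [v Kv|s0 hs0] := nK _ _ Q (@supseq_filter T).
  exists ([set v' | P (tov v) (tov v')], [set s : seq T | tov v \in s]).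
    split; first exact: (ctov v _ (hP _ Kv)).
    by exists [:: tov v] => s; apply; rewrite inE.
  move=> [v' s] /= [Pv vs]; exists (tov v) => //.
  by rewrite mem_filter vs andbT; apply/eqP.
exists [seq x <- s0 | enorm x == 1]; split.
  by move=> om; rewrite mem_filter => /andP[/eqP].
move=> w w1; pose v : 'rV[R]_n := \row_i tnth w i.
have tv : tov v = w by apply: eq_tuple => i; rewrite tnth_mktuple mxE.
have := hs0 s0 (fun x h => h) v; rewrite /K/= tv => /(_ w1).
by rewrite /Q tv.
Qed.

Lemma tnth_vscale (c : R) (x : T) i : tnth (vscale c x) i = c * tnth x i.
Proof. by rewrite tnth_mktuple. Qed.

Lemma dotp_vscale (c : R) (x : T) : dotp (vscale c x) (vscale c x) = c ^+ 2 * dotp x x.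
Proof.
rewrite /dotp mulr_sumr; apply: eq_bigr => i _.
by rewrite !tnth_vscale; ring.
Qed.

Lemma enorm_vscale (c : R) (x : T) : 0 <= c -> enorm (vscale c x) = c * enorm x.
Proof. by move=> c0; rewrite /enorm dotp_vscale sqrtrM ?sqr_ge0// sqrtr_sqr ger0_norm. Qed.

Lemma vscaleA (a b : R) (x : T) : vscale a (vscale b x) = vscale (a * b) x.
Proof. by apply: eq_tuple => i; rewrite !tnth_vscale mulrA. Qed.

Lemma vscale1 (x : T) : vscale 1 x = x.
Proof. by apply: eq_tuple => i; rewrite tnth_vscale mul1r. Qed.

Lemma enorm_unit (w : T) : w <> vzero R n -> enorm (vscale (enorm w)^-1 w) = 1.
Proof.
move=> w0; have w1 := enorm_gt0 w0.
by rewrite enorm_vscale ?invr_ge0 ?ltW// mulVf// gt_eqF.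
Qed.

Lemma vscale_unit (w : T) : w <> vzero R n ->
  w = vscale (enorm w) (vscale (enorm w)^-1 w).
Proof. by move=> w0; rewrite vscaleA divff ?vscale1// gt_eqF// enorm_gt0. Qed.

Lemma sphere_bounded (f : T -> R) : (forall w, w <> vzero R n -> rcont_at f w) ->
  exists2 C, 0 <= C & forall w, enorm w = 1 -> `|f w| <= C.
Proof.
move=> cf.
have [om om1|s [s1 hs]] := @sphere_cover (fun om => [set w | `|f w| < `|f om| + 1]).
  have om0 : om <> vzero R n.
    by move=> e; move/eqP: om1; rewrite e (eqP (_ : enorm _ == 0)) ?enorm_eq0// eq_sym oner_eq0.
  have [del d0 hd] := cf _ om0 1 ltr01.
  exists del => // z /hd /= h; rewrite -ltrBlDl (le_lt_trans _ h)//.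
  exact: lerB_dist.
exists (\sum_(om <- s) (`|f om| + 1)); first by apply: sumr_ge0.
move=> w /hs[om oms /= h]; apply: (le_trans (ltW h)).
rewrite (big_rem om)//= lerDl; apply: sumr_ge0 => om' _; exact: addr_ge0.
Qed.

Lemma nbt_neq0 (w : T) : w <> vzero R n -> nbt w [set z | z <> vzero R n].
Proof.
move=> w0; exists (enorm w); first exact: enorm_gt0.
move=> z zw z0; move: zw; rewrite z0 ltNge => /negP; apply.
rewrite (_ : enorm (vsub _ w) = enorm w)//; rewrite /enorm; congr Num.sqrt.
by apply: eq_bigr => i _; rewrite tnth_vsub tnth_mktuple; ring.
Qed.

Lemma dotp_gt0 (w : T) : w <> vzero R n -> 0 < dotp w w.
Proof. by move=> w0; rewrite -sqr_enorm exprn_gt0// enorm_gt0. Qed.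

End Sphere.

Section Homogeneous.
Variables (R : realType) (n : nat).
Local Notation T := (n.-tuple R).

Definition off0 : set T := [set w | w <> vzero R n].

(* Each derivative lowers the degree by one. *)
Definition hom (kap : R) (j : nat) (f : unit -> T -> R) :=
  forall u lam w, 0 < lam -> w <> vzero R n ->
    f u (vscale lam w) = lam `^ (kap - j%:R) * f u w.

Definition Hom k kap (f : T -> R) := Reg off0 (hom kap) k 0 (fun=> f).

Lemma Reg_hom_idx k j j' kap kap' f : kap - j%:R = kap' - j'%:R ->
  Reg off0 (hom kap) k j f -> Reg off0 (hom kap') k j' f.
Proof.
elim: k j j' f => [|k IH] j j' f e [bf cf df]; split=> //;
  try by move=> u lam w l0 w0; rewrite bf// e.
move=> i; have [f' [df' rf']] := df i; exists f'; split=> //; apply: IH rf'.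
by rewrite -!natr1 !opprD !addrA e.
Qed.

Lemma Hom_cont k kap f w : Hom k kap f -> w <> vzero R n -> rcont_at f w.
Proof. by move=> h w0; exact: (Reg_cont h tt w0). Qed.

Lemma Hom_hom k kap f lam w : Hom k kap f -> 0 < lam -> w <> vzero R n ->
  f (vscale lam w) = lam `^ kap * f w.
Proof. by move=> /Reg_bound h l0 w0; have := h tt _ _ l0 w0; rewrite subr0. Qed.

Lemma Hom_deriv k kap f i : Hom k.+1 kap f -> exists f',
  (forall w, w <> vzero R n -> haspd i f w (f' w)) /\ Hom k (kap - 1) f'.
Proof.
move=> [_ _ /(_ i)[f' [df' rf']]]; exists (f' tt); split=> [w w0|].
  exact: df'.
apply: (@Reg_hom_idx _ 1%N 0%N kap); first by rewrite subr0.
by rewrite (_ : (fun=> f' tt) = f')//; apply/funext => -[].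
Qed.

Lemma HomS k kap f :
  (forall lam w, 0 < lam -> w <> vzero R n -> f (vscale lam w) = lam `^ kap * f w) ->
  (forall w, w <> vzero R n -> rcont_at f w) ->
  (forall i, exists f', (forall w, w <> vzero R n -> haspd i f w (f' w)) /\
     Hom k (kap - 1) f') -> Hom k.+1 kap f.
Proof.
move=> hf cf df; split=> // [u lam w l0 w0|i]; first by rewrite subr0 hf.
have [f' [df' rf']] := df i; exists (fun=> f'); split=> //.
by apply: Reg_hom_idx rf'; rewrite subr0.
Qed.

Lemma Hom0 kap f :
  (forall lam w, 0 < lam -> w <> vzero R n -> f (vscale lam w) = lam `^ kap * f w) ->
  (forall w, w <> vzero R n -> rcont_at f w) -> Hom 0 kap f.
Proof. by move=> hf cf; split=> // u lam w l0 w0; rewrite subr0 hf. Qed.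

Lemma Hom_exp k kap kap' f : kap = kap' -> Hom k kap f -> Hom k kap' f.
Proof. by move=> ->. Qed.

Lemma HomM k kap kap' f g : Hom k kap f -> Hom k kap' g ->
  Hom k (kap + kap') (fun w => f w * g w).
Proof.
apply: (RegM (j := 0) (l := 0)) => [j {}f {}g|j l {}f {}g] hf hg u lam w l0 w0.
  by rewrite hf// hg// mulrDr.
rewrite hf// hg// mulrACA -powRD; last by rewrite (gt_eqF l0) implybT.
by congr (_ `^ _ * _); rewrite natrD; ring.
Qed.

Lemma HomZ k kap c f : Hom k kap f -> Hom k kap (fun w => c * f w).
Proof.
rewrite -{2}[kap]add0r; apply: HomM; apply: Reg_cst.
  by move=> j u lam w _ _; rewrite mulr0.
by move=> u lam w _ _; rewrite subr0 powRr0 mul1r.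
Qed.

Lemma Hom_coord k i : Hom k 1 (fun w => tnth w i).
Proof.
have h lam (w : T) : 0 < lam -> w <> vzero R n ->
    tnth (vscale lam w) i = lam `^ 1 * tnth w i.
  by move=> l0 _; rewrite powRr1 ?(ltW l0)// tnth_vscale.
have c (w : T) : w <> vzero R n -> rcont_at (fun w => tnth w i) w.
  by move=> _; exact: rcont_tnth.
case: k => [|k]; first exact: Hom0.
apply: HomS => // a; exists (fun=> (i == a)%:R); split=> [w _|].
  exact: haspd_tnth.
rewrite subrr; apply: Reg_cst; first by move=> j u lam w _ _; rewrite mulr0.
by move=> u lam w _ _; rewrite subr0 powRr0 mul1r.
Qed.

Definition r2inv (w : T) : R := (dotp w w)^-1.

Lemma haspd_dotp_powR (a : R) i (w : T) : w <> vzero R n ->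
  haspd i (fun z => dotp z z `^ a) w (2 * a * tnth w i * r2inv w * dotp w w `^ a).
Proof.
move=> w0; have s0 := dotp_gt0 w0.
have hp := @is_derive1_powR _ a _ s0.
have h := haspd_comp (f := fun z => dotp z z) hp (haspd_sqr i w); apply: (haspd_eq h).
rewrite powRB; last by rewrite (gt_eqF s0) implybT.
by rewrite powRr1 ?(ltW s0)// /r2inv; ring.
Qed.

Lemma rcont_dotp_powR (a : R) (w : T) : w <> vzero R n ->
  rcont_at (fun z => dotp z z `^ a) w.
Proof.
move=> w0; have s0 := dotp_gt0 w0.
apply: (@rcont_comp R n (fun s => s `^ a) (fun z : T => dotp z z) w).
  apply: differentiable_continuous; apply/derivable1_diffP.
  by apply: derivable_powR; rewrite in_itv/= s0.
exact: rcont_sqr.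
Qed.

Lemma r2invE (w : T) : r2inv w = dotp w w `^ (-1).
Proof. by rewrite powR_inv1// dotp_ge0. Qed.

Lemma hom_dotp_powR (a : R) lam (w : T) : 0 < lam ->
  dotp (vscale lam w) (vscale lam w) `^ a = lam `^ (2 * a) * dotp w w `^ a.
Proof.
move=> l0; rewrite dotp_vscale powRM ?sqr_ge0 ?dotp_ge0//.
by rewrite powRrM powR_mulrn// ltW.
Qed.

(** The class of these powers times coordinates is stable under differentiation; a derivative
    involves the exponents a and -1, so the induction on k keeps the exponent general. *)
Lemma Hom_dotp_powR k (a : R) : Hom k (2 * a) (fun w => dotp w w `^ a).
Proof.
elim: k a => [|k IH] a.
  apply: Hom0 => [lam w l0 _|w]; [exact: hom_dotp_powR|exact: rcont_dotp_powR].
apply: HomS => [lam w l0 _|w|i]; [exact: hom_dotp_powR|exact: rcont_dotp_powR|].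
exists (fun w => 2 * a * tnth w i * r2inv w * dotp w w `^ a); split.
  by move=> w; exact: haspd_dotp_powR.
rewrite (_ : (fun w => _) =
  (fun w => (2 * a) * (tnth w i * (dotp w w `^ (-1) * dotp w w `^ a)))); last first.
  by apply/funext => w; rewrite -r2invE; ring.
apply: HomZ; apply: (@Hom_exp _ (1 + (2 * (- 1) + 2 * a))); first by ring.
by apply: HomM; [exact: Hom_coord|exact: HomM].
Qed.

Lemma Hom_r2inv k : Hom k (-2) r2inv.
Proof.
rewrite (_ : r2inv = fun w => dotp w w `^ (-1)).
  by apply: (@Hom_exp _ (2 * -1)); [ring|exact: Hom_dotp_powR].
by apply/funext => w; rewrite r2invE.
Qed.

(* Differentiate f (lam w + t e_i) = lam^kap f (w + (t / lam) e_i). *)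
Lemma hom_partial kap f f' i :
  (forall lam w, 0 < lam -> w <> vzero R n -> f (vscale lam w) = lam `^ kap * f w) ->
  (forall w, w <> vzero R n -> haspd i f w (f' w)) ->
  forall lam w, 0 < lam -> w <> vzero R n ->
    f' (vscale lam w) = lam `^ (kap - 1) * f' w.
Proof.
move=> hf df lam w l0 w0.
have lw0 : vscale lam w <> vzero R n.
  move=> e; have := dotp_gt0 w0; rewrite -(pmulr_rgt0 _ (exprn_gt0 2 l0)) -dotp_vscale e.
  rewrite /dotp big1 ?ltxx// => j _; by rewrite tnth_mktuple mul0r.
apply: (haspd_unique (df _ lw0)).
have hg : is_derive (0 : R) 1 (fun t => lam `^ kap * f (vupd w i (lam^-1 * t)))
    (lam `^ (kap - 1) * f' w).
  have h1 : is_derive (0 : R) 1 (fun t : R => lam^-1 * t) lam^-1.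
    rewrite -[X in is_derive _ _ _ X]mulr1.
    exact: is_deriveZ.
  have h2 : is_derive (lam^-1 * 0) 1 (fun t => f (vupd w i t)) (f' w).
    by rewrite mulr0; exact: df.
  have h3 := is_derive1_comp h2 h1.
  have := @is_deriveZ _ _ _ _ (lam `^ kap) (0 : R) (1 : R) _ h3.
  rewrite powRB; last by rewrite (gt_eqF l0) implybT.
  by rewrite powRr1 ?(ltW l0)// /GRing.scale/= -mulrA [lam^-1 * _]mulrC.
rewrite /haspd; apply: (near_eq_is_derive _ hg).
have := vupd_cvg (x := w) (i := i) (t := 0); rewrite vupd0 => cv.
have sc : (fun t : R => lam^-1 * t) @ (0 : R) --> (0 : R).
  by rewrite -[X in _ --> X](mulr0 lam^-1); apply: cvgM; [exact: cvg_cst|exact: cvg_id].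
have hn : \forall t \near (0 : R), vupd w i (lam^-1 * t) <> vzero R n.
  exact: (cvg_comp _ _ sc cv _ (nbt_neq0 w0)).
apply: (filterS _ hn) => t ht; rewrite -(hf _ _ l0 ht); congr f.
apply: eq_tuple => j; rewrite !(tnth_vscale, tnth_vupd).
by case: eqP => // _; rewrite mulrDr mulrA divff ?mul1r// gt_eqF.
Qed.

Lemma haspd_rdpart mu s w i : smooth_off0 mu -> w <> vzero R n ->
  haspd i (rdpart s mu) w (rdpart (i :: s) mu w).
Proof. by move=> sm w0; have [_ h] := sm s w w0; exact: rpartial_haspd. Qed.

Lemma smooth_Hom mu (m : R) k s : smooth_off0 mu ->
  (forall (lam : R) (x : T), 0 < lam -> x <> vzero R n ->
     mu (vscale lam x) = lam `^ m * mu x) -> Hom k (m - (size s)%:R) (rdpart s mu).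
Proof.
move=> sm hm.
have hs s' lam w : 0 < lam -> w <> vzero R n ->
    rdpart s' mu (vscale lam w) = lam `^ (m - (size s')%:R) * rdpart s' mu w.
  elim: s' lam w => [|i s' IH] lam w l0 w0; first by rewrite subr0 /rdpart/= hm.
  rewrite (hom_partial IH (f' := rdpart (i :: s') mu) (i := i) _ l0 w0).
    by rewrite /= -[in RHS]natr1 opprD addrA.
  by move=> z z0; exact: haspd_rdpart.
elim: k s => [|k IH] s.
  by apply: Hom0 => [lam w|w w0]; [exact: hs|case: (sm s w w0)].
apply: HomS => [lam w|w w0|i]; [exact: hs|by case: (sm s w w0)|].
exists (rdpart (i :: s) mu); split; first by move=> w w0; exact: haspd_rdpart.
by apply: Hom_exp (IH (i :: s)); rewrite /= -[in LHS]natr1 opprD addrA.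
Qed.

End Homogeneous.

Section Inverse.
Variables (R : realType) (n : nat).
Local Notation T := (n.-tuple R).

Lemma rcontV (f : T -> R) x : f x != 0 -> rcont_at f x -> rcont_at (fun z => (f z)^-1) x.
Proof. by move=> fx /rcontP hf; apply/rcontP; exact: cvgV. Qed.

Lemma haspdV i (f : T -> R) x D : f x != 0 -> haspd i f x D ->
  haspd i (fun z => (f z)^-1) x (- (f x) ^- 2 * D).
Proof.
move=> fx hf; have := @is_deriveV R (fun t => f (vupd x i t)) 0 D 1.
by rewrite vupd0 => /(_ fx hf).
Qed.

End Inverse.

(** * Symbols measured in powers of r, and the resolvent of u *)

Section Symbols.
Variables (R : realType) (n : nat) (Y : Type).
Local Notation T := (n.-tuple R).
Variables (Om : set T) (r : Y -> T -> R).
Hypothesis r0 : forall y w, 0 <= r y w.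
Hypothesis r1 : forall y w, r y w <= 1.

(* Unlike for the usual symbol classes, no decay is gained by differentiating. *)
Definition bsym N (_ : nat) (f : Y -> T -> R) :=
  exists C, forall y w, Om w -> `|f y w| <= C * r y w ^+ N.

Definition Sym k N (f : Y -> T -> R) := Reg Om (bsym N) k 0 f.

Lemma bsym_ge0 N j f : bsym N j f ->
  exists2 C, 0 <= C & forall y w, Om w -> `|f y w| <= C * r y w ^+ N.
Proof.
move=> [C hC]; exists `|C| => // y w Ow; rewrite (le_trans (hC y w Ow))//.
by rewrite ler_wpM2r ?ler_norm// exprn_ge0.
Qed.

Lemma bsymD N j f g : bsym N j f -> bsym N j g -> bsym N j (fun y w => f y w + g y w).
Proof.
move=> [C hC] [D hD]; exists (C + D) => y w Ow.
by rewrite (le_trans (ler_normD _ _))// mulrDl lerD ?hC ?hD.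
Qed.

Lemma bsym_zero N j : bsym N j (fun _ _ => 0).
Proof. by exists 0 => y w _; rewrite normr0 mul0r. Qed.

Lemma SymD k N f g : Sym k N f -> Sym k N g -> Sym k N (fun y w => f y w + g y w).
Proof. by apply: RegD => j {}f {}g; exact: bsymD. Qed.

Lemma SymM k N N' f g : Sym k N f -> Sym k N' g ->
  Sym k (N + N') (fun y w => f y w * g y w).
Proof.
apply: (RegM (j := 0) (l := 0)) => [j {}f {}g|j l {}f {}g]; first exact: bsymD.
move=> /bsym_ge0[C C0 hC] /bsym_ge0[D D0 hD]; exists (C * D) => y w Ow.
by rewrite normrM exprD mulrACA ler_pM ?hC ?hD.
Qed.

Lemma Sym_le k k' N N' f : (k' <= k)%N -> (N' <= N)%N -> Sym k N f -> Sym k' N' f.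
Proof.
move=> kk NN /(Reg_le kk); apply: Reg_sub => j {}f /bsym_ge0[C C0 hC].
exists C => y w Ow; rewrite (le_trans (hC y w Ow))// ler_wpM2l//.
by rewrite ler_wiXn2l.
Qed.

Lemma Sym_cst k c : Sym k 0 (fun _ _ => c).
Proof.
apply: Reg_cst => [j|]; first exact: bsym_zero.
by exists `|c| => y w _; rewrite expr0 mulr1.
Qed.

Lemma SymZ k N c f : Sym k N f -> Sym k N (fun y w => c * f y w).
Proof. by move=> h; rewrite -[N]add0n; apply: SymM h; exact: Sym_cst. Qed.

Lemma Sym_sum k N I (s : seq I) (f : I -> Y -> T -> R) :
  (forall a, Sym k N (f a)) -> Sym k N (fun y w => \sum_(a <- s) f a y w).
Proof.
by apply: Reg_sum => [j|j {}f g]; [exact: bsym_zero|exact: bsymD].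
Qed.

Lemma Sym_deriv k N f i : Sym k.+1 N f -> exists f',
  (forall y w, Om w -> haspd i (f y) w (f' y w)) /\ Sym k N f'.
Proof.
move=> [_ _ /(_ i)[f' [df' rf']]]; exists f'; split=> //; exact: Reg_idx rf'.
Qed.

Lemma SymS k N f : bsym N 0 f -> (forall y w, Om w -> rcont_at (f y) w) ->
  (forall i, exists f', (forall y w, Om w -> haspd i (f y) w (f' y w)) /\ Sym k N f') ->
  Sym k.+1 N f.
Proof.
move=> bf cf df; split=> // i; have [f' [df' rf']] := df i.
by exists f'; split=> //; exact: Reg_idx rf'.
Qed.

Lemma Sym_bound k N f : Sym k N f ->
  exists2 C, 0 <= C & forall y w, Om w -> `|f y w| <= C * r y w ^+ N.
Proof. by move=> /Reg_bound/bsym_ge0. Qed.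

Lemma Sym_cont k N f y w : Sym k N f -> Om w -> rcont_at (f y) w.
Proof. by move=> h; exact: (Reg_cont h). Qed.

(** Scale to the unit sphere, where continuity gives a bound; for nonpositive degree the radial
    factor is largest at the inner radius 1/2. *)
Lemma Hom_bsym k kap f : (forall w, Om w -> 2^-1 <= enorm w) -> kap <= 0 ->
  Hom k kap f -> bsym 0 0 (fun _ => f).
Proof.
move=> hOm kap0 hf.
have cf w : w <> vzero R n -> rcont_at f w by exact: Hom_cont hf.
have [C C0 hC] := sphere_bounded cf.
exists (2^-1 `^ kap * C) => y w Ow; rewrite expr0 mulr1.
have w0 : w <> vzero R n.
  move=> /eqP; rewrite -enorm_eq0 => /eqP e.
  by move: (hOm w Ow); rewrite e leNgt invr_gt0 ltr0n.
have w1 := enorm_gt0 w0.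
have u0 : vscale (enorm w)^-1 w <> vzero R n.
  by move=> /eqP; rewrite -enorm_eq0 enorm_unit// oner_eq0.
rewrite {1}(vscale_unit w0) (Hom_hom hf)// normrM ler_pM//.
  rewrite ger0_norm ?powR_ge0// -[kap]opprK !(powRN _ (- kap)).
  rewrite lef_pV2 ?posrE ?powR_gt0 ?invr_gt0//.
  by apply: ge0_ler_powR; rewrite ?oppr_ge0// ?nnegrE ?invr_ge0 ?enorm_ge0// hOm.
by apply: hC; exact: enorm_unit.
Qed.

(** Differentiation lowers the degree further, so every derivative remains covered by [Hom_bsym]. *)
Lemma Hom_Sym k kap f : (forall w, Om w -> 2^-1 <= enorm w) -> kap <= 0 ->
  Hom k kap f -> Sym k 0 (fun _ => f).
Proof.
move=> hOm; have O0 w : Om w -> w <> vzero R n.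
  move=> /hOm h /eqP; rewrite -enorm_eq0 => /eqP e.
  by move: h; rewrite e leNgt invr_gt0 ltr0n.
elim: k kap f => [|k IH] kap f kap0 hf.
  split=> //; first exact: Hom_bsym hf.
  by move=> y w /O0; exact: Hom_cont hf.
apply: SymS; first exact: Hom_bsym hf.
  by move=> y w /O0; exact: Hom_cont hf.
move=> i; have [f' [df' hf']] := Hom_deriv i hf.
exists (fun _ => f'); split; first by move=> y w /O0; exact: df'.
by apply: IH hf'; rewrite subr_le0 (le_trans kap0).
Qed.

End Symbols.

Section Resolvent.
Variables (R : realType) (n : nat) (Y : Type).
Local Notation T := (n.-tuple R).
Variables (Om : set T) (u : 'I_n -> Y -> T -> R).
Variables (p : 'I_n -> 'I_n -> T -> R) (q : 'I_n -> T -> R).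

(** With r as in the overview, these are r^2, u_j r^2 and r. Since u_j may be as large as 1/r,
    [rese j] is only of order r. *)
Definition resv (y : Y) (w : T) : R := (1 + \sum_(j < n) u j y w ^+ 2)^-1.
Definition rese j (y : Y) (w : T) : R := u j y w * resv y w.
Definition resr (y : Y) (w : T) : R := Num.sqrt (resv y w).

Let den_gt0 y w : 0 < 1 + \sum_(j < n) u j y w ^+ 2.
Proof. by rewrite ltr_pwDl// sumr_ge0// => j _; exact: sqr_ge0. Qed.

Lemma resv_gt0 y w : 0 < resv y w.
Proof. by rewrite invr_gt0. Qed.

Lemma resv_le1 y w : resv y w <= 1.
Proof. by rewrite invf_le1// lerDl sumr_ge0// => j _; exact: sqr_ge0. Qed.

Lemma resr_ge0 y w : 0 <= resr y w.
Proof. exact: sqrtr_ge0. Qed.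

Lemma resr_le1 y w : resr y w <= 1.
Proof. by rewrite -[leRHS]sqrtr1 ler_wsqrtr// resv_le1. Qed.

Lemma sqr_resr y w : resr y w ^+ 2 = resv y w.
Proof. by rewrite sqr_sqrtr// ltW// resv_gt0. Qed.

Lemma resv_le_resr y w : resv y w <= resr y w.
Proof. by rewrite -sqr_resr expr2 ler_piMr// ?resr_ge0 ?resr_le1. Qed.

Let den_neq0 y w : 1 + \sum_(j < n) u j y w ^+ 2 != 0.
Proof. by rewrite gt_eqF. Qed.

Lemma sum_urese y w : \sum_(j < n) u j y w * rese j y w = 1 - resv y w.
Proof.
under eq_bigr do rewrite /rese mulrA -expr2.
rewrite -mulr_suml /resv; have := den_neq0 y w.
by move: (\sum_(j < n) _) => S S0; field.
Qed.

Lemma norm_rese_le j y w : `|rese j y w| <= resr y w.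
Proof.
have v0 := resv_gt0 y w.
rewrite /rese normrM (gtr0_norm v0) -{1}sqr_resr expr2 mulrA ler_piMl ?resr_ge0//.
rewrite -[leRHS]sqrtr1 -sqrtr_sqr -sqrtrM ?sqr_ge0//.
rewrite ler_wsqrtr// /resv ler_pdivrMr// mul1r (bigD1 j)//= addrCA lerDl.
by rewrite addr_ge0// sumr_ge0// => i _; exact: sqr_ge0.
Qed.

(** The logarithmic derivative of [resv] in direction k. It is written through [rese] and [resv] so
    that the unbounded u never stands alone. *)
Definition resA k (y : Y) (w : T) : R :=
  -2 * (\sum_(l < n) p l k w * rese l y w) + -2 * (q k w * (1 + -1 * resv y w)).

Hypothesis hu : forall j k y w, Om w ->
  haspd k (u j y) w (p j k w + q k w * u j y w).

Lemma haspd_resv k y w : Om w -> haspd k (resv y) w (resv y w * resA k y w).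
Proof.
move=> Ow.
have hd : haspd k (fun w => 1 + \sum_(j < n) u j y w ^+ 2) w
    (2 * (\sum_(l < n) p l k w * u l y w) + 2 * (q k w * \sum_(j < n) u j y w ^+ 2)).
  apply: (haspd_eq (D := 0 + \sum_(j < n)
     ((p j k w + q k w * u j y w) * u j y w + u j y w * (p j k w + q k w * u j y w)))).
    apply: haspdD; first exact: haspd_cst.
    by apply: haspd_sum => j; apply: haspdM; exact: hu.
  rewrite add0r !mulr_sumr -big_split/=; apply: eq_bigr => j _; ring.
apply: haspd_eq (haspdV (den_neq0 y w) hd) _.
have -> : resA k y w = -2 * ((\sum_(l < n) p l k w * u l y w) * resv y w) +
    -2 * (q k w * (1 + -1 * resv y w)).
  rewrite /resA mulr_suml; congr (_ * _ + _).
  by apply: eq_bigr => l _; rewrite /rese mulrA.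
rewrite /resv; move: (den_neq0 y w).
move: (\sum_(j < n) u j y w ^+ 2) (\sum_(l < n) _) => S P S0; field.
exact: S0.
Qed.

Lemma haspd_rese j k y w : Om w -> haspd k (rese j y) w
  (p j k w * resv y w + q k w * rese j y w + rese j y w * resA k y w).
Proof.
move=> Ow; apply: haspd_eq (haspdM (hu j k y Ow) (haspd_resv k y Ow)) _.
by rewrite /rese; ring.
Qed.

Hypothesis cu : forall j y w, Om w -> rcont_at (u j y) w.

Lemma rcont_resv y w : Om w -> rcont_at (resv y) w.
Proof.
move=> Ow; apply: rcontV => //; apply: rcontD; first exact: rcont_cst.
by apply: rcont_sum => j; apply: rcontM; exact: cu.
Qed.

Lemma rcont_rese j y w : Om w -> rcont_at (rese j y) w.
Proof. by move=> Ow; apply: rcontM; [exact: cu|exact: rcont_resv]. Qed.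

Local Notation Sym := (Sym Om resr).

Hypothesis hp : forall k i j, Sym k 0 (fun _ => p i j).
Hypothesis hq : forall k i, Sym k 0 (fun _ => q i).

(** Both families are treated at once because their derivatives form a closed system: polynomials in
    p, q, [resv] and [rese], each term keeping a factor [resv] or [rese] of order 1. *)
Lemma Sym_resolvent k : Sym k 1 resv /\ forall j, Sym k 1 (rese j).
Proof.
have bv : bsym Om resr 1 0 resv.
  by exists 1 => y w _; rewrite mul1r expr1 gtr0_norm ?resv_gt0 ?resv_le_resr.
have be j : bsym Om resr 1 0 (rese j).
  by exists 1 => y w _; rewrite mul1r expr1 norm_rese_le.
elim: k => [|k [IHv IHe]].
  split=> [|j]; split=> //; first by move=> y w; exact: rcont_resv.
  by move=> y w; exact: rcont_rese.
have le0 f : Sym k 1 f -> Sym k 0 f by apply: (Sym_le resr_ge0 resr_le1).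
have hA i : Sym k 0 (resA i).
  apply: SymD; apply: (SymZ resr_ge0).
    apply: Sym_sum => l; rewrite -[0%N]addn0; apply: (SymM resr_ge0) => //.
    exact: le0.
  rewrite -[0%N]addn0; apply: (SymM resr_ge0) => //.
  by apply: SymD; [exact: Sym_cst|apply: (SymZ resr_ge0); exact: le0].
split=> [|j]; apply: SymS => //.
- by move=> y w; exact: rcont_resv.
- move=> i; exists (fun y w => resv y w * resA i y w); split.
    by move=> y w; exact: haspd_resv.
  by rewrite -[1%N]addn0; exact: (SymM resr_ge0).
- by move=> y w; exact: rcont_rese.
- move=> i; exists (fun y w => p j i w * resv y w + q i w * rese j y w +
    rese j y w * resA i y w); split.
    by move=> y w; exact: haspd_rese.
  apply: SymD; first apply: SymD.
  + by rewrite -[1%N]add0n; exact: (SymM resr_ge0).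
  + by rewrite -[1%N]add0n; exact: (SymM resr_ge0).
  + by rewrite -[1%N]addn0; exact: (SymM resr_ge0).
Qed.

End Resolvent.

(** * Expansion of the gradient on cones *)

Section Line.
Variables (R : realType) (n : nat).
Local Notation T := (n.-tuple R).

Definition line (x v : T) (t : R) : T := [tuple tnth x i + t * tnth v i | i < n].

Lemma tnth_line x v t i : tnth (line x v t) i = tnth x i + t * tnth v i.
Proof. by rewrite tnth_mktuple. Qed.

Lemma lineD x v s t : line (line x v s) v t = line x v (s + t).
Proof. by apply: eq_tuple => i; rewrite !tnth_line mulrDl addrA. Qed.

Lemma line0 x v : line x v 0 = x.
Proof. by apply: eq_tuple => i; rewrite tnth_line mul0r addr0. Qed.

(** Continuous partial derivatives give derivatives in every direction; [telescope_bound] with the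
    gradient at x controls the remainder. *)
Lemma chain_line0 (f : T -> R) (D : 'I_n -> T -> R) (x v : T) :
  (\forall z \near nbt x, forall k, haspd k f z (D k z)) ->
  (forall k, rcont_at (D k) x) ->
  is_derive (0 : R) 1 (fun t => f (line x v t)) (\sum_(k < n) D k x * tnth v k).
Proof.
move=> hD cD; set L := \sum_(k < n) _.
suff c : (fun h : R => h^-1 *: (f (line x v (h *: 1 + 0)) - f (line x v 0)))
    @ 0^' --> L.
  by apply: DeriveDef; [exact: cvgP c|exact: cvg_lim c].
apply/cvgrPdist_le => e e0.
(* Serves for the accuracy e / N and for the step size; the summand 1 keeps it positive when v
   vanishes. *)
pose N := 1 + norm1 v; have N0 : 0 < N by rewrite ltr_pwDl// norm1_ge0.
have near_x : \forall z \near nbt x, forall k, haspd k f z (D k z) /\ `|D k z - D k x| <= e / N.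
  have : \forall z \near nbt x, forall k, `|D k z - D k x| <= e / N.
    apply: filter_forall => k; have /rcontP/cvgrPdist_le := cD k.
    by move=> /(_ (e / N)); rewrite divr_gt0// => /(_ isT); apply: filterS => z; rewrite distrC.
  by apply: filterS2 hD => z h1 h2 k; split; [exact: h1|exact: h2].
have /nbtP[del d0 hdel] := near_x.
near=> h.
have h0 : h != 0 by near: h; exact: nbhs_dnbhs_neq.
have hN : `|h| < del / N.
  near: h; apply: dnbhs0_lt; exact: divr_gt0.
rewrite /GRing.scale/= mulr1 addr0 line0.
have small z : (forall j, `|tnth z j - tnth x j| <= `|tnth (line x v h) j - tnth x j|) ->
    forall j, `|tnth z j - tnth x j| < del.
  move=> hz j; rewrite (le_lt_trans (hz j))// tnth_line addrAC subrr add0r normrM.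
  rewrite (@le_lt_trans _ _ (`|h| * N))//; last by rewrite -ltr_pdivlMr.
  by rewrite ler_wpM2l// /N ler_wpDl// coord_le_norm1.
have := @telescope_bound R n f x (line x v h) D (fun k => D k x) (fun=> e / N).
rewrite (eq_bigr (fun k => h * (D k x * tnth v k))); last first.
  by move=> k _; rewrite tnth_line addrAC subrr add0r mulrCA.
rewrite -mulr_sumr -/L -mulr_sumr.
rewrite (eq_bigr (fun k => `|h| * `|tnth v k|)); last first.
  by move=> k _; rewrite tnth_line addrAC subrr add0r normrM.
rewrite -mulr_sumr -/(norm1 v) => tb.
have {tb} : `|f (line x v h) - f x - h * L| <= e / N * (`|h| * norm1 v).
  by apply: tb => z hz k; exact: (hdel z (small z hz) k).
move=> tb; rewrite distrC -[L](mulKf h0) -mulrBr normrM normfV.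
rewrite ler_pdivrMl ?normr_gt0// (le_trans tb)// mulrCA ler_wpM2l//.
rewrite -mulrA ler_piMr ?(ltW e0)// mulrC ler_pdivrMr// mul1r /N.
by rewrite lerDr.
Unshelve. all: by end_near. Qed.

Lemma chain_line (f : T -> R) (D : 'I_n -> T -> R) (x v : T) (t : R) :
  (\forall z \near nbt (line x v t), forall k, haspd k f z (D k z)) ->
  (forall k, rcont_at (D k) (line x v t)) ->
  is_derive t 1 (fun t => f (line x v t)) (\sum_(k < n) D k (line x v t) * tnth v k).
Proof.
move=> hD cD; apply: is_derive_shift; under eq_fun do rewrite -lineD.
exact: chain_line0.
Qed.

End Line.

Section ConeDerivative.
Variables (R : realType) (n : nat).
Local Notation T := (n.-tuple R).
Variables (m : R) (m1 : 'I_n -> T -> R) (m2 : 'I_n -> 'I_n -> T -> R).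
Hypothesis m_ge2 : 2 <= m.
Hypothesis dm1 : forall j k w, w <> vzero R n -> haspd k (m1 j) w (m2 j k w).
Hypothesis cm2 : forall j k w, w <> vzero R n -> rcont_at (m2 j k) w.
Hypothesis hm2 : forall j k lam w, 0 < lam -> w <> vzero R n ->
  m2 j k (vscale lam w) = lam `^ (m - 2) * m2 j k w.
Hypothesis nondeg : forall om, enorm om = 1 -> \det (\matrix_(j, k) m2 j k om) != 0.

(** The scale s is a free parameter in place of |w|: the condition is then convex in the pair (s,
    w), and scales interpolate linearly along segments. *)
Definition incone (om : T) (eps s : R) (w : T) :=
  0 < s /\ forall i, `|tnth w i - s * tnth om i| < eps * s.

Lemma incone_line om eps s s' (w w' : T) t : 0 <= t <= 1 ->
  incone om eps s w -> incone om eps s' w' ->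
  incone om eps (s' + t * (s - s')) (line w' (vsub w w') t).
Proof.
move=> /andP[t0 t1] [s0 hw] [s'0 hw'].
have t1' : 0 <= 1 - t by rewrite subr_ge0.
have e1 a b : a + t * (b - a) = (1 - t) * a + t * b by ring.
rewrite e1; split=> [|i].
  have [->|tn] := eqVneq t 0; first by rewrite subr0 mul1r mul0r addr0.
  by rewrite ltr_wpDl ?mulr_gt0 ?mulr_ge0 ?(ltW s'0)// lt_neqAle eq_sym tn.
rewrite tnth_line tnth_vsub e1.
rewrite (_ : _ - _ = (1 - t) * (tnth w' i - s' * tnth om i) +
  t * (tnth w i - s * tnth om i)); last by ring.
rewrite (le_lt_trans (ler_normD _ _))// !normrM (ger0_norm t0) (ger0_norm t1').
rewrite mulrDr !(mulrCA eps).
have [->|tn] := eqVneq t 0.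
  by rewrite subr0 !mul1r !mul0r !addr0.
have tp : 0 < t by rewrite lt_neqAle eq_sym tn.
by rewrite ler_ltD// ?ler_wpM2l ?ltr_pM2l// ltW.
Qed.

Lemma incone_scale om eps s w : incone om eps s w ->
  w = vscale s (vscale s^-1 w) /\
  forall i, `|tnth (vscale s^-1 w) i - tnth om i| < eps.
Proof.
move=> [s0 hw]; rewrite vscaleA divff ?gt_eqF// vscale1; split=> // i.
rewrite tnth_vscale -(ltr_pM2l s0) -{1}(gtr0_norm s0) -normrM mulrBr mulrA.
by rewrite divff ?gt_eqF// mul1r [s * eps]mulrC.
Qed.

Lemma incone_neq0 om eps s w : enorm om = 1 -> n%:R * eps <= 2^-1 ->
  incone om eps s w -> w <> vzero R n.
Proof.
move=> om1 neps [s0 hw] w0.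
have : norm1 om <= n%:R * eps.
  rewrite /norm1 mulr_natl -[n in leRHS]card_ord -sumr_const; apply: ler_sum => i _.
  rewrite ltW// -(ltr_pM2l s0) -{1}(gtr0_norm s0) -normrM [s * eps]mulrC.
  by have := hw i; rewrite w0 tnth_mktuple sub0r normrN.
have := enorm_le_norm1 om; rewrite om1 => h1 h2.
by have := le_trans (le_trans h1 h2) neps; rewrite leNgt invf_lt1 ?ltr1n.
Qed.

Lemma incone_enorm_le om eps s w : enorm om = 1 -> n%:R * eps <= 2^-1 ->
  incone om eps s w -> enorm w <= n.+1%:R * s.
Proof.
move=> om1 neps [s0 hw]; rewrite (le_trans (enorm_le_norm1 _))//.
apply: (@le_trans _ _ (\sum_(i < n) (s * `|tnth om i| + eps * s))).
  apply: ler_sum => i _; rewrite -{1}(gtr0_norm s0) -normrM.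
  rewrite -[X in `|X| <= _](subrK (s * tnth om i)) addrC (le_trans (ler_normD _ _))//.
  by rewrite lerD2l ltW.
rewrite big_split/= -mulr_sumr -/(norm1 om) sumr_const card_ord -[_ *+ n]mulr_natl mulrA.
have := norm1_le_enorm om; rewrite om1 mulr1 => h1.
rewrite -natr1 [_ + 1]addrC mulrDl mul1r addrC lerD//.
  by rewrite ler_piMl ?(ltW s0)// (le_trans neps)// invf_le1// ler1n.
by rewrite mulrC ler_wpM2r// ltW.
Qed.

Lemma norm1_sqr_le (v : T) : norm1 v ^+ 2 <= n%:R ^+ 2 * \sum_(k < n) tnth v k ^+ 2.
Proof.
have -> : \sum_(k < n) tnth v k ^+ 2 = enorm v ^+ 2.
  by rewrite sqr_enorm; apply: eq_bigr => k _; rewrite expr2.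
rewrite -exprMn lerXn2r ?nnegrE ?norm1_ge0 ?mulr_ge0 ?enorm_ge0//.
exact: norm1_le_enorm.
Qed.

(** Freeze the matrix at om: with A invertible and c = v^T A^(-1), the pairing of c with A v is
    |v|^2. A narrow cone perturbs this by at most half, and homogeneity supplies the power of s. The
    vector c depends on v alone, so the estimate can be integrated along a segment of direction
    v. *)
Lemma cone_derivative_lower om : enorm om = 1 ->
  exists eps, [/\ 0 < eps, n%:R * eps <= 2^-1 & exists2 C, 0 <= C &
    forall v : T, exists c : 'I_n -> R, \sum_(j < n) `|c j| <= C * norm1 v /\
    forall s w, incone om eps s w ->
      s `^ (m - 2) * (2^-1 * \sum_(k < n) tnth v k ^+ 2) <=
      \sum_(j < n) c j * \sum_(k < n) m2 j k w * tnth v k].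
Proof.
move=> om1.
have om0 : om <> vzero R n.
  by move=> /eqP; rewrite -enorm_eq0 om1 oner_eq0.
pose A : 'M[R]_n := \matrix_(j, k) m2 j k om.
have Au : A \in unitmx by rewrite unitmxE unitfE; exact: nondeg.
pose M : R := \sum_(j < n) \sum_(k < n) `|invmx A k j|.
have M0 : 0 <= M by apply: sumr_ge0 => j _; exact: sumr_ge0.
(* Chosen so that [del * M * n^2] <= 1/2; the summand 1 avoids dividing by zero. *)
pose del : R := (2 * (M * n%:R ^+ 2 + 1))^-1.
have Mn1 : 0 < M * n%:R ^+ 2 + 1 by rewrite ltr_wpDl// mulr_ge0// exprn_ge0.
have del0 : 0 < del by rewrite invr_gt0 mulr_gt0.
have /nbtP[e0 e00 he0] : \forall z \near nbt om, forall j k, `|m2 j k z - m2 j k om| <= del.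
  apply: filter_forall => j; apply: filter_forall => k.
  have /rcontP/cvgrPdist_le/(_ _ del0) := @cm2 j k om om0.
  by apply: filterS => z; rewrite distrC.
(* The second bound ensures n * eps <= 1/2, which keeps the cone away from the origin. *)
exists (Num.min e0 (2 * n.+1%:R)^-1).
have n10 : 0 < 2 * n.+1%:R :> R by rewrite mulr_gt0// ltr0n.
split.
- by rewrite lt_min e00 invr_gt0.
- rewrite (@le_trans _ _ (n%:R * (2 * n.+1%:R)^-1))//.
    by rewrite ler_wpM2l// ge_min lexx orbT.
  rewrite invfM mulrCA ler_piMr ?invr_ge0// ler_pdivrMr ?ltr0n// mul1r.
  by rewrite ler_nat.
exists M => // v.
pose c j := \sum_(k < n) tnth v k * invmx A k j.
have cM : \sum_(j < n) `|c j| <= M * norm1 v.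
  rewrite /M mulr_suml; apply: ler_sum => j _.
  rewrite (le_trans (ler_norm_sum _ _ _))// mulr_suml; apply: ler_sum => k _.
  by rewrite normrM mulrC ler_wpM2l// coord_le_norm1.
exists c; split=> // s w hw.
have [s0 _] := hw; have [ws hz] := incone_scale hw.
set z := vscale s^-1 w in ws hz.
have z0 : z <> vzero R n.
  have w0 : w <> vzero R n.
    apply: (incone_neq0 om1 _ hw); rewrite (@le_trans _ _ (n%:R * (2 * n.+1%:R)^-1))//.
      by rewrite ler_wpM2l// ge_min lexx orbT.
    rewrite invfM mulrCA ler_piMr ?invr_ge0// ler_pdivrMr ?ltr0n// mul1r.
    by rewrite ler_nat.
  move=> zz; apply: w0; rewrite ws zz; apply: eq_tuple => i.
  by rewrite tnth_vscale !tnth_mktuple mulr0.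
have m2z j k : m2 j k w = s `^ (m - 2) * m2 j k z by rewrite {1}ws hm2.
have -> : \sum_(j < n) c j * \sum_(k < n) m2 j k w * tnth v k =
    s `^ (m - 2) * \sum_(j < n) c j * \sum_(k < n) m2 j k z * tnth v k.
  rewrite mulr_sumr; apply: eq_bigr => j _; rewrite mulrCA; congr (_ * _).
  by rewrite mulr_sumr; apply: eq_bigr => k _; rewrite m2z mulrA.
rewrite ler_wpM2l ?powR_ge0//.
pose Q := \sum_(k < n) tnth v k ^+ 2.
have main : \sum_(j < n) c j * (\sum_(k < n) A j k * tnth v k) = Q.
  under eq_bigr do rewrite mulr_sumr.
  rewrite exchange_big; apply: eq_bigr => k _ /=.
  under eq_bigr do rewrite mulrA.
  rewrite -mulr_suml expr2; congr (_ * _).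
  transitivity (((\row_i tnth v i) *m invmx A *m A) 0 k).
    rewrite mxE; apply: eq_bigr => j _; congr (_ * _); rewrite mxE.
    by apply: eq_bigr => l _; rewrite mxE.
  by rewrite -mulmxA mulVmx// mulmx1 mxE.
have err : `|\sum_(j < n) c j * (\sum_(k < n) (m2 j k z - A j k) * tnth v k)| <= 2^-1 * Q.
  apply: (@le_trans _ _ (del * (M * norm1 v ^+ 2))).
    rewrite (le_trans (ler_norm_sum _ _ _))//.
    apply: (@le_trans _ _ (\sum_(j < n) `|c j| * (del * norm1 v))).
      apply: ler_sum => j _; rewrite normrM ler_wpM2l//.
      rewrite (le_trans (ler_norm_sum _ _ _))// /norm1 mulr_sumr.
      apply: ler_sum => k _; rewrite normrM ler_wpM2r// /A mxE.
      apply: he0 => i; rewrite (lt_le_trans (hz i))// ge_min lexx//.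
    rewrite -mulr_suml mulrCA ler_wpM2l ?(ltW del0)// expr2 mulrA.
    by rewrite ler_wpM2r// norm1_ge0.
  apply: (@le_trans _ _ (del * (M * (n%:R ^+ 2 * Q)))).
    by rewrite ler_wpM2l ?(ltW del0)// ler_wpM2l// norm1_sqr_le.
  rewrite /del invfM -mulrA ler_wpM2l ?invr_ge0// ler_pdivrMl// mulrA.
  rewrite ler_wpM2r ?lerDl//; apply: sumr_ge0 => k _; exact: sqr_ge0.
have -> : \sum_(j < n) c j * (\sum_(k < n) m2 j k z * tnth v k) =
    Q + \sum_(j < n) c j * (\sum_(k < n) (m2 j k z - A j k) * tnth v k).
  rewrite -main -big_split/=; apply: eq_bigr => j _; rewrite -mulrDr -big_split/=.
  by congr (_ * _); apply: eq_bigr => k _; ring.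
move: err; rewrite ler_norml => /andP[h _]; rewrite -/Q -lerBlDl (le_trans _ h)//.
by move: (Q) => q; lra.
Qed.

End ConeDerivative.

Section ConeExpansion.
Variables (R : realType) (n : nat).
Local Notation T := (n.-tuple R).
Variables (m : R) (m1 : 'I_n -> T -> R) (m2 : 'I_n -> 'I_n -> T -> R).
Hypothesis m_ge2 : 2 <= m.
Hypothesis dm1 : forall j k w, w <> vzero R n -> haspd k (m1 j) w (m2 j k w).
Hypothesis cm2 : forall j k w, w <> vzero R n -> rcont_at (m2 j k) w.
Hypothesis hm2 : forall j k lam w, 0 < lam -> w <> vzero R n ->
  m2 j k (vscale lam w) = lam `^ (m - 2) * m2 j k w.
Hypothesis nondeg : forall om, enorm om = 1 -> \det (\matrix_(j, k) m2 j k om) != 0.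

Lemma mvt_itv (f df : R -> R) (a b : R) : a < b ->
  (forall t : R, a <= t <= b -> is_derive t 1 f (df t)) ->
  exists2 c, a <= c <= b & f b - f a = df c * (b - a).
Proof.
move=> ab dff; have [t tab||c cab e] := @MVT _ f df a b ab.
- by apply: dff; move/subset_itv_oo_cc: tab; rewrite /= in_itv.
- apply: derivable_within_continuous => t; rewrite in_itv/= => tab.
  by case: (dff t tab).
- by exists c => //; move/subset_itv_oo_cc: cab; rewrite /= in_itv.
Qed.

Lemma line1 (w w' : T) : line w' (vsub w w') 1 = w.
Proof. by apply: eq_tuple => i; rewrite tnth_line tnth_vsub mul1r addrC subrK. Qed.

(** Test the difference of gradients against the fixed vector c along the segment from w' to w,
    which stays in the cone by convexity. The power of the larger scale s is obtained because the
    interpolated scale is at least s / 2 on the second half. *)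
Lemma cone_expanding om : enorm om = 1 ->
  exists eps, [/\ 0 < eps, n%:R * eps <= 2^-1 & exists2 C, 0 <= C &
    forall s s' w w', s' <= s -> incone om eps s w -> incone om eps s' w' ->
      s `^ (m - 2) * norm1 (vsub w w') <= C * \sum_(j < n) `|m1 j w - m1 j w'|].
Proof.
move=> om1.
have [eps [eps0 neps [C C0 hC]]] := cone_derivative_lower cm2 hm2 nondeg om1.
exists eps; split=> //.
pose a := m - 2; have a0 : 0 <= a by rewrite subr_ge0.
pose K : R := 4 * 2 `^ a * n%:R ^+ 2.
have K0 : 0 <= K by rewrite !mulr_ge0 ?powR_ge0 ?exprn_ge0.
exists (K * C); first by rewrite mulr_ge0.
move=> s s' w w' ss hw hw'.
have [s0 _] := hw; have [s'0 _] := hw'.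
set v := vsub w w'.
have [c [cC hc]] := hC v.
pose x t := line w' v t; pose st t := s' + t * (s - s').
have xin t : 0 <= t <= 1 -> incone om eps (st t) (x t) by move=> h; exact: incone_line.
have xn0 t : 0 <= t <= 1 -> x t <> vzero R n.
  by move=> /xin; exact: incone_neq0.
pose psi (t : R) := \sum_(j < n) c j * m1 j (x t).
pose dpsi t := \sum_(j < n) c j * \sum_(k < n) m2 j k (x t) * tnth v k.
have dps (t : R) : 0 <= t <= 1 -> is_derive t 1 psi (dpsi t).
  move=> ht; have h j : is_derive t 1 (fun t => c j * m1 j (x t))
      (c j * \sum_(k < n) m2 j k (x t) * tnth v k).
    apply: is_deriveZ; apply: (@chain_line _ _ (m1 j) (m2 j)) => [|k].
      by apply: filterS (nbt_neq0 (xn0 t ht)) => z z0 k; exact: dm1.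
    by apply: cm2; exact: xn0.
  have -> : psi = \sum_(j < n) (fun t => c j * m1 j (x t)).
    by apply/funext => r; rewrite fct_sumE.
  exact: is_derive_sum.
pose Q := \sum_(k < n) tnth v k ^+ 2.
have Q0 : 0 <= Q by apply: sumr_ge0 => k _; exact: sqr_ge0.
have dlow t : 0 <= t <= 1 -> st t `^ a * (2^-1 * Q) <= dpsi t.
  by move=> /xin; exact: hc.
have half01 : 0 <= (2^-1 : R) <= 1 by rewrite invr_ge0 ler0n invf_le1// ler1n.
(* On the first half nonnegativity of the derivative is enough; the gain comes from the second
   half. *)
have [t1 /andP[t10 t11] e1] : exists2 c, 0 <= c <= 2^-1 &
    psi 2^-1 - psi 0 = dpsi c * (2^-1 - 0).
  apply: mvt_itv => [|t /andP[h1 h2]]; first by rewrite invr_gt0.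
  by apply: dps; rewrite h1 (le_trans h2)//; case/andP: half01.
have [t2 /andP[t20 t21] e2] : exists2 c, 2^-1 <= c <= 1 &
    psi 1 - psi 2^-1 = dpsi c * (1 - 2^-1).
  apply: mvt_itv => [|t /andP[h1 h2]]; first by rewrite invf_lt1// ltr1n.
  by apply: dps; rewrite h2 andbT (le_trans _ h1)//; case/andP: half01.
have d1 : 0 <= dpsi t1.
  have t1in : 0 <= t1 <= 1 by rewrite t10 (le_trans t11)//; case/andP: half01.
  by apply: le_trans (dlow t1 t1in); rewrite mulr_ge0 ?powR_ge0// mulr_ge0.
have d2 : (s / 2) `^ a * (2^-1 * Q) <= dpsi t2.
  have t2in : 0 <= t2 <= 1 by rewrite t21 (le_trans _ t20)//; case/andP: half01.
  apply: le_trans (dlow t2 t2in); rewrite ler_wpM2r ?mulr_ge0//.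
  apply: ge0_ler_powR => //; rewrite ?nnegrE ?divr_ge0 ?(ltW s0)//.
    by have [/ltW] := xin t2 t2in.
  by rewrite /st; move: t20 t21; nra.
have low : 4^-1 * ((s / 2) `^ a * Q) <= psi 1 - psi 0.
  rewrite -(subrKA (psi 2^-1)) e1 e2 subr0.
  have -> : 1 - 2^-1 = 2^-1 :> R by lra.
  have : 0 <= dpsi t1 * 2^-1 by rewrite mulr_ge0.
  by move: d2; move: ((s / 2) `^ a) => P; lra.
have up : psi 1 - psi 0 <= C * norm1 v * \sum_(j < n) `|m1 j w - m1 j w'|.
  rewrite /psi -sumrB (le_trans (ler_norm _))// (le_trans (ler_norm_sum _ _ _))//.
  apply: (@le_trans _ _ ((\sum_(j < n) `|c j|) * \sum_(j < n) `|m1 j w - m1 j w'|)).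
    rewrite mulr_suml; apply: ler_sum => j _.
    rewrite -mulrBr normrM ler_wpM2l// /x line0 line1.
    by rewrite (bigD1 j)//= lerDl sumr_ge0.
  by rewrite ler_wpM2r// sumr_ge0.
set D := \sum_(j < n) _ in up *.
have D0 : 0 <= D by exact: sumr_ge0.
have [v0|v0] := eqVneq (norm1 v) 0; first by rewrite v0 mulr0 !mulr_ge0.
have vp : 0 < norm1 v by rewrite lt_neqAle eq_sym v0 norm1_ge0.
rewrite -(ler_pM2r vp).
have sE : s `^ a = 2 `^ a * (s / 2) `^ a.
  by rewrite -powRM// ?divr_ge0 ?(ltW s0)//; congr (_ `^ _); lra.
rewrite -/a sE -[X in X <= _]mulrA -expr2.
apply: (@le_trans _ _ (2 `^ a * (s / 2) `^ a * (n%:R ^+ 2 * Q))).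
  by rewrite ler_wpM2l ?mulr_ge0 ?powR_ge0// norm1_sqr_le.
have h := le_trans low up.
have -> : 2 `^ a * (s / 2) `^ a * (n%:R ^+ 2 * Q) = K * (4^-1 * ((s / 2) `^ a * Q)).
  by rewrite /K; field.
by rewrite (le_trans (ler_wpM2l K0 h))// le_eqVlt; apply/orP; left; apply/eqP; ring.
Qed.

End ConeExpansion.

Section ResolventWeight.
Variables (R : realType) (n : nat).
Local Notation T := (n.-tuple R).
Variables (m : R) (m1 : 'I_n -> T -> R) (m2 : 'I_n -> 'I_n -> T -> R).
Hypothesis m_ge2 : 2 <= m.
Hypothesis dm1 : forall j k w, w <> vzero R n -> haspd k (m1 j) w (m2 j k w).
Hypothesis cm2 : forall j k w, w <> vzero R n -> rcont_at (m2 j k) w.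
Hypothesis hm2 : forall j k lam w, 0 < lam -> w <> vzero R n ->
  m2 j k (vscale lam w) = lam `^ (m - 2) * m2 j k w.
Hypothesis nondeg : forall om, enorm om = 1 -> \det (\matrix_(j, k) m2 j k om) != 0.

(** This is |w|^(2-m), written as a power of |w|^2 so as to fall under [Hom_dotp_powR];
    [grad_scaled] is the u of the overview. *)
Definition theta (w : T) : R := dotp w w `^ ((2 - m) / 2).
Definition grad_scaled (j : 'I_n) (y w : T) : R := theta w * (m1 j w + tnth y j).

Lemma enorm_theta w : w <> vzero R n -> enorm w `^ (m - 2) * theta w = 1.
Proof.
move=> w0; rewrite /theta -sqr_enorm -powR_mulrn ?enorm_ge0// -powRrM.
rewrite -powRD; last by rewrite (gt_eqF (enorm_gt0 w0)) implybT.
by rewrite (_ : m - 2 + _ = 0) ?powRr0//; field.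
Qed.

Lemma grad_scaledE j y w : w <> vzero R n ->
  m1 j w + tnth y j = enorm w `^ (m - 2) * grad_scaled j y w.
Proof. by move=> w0; rewrite /grad_scaled mulrA enorm_theta// mul1r. Qed.

Local Notation r := (resr grad_scaled).
Let U y w : R := \sum_(j < n) `|grad_scaled j y w|.

Let U_ge0 y w : 0 <= U y w. Proof. exact: sumr_ge0. Qed.

Let U_resr y w : (1 + U y w) * r y w <= n.+1%:R.
Proof.
rewrite mulrDl mul1r -natr1 addrC lerD ?resr_le1// /U mulr_suml.
rewrite -[n in leRHS]card_ord -sumr_const; apply: ler_sum => j _.
rewrite -[leRHS]sqrtr1 -sqrtr_sqr /resr -sqrtrM ?sqr_ge0// ler_wsqrtr//.
have d0 : 0 < 1 + \sum_(j < n) grad_scaled j y w ^+ 2.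
  by rewrite ltr_pwDl// sumr_ge0// => i _; exact: sqr_ge0.
rewrite /resv ler_pdivrMr// mul1r (bigD1 j)//= addrCA lerDl.
by rewrite addr_ge0// sumr_ge0// => i _; exact: sqr_ge0.
Qed.

(** The vector y cancels in the difference of gradients, so it may be added to both. Undoing the
    scaling costs at most ((n + 1) s)^(m-2), whose power of s cancels against the left-hand side of
    the expansion estimate. *)
Let cone_sep om eps C s s' w w' y : enorm om = 1 -> n%:R * eps <= 2^-1 -> 0 <= C ->
  (forall s s' w w', s' <= s -> incone om eps s w -> incone om eps s' w' ->
      s `^ (m - 2) * norm1 (vsub w w') <= C * \sum_(j < n) `|m1 j w - m1 j w'|) ->
  s' <= s -> incone om eps s w -> incone om eps s' w' ->
  norm1 (vsub w w') <= C * n.+1%:R `^ (m - 2) * (U y w + U y w').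
Proof.
move=> om1 neps C0 hC ss hw hw'; have [s0 _] := hw; have [s'0 _] := hw'.
have a0 : 0 <= m - 2 by rewrite subr_ge0.
have N0 : 0 <= n.+1%:R `^ (m - 2) :> R by exact: powR_ge0.
have sp : 0 < s `^ (m - 2) by exact: powR_gt0.
rewrite -(ler_pM2l sp) (le_trans (hC _ _ _ _ ss hw hw'))//.
rewrite -mulrA mulrCA ler_wpM2l//.
have bd (t : R) (z : T) j : t <= s -> incone om eps t z ->
    `|m1 j z + tnth y j| <= s `^ (m - 2) * n.+1%:R `^ (m - 2) * `|grad_scaled j y z|.
  move=> ts hz; have z0 := incone_neq0 om1 neps hz.
  rewrite grad_scaledE// normrM ler_wpM2r// ger0_norm ?powR_ge0//.
  rewrite -powRM ?(ltW s0)//; apply: ge0_ler_powR => //.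
  - by rewrite nnegrE enorm_ge0.
  - by rewrite nnegrE mulr_ge0// ltW.
  - rewrite (le_trans (incone_enorm_le om1 neps hz))// mulrC ler_wpM2r//.
apply: (@le_trans _ _ (\sum_(j < n) (`|m1 j w + tnth y j| + `|m1 j w' + tnth y j|))).
  apply: ler_sum => j _; rewrite (le_trans _ (ler_normB _ _))//.
  by rewrite opprD addrACA subrr addr0.
rewrite mulrA big_split/= mulrDr /U !mulr_sumr lerD//; apply: ler_sum => j _.
  exact: bd hw.
exact: bd hw'.
Qed.

Lemma norm1_sym (x z : T) : norm1 (vsub x z) = norm1 (vsub z x).
Proof. by apply: eq_bigr => i _; rewrite !tnth_vsub distrC. Qed.

(** Near-minimality of [U y] at a centre z gives |w - z| = O(1 + U y w), that is r = O(1 / (1 + |w -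
    z|)). The order of quantifiers matters: cones and constant are chosen before y, only the centres
    after it. *)
Lemma resolvent_weight : exists (s : seq T) (C : R), 0 <= C /\ forall y, exists z : T -> T,
  forall w, w <> vzero R n ->
    r y w ^+ (2 * n) <= C * \sum_(om <- s) wt (vsub w (z om)).
Proof.
have /choice[ec hec] : forall om : T, exists p : R * R, enorm om = 1 ->
    [/\ 0 < p.1, n%:R * p.1 <= 2^-1, 0 <= p.2 &
    forall s s' w w', s' <= s -> incone om p.1 s w -> incone om p.1 s' w' ->
      s `^ (m - 2) * norm1 (vsub w w') <= p.2 * \sum_(j < n) `|m1 j w - m1 j w'|].
  move=> om; have [om1|om1] := pselect (enorm om = 1); last by exists (0, 0).
  have [eps [e0 neps [C C0 hC]]] := cone_expanding m_ge2 dm1 cm2 hm2 nondeg om1.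
  by exists (eps, C).
pose eps om := (ec om).1; pose CC om := (ec om).2.
have [om om1|s [s1 hs]] := @sphere_cover R n
    (fun om => [set w | forall i, `|tnth w i - tnth om i| < eps om]).
  by apply/nbtP; exists (eps om) => //; have [] := hec om om1.
have CC0 om : om \in s -> 0 <= CC om by move=> /s1/hec[].
pose a := m - 2.
pose Cs : R := \sum_(om <- s) `|CC om|.
have Cs0 : 0 <= Cs by exact: sumr_ge0.
(* The first factor compares 1 + |w - z| with 1 + [U y w]; the second is the bound of [U_resr]. *)
pose L : R := (1 + 2 * (Cs * n.+1%:R `^ a)) * n.+1%:R.
have L0 : 0 <= L.
  by rewrite /L mulr_ge0// addr_ge0// mulr_ge0// mulr_ge0// powR_ge0.
exists s, (L ^+ (2 * n)); split; first exact: exprn_ge0.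
move=> y.
pose K om := [set w | exists t, incone om (eps om) t w].
(* The infimum over the cone need not be attained; a point within 1 of it is enough. *)
have /choice[z hz] : forall om, exists z : T, om \in s ->
    K om z /\ forall w, K om w -> U y z <= U y w + 1.
  move=> om; have [oms|] := boolP (om \in s); last by exists om.
  have [e0 _ _ _] := hec om (s1 om oms).
  have Kom : K om om.
    by exists 1; split=> // i; rewrite mul1r subrr normr0 mulr1.
  have hi : has_inf (U y @` K om).
    by split; [exists (U y om), om|exists 0 => _ [w _ <-]; exact: U_ge0].
  have [_ [z Kz <-] hz] := inf_adherent ltr01 hi.
  exists z => _; split=> // w Kw; rewrite (le_trans (ltW hz))// lerD2r.
  by apply: ge_inf; [case: hi|exists w].
exists z => w w0.
have [om oms hw] := hs _ (enorm_unit w0).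
have [e0 neps c0 hC] := hec om (s1 om oms).
have w1 := enorm_gt0 w0.
have Kw : incone om (eps om) (enorm w) w.
  split=> // i; have := hw i; rewrite tnth_vscale -(ltr_pM2l w1).
  rewrite -{1}(gtr0_norm w1) -normrM mulrBr mulrA divff ?gt_eqF// mul1r.
  by rewrite [_ * eps om]mulrC.
have [[t Kz] zmin] := hz om oms.
have sep : norm1 (vsub w (z om)) <= CC om * n.+1%:R `^ a * (U y w + U y (z om)).
  (* [cone_sep] takes the point of larger scale first, so the two points may have to be
     exchanged. *)
  have [tw|/ltW tw] := leP t (enorm w).
    exact: (cone_sep _ (s1 _ oms) neps c0 hC tw Kw Kz).
  rewrite norm1_sym addrC.
  exact: (cone_sep _ (s1 _ oms) neps c0 hC tw Kz Kw).
have zle : U y (z om) <= U y w + 1 by apply: zmin; exists (enorm w).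
have CCs : CC om <= Cs.
  rewrite /Cs (big_rem om)//= (le_trans (ler_norm _))// lerDl; exact: sumr_ge0.
have P0 : 0 <= n.+1%:R `^ a :> R by exact: powR_ge0.
have key : r y w * (1 + norm1 (vsub w (z om))) <= L.
  apply: (@le_trans _ _ (r y w * ((1 + 2 * (Cs * n.+1%:R `^ a)) * (1 + U y w)))).
    rewrite ler_wpM2l ?resr_ge0//.
    have h1 : norm1 (vsub w (z om)) <= Cs * n.+1%:R `^ a * (2 * U y w + 1).
      rewrite (le_trans sep)// ler_pM ?mulr_ge0 ?addr_ge0 ?CC0//.
        by rewrite ler_wpM2r.
      by move: zle; move: (U _ _) (U _ _) => b c; lra.
    have := U_ge0 y w; have CP : 0 <= Cs * n.+1%:R `^ a by rewrite mulr_ge0.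
    move: h1 CP; move: (Cs * _) (U y w) => c b h1 CP b0; nra.
  rewrite mulrCA /L ler_wpM2l ?addr_ge0 ?mulr_ge0// mulrC; exact: U_resr.
apply: (@le_trans _ _ (L ^+ (2 * n) * wt (vsub w (z om)))); last first.
  rewrite ler_wpM2l ?exprn_ge0// (big_rem om)//= lerDl.
  by apply: sumr_ge0 => om' _; exact: wt_ge0.
rewrite -ler_pdivrMr ?wt_gt0//.
apply: (@le_trans _ _ (r y w ^+ (2 * n) * (1 + norm1 (vsub w (z om))) ^+ (2 * n))).
  by rewrite ler_wpM2l ?exprn_ge0 ?resr_ge0// inv_wt_le.
rewrite -exprMn lerXn2r ?nnegrE//.
by rewrite mulr_ge0 ?resr_ge0// addr_ge0// norm1_ge0.
Qed.

End ResolventWeight.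

(** * Oscillatory integrals *)

Section Amplitudes.
Variables (R : realType) (n : nat) (Y : Type).
Local Notation T := (n.-tuple R).
Variable r : Y -> T -> R.
Hypothesis r0 : forall y w, 0 <= r y w.
Hypothesis r1 : forall y w, r y w <= 1.

(** Overlaps with the open set |w|^2 < 1/2, and together they cover the space: amplitudes are
    symbols on the first and vanish on the second. *)
Definition outer : set T := [set w | 2^-1 < enorm w].

Lemma outer_open w : outer w -> nbt w outer.
Proof.
move=> ow; have /cvgrPdist_lt/(_ (enorm w - 2^-1)) := @enorm_cvg _ _ w.
rewrite subr_gt0 => /(_ ow); apply: filterS => z zw; rewrite /outer/=.
by have := le_lt_trans (ler_norm _) zw; lra.
Qed.

Lemma outer_neq0 w : outer w -> w <> vzero R n.
Proof.
move=> ow /eqP; rewrite -enorm_eq0 => /eqP e.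
by move: ow; rewrite /outer/= e ltNge invr_ge0 ler0n.
Qed.

Lemma outer_or (w : T) : outer w \/ dotp w w < 2^-1.
Proof.
have [h|h] := ltP 2^-1 (enorm w); first by left.
right; rewrite -sqr_enorm; have := enorm_ge0 w; nra.
Qed.

Lemma inner_open (w : T) : dotp w w < 2^-1 -> \forall z \near nbt w, dotp z z < 2^-1.
Proof.
move=> iw; have /cvgrPdist_lt/(_ (2^-1 - dotp w w)) := @sqr_cvg _ _ w.
rewrite subr_gt0 => /(_ iw); apply: filterS => z; rewrite distrC => zw.
by have := le_lt_trans (ler_norm _) zw; lra.
Qed.

Lemma inner0 : dotp (vzero R n) (vzero R n) < 2^-1.
Proof. by rewrite /dotp big1 ?invr_gt0// => i _; rewrite tnth_mktuple mul0r. Qed.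

Local Notation Sym := (Sym outer r).

Lemma bsym_eq N j (f g : Y -> T -> R) : (forall y w, outer w -> f y w = g y w) ->
  bsym outer r N j f -> bsym outer r N j g.
Proof. by move=> fg [C hC]; exists C => y w ow; rewrite -fg//; exact: hC. Qed.

Lemma Sym_eq k N (f g : Y -> T -> R) : (forall y w, outer w -> f y w = g y w) ->
  Sym k N f -> Sym k N g.
Proof. by apply: Reg_eq => [w|j {}f {}g]; [exact: outer_open|exact: bsym_eq]. Qed.

(* Amplitudes vanish near the origin, where the phase need not be smooth. *)
Definition Amp k N (c : Y -> T -> R) :=
  Sym k N c /\ forall y w, dotp w w < 2^-1 -> c y w = 0.

Lemma Amp_bound k N c : Amp k N c ->
  exists2 C, 0 <= C & forall y w, `|c y w| <= C * r y w ^+ N.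
Proof.
move=> [/(Sym_bound r0)[C C0 hC] c0]; exists C => // y w.
have [|iw] := outer_or w; first exact: hC.
by rewrite c0// normr0 mulr_ge0// exprn_ge0.
Qed.

Lemma Amp_bound1 k N c : Amp k N c -> exists2 C, 0 <= C & forall y w, `|c y w| <= C.
Proof.
move=> /Amp_bound[C C0 hC]; exists C => // y w; rewrite (le_trans (hC y w))//.
by rewrite ler_piMr// exprn_ile1.
Qed.

Lemma Amp_le k k' N c : (k' <= k)%N -> Amp k N c -> Amp k' N c.
Proof. by move=> kk [sc c0]; split=> //; exact: (Sym_le r0 r1 kk _ sc). Qed.

Lemma AmpM k N N' f c : Sym k N f -> Amp k N' c ->
  Amp k (N + N') (fun y w => f y w * c y w).
Proof.
move=> sf [sc c0]; split; first exact: (SymM r0).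
by move=> y w iw; rewrite c0// mulr0.
Qed.

Lemma inner_near0 N k c y w : Amp k N c -> dotp w w < 2^-1 ->
  \forall z \near nbt w, 0 = c y z.
Proof. by move=> [_ c0] /inner_open; apply: filterS => z iz; rewrite c0. Qed.

Lemma Amp_rcontM k N c (f : T -> R) y w : Amp k N c ->
  (w <> vzero R n -> rcont_at f w) -> rcont_at (fun z => f z * c y z) w.
Proof.
move=> ac cf; have [ow|iw] := outer_or w.
  apply: rcontM; first by apply: cf; exact: outer_neq0.
  by case: ac => sc _; exact: (Sym_cont y sc ow).
apply: (@rcont_near _ _ (fun=> 0)); last exact: rcont_cst.
by apply: filterS (inner_near0 y ac iw) => z <-; rewrite mulr0.
Qed.

Lemma Amp_deriv k N c i : Amp k.+1 N c -> exists c',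
  (forall y w, haspd i (c y) w (c' y w)) /\ Amp k N c'.
Proof.
move=> ac; have [sc c0] := ac; have [f [df sf]] := Sym_deriv i sc.
(* [f] is only known to be the derivative on [outer], so it is replaced by 0 near the origin; on the
   overlap the two agree by uniqueness of derivatives. *)
pose c' y (w : T) := if dotp w w < 2^-1 then 0 else f y w.
have d0 y w : dotp w w < 2^-1 -> haspd i (c y) w 0.
  move=> iw; apply: haspd_near (haspd_cst i 0 w); exact: inner_near0 ac iw.
have fc y w : outer w -> f y w = c' y w.
  rewrite /c'; case: ifPn => // iw ow.
  exact: haspd_unique (df y w ow) (d0 y w iw).
exists c'; split; last split; last by move=> y w iw; rewrite /c' iw.
- move=> y w; rewrite /c'; case: ifPn => iw; first exact: d0.
  by have [ow|] := outer_or w; [exact: df|rewrite (negbTE iw)].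
- exact: Sym_eq fc sf.
Qed.

Lemma Amp_haspdM k N c c' i (f df : T -> R) y w : Amp k N c -> Amp k N c' ->
  (forall w, haspd i (c y) w (c' y w)) ->
  (w <> vzero R n -> haspd i f w (df w)) ->
  haspd i (fun z => f z * c y z) w (df w * c y w + f w * c' y w).
Proof.
move=> ac ac' hc hf; have [ow|iw] := outer_or w.
  by apply: haspdM => //; apply: hf; exact: outer_neq0.
have [[_ c0] [_ c'0]] := (ac, ac').
rewrite c0// c'0// !mulr0 addr0; apply: haspd_near (haspd_cst i 0 w).
by apply: filterS (inner_near0 y ac iw) => z <-; rewrite mulr0.
Qed.

End Amplitudes.

(** * An explicit cutoff of finite smoothness *)

Section Cutoff.
Variables (R : realType) (n : nat) (Y : Type).
Local Notation T := (n.-tuple R).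
Variable r : Y -> T -> R.
Hypothesis r0 : forall y w, 0 <= r y w.
Hypothesis r1 : forall y w, r y w <= 1.
Local Notation Sym := (Sym (@outer R n) r).

(** For K positive, of class C^(K-1) and zero on the negative half-line, which is all that finitely
    many integrations by parts require of a cutoff. *)
Definition pospow K (t : R) := Num.max 0 t ^+ K.

Lemma continuous_pospow K : continuous (pospow K).
Proof.
move=> t; apply: (cvg_comp (fun s => Num.max 0 s) (fun s => s ^+ K) _
  (@exprn_continuous _ K _)).
by apply: (@continuous_max _ _ (fun=> 0) id); [exact: cst_continuous|exact: cvg_id].
Qed.

Lemma is_derive_pospow K (t : R) :
  is_derive t 1 (pospow K.+2) (K.+2%:R * pospow K.+1 t).
Proof.
rewrite /pospow; have [t0|t0|t0] := ltgtP t 0.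
- rewrite expr0n/= mulr0.
  apply: (@near_eq_is_derive _ _ _ (fun=> 0)).
  near=> s; rewrite max_l ?expr0n//; apply/ltW; near: s; exact: lt_nbhsl.
- have hX : is_derive t 1 (fun s : R => s ^+ K.+2) (K.+2%:R * t ^+ K.+1).
    rewrite (_ : (fun s : R => s ^+ K.+2) = (id : R -> R) ^+ K.+2); last first.
      by apply/funext => s; rewrite exprfctE.
    by apply: is_derive_eq; rewrite /GRing.scale/= mulr1.
  apply: (near_eq_is_derive _ hX).
  near=> s; rewrite max_r//; apply/ltW; near: s; exact: lt_nbhsr.
- rewrite t0 expr0n/= mulr0.
  suff c : (fun h : R => h^-1 *: (Num.max 0 (h *: (1 : R) + 0 : R) ^+ K.+2 - Num.max 0 (0 : R) ^+ K.+2))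
      @ 0^' --> (0 : R).
    by apply: DeriveDef; [exact: cvgP c|exact: cvg_lim c].
  apply/cvgrPdist_le => e e0; near=> h.
  have h0 : h != 0 by near: h; exact: nbhs_dnbhs_neq.
  have he : `|h| < Num.min e 1.
    by near: h; apply: dnbhs0_lt; rewrite lt_min e0 ltr01.
  move: he; rewrite lt_min => /andP[he h1].
  rewrite sub0r normrN /GRing.scale/= mulr1 addr0 maxxx expr0n/= subr0.
  rewrite normrM normfV ler_pdivrMl ?normr_gt0// normrX.
  have m0 : `|Num.max 0 h| <= `|h|.
    by case: (leP 0 h) => hh; rewrite ?normr0.
  rewrite (le_trans (lerXn2r _ _ _ m0)) ?nnegrE// exprS ler_wpM2l//.
  by rewrite exprS (le_trans _ (ltW he))// ler_piMr// exprn_ile1// ltW.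
Unshelve. all: by end_near. Qed.

(** Each derivative lowers the power by one, so K has to exceed the number of derivatives; g <= 1
    bounds the positive part. *)
Lemma pospow_Sym k K (g : T -> R) : (k < K)%N -> (forall w, g w <= 1) ->
  (forall k, Sym k 0 (fun _ => g)) -> Sym k 0 (fun _ w => pospow K (g w)).
Proof.
move=> + g1 sg.
have bd K' : bsym (@outer R n) r 0 0 (fun _ w => pospow K' (g w)).
  exists 1 => y w _; rewrite expr0 mulr1 /pospow normrX exprn_ile1//.
  by case: (leP 0 (g w)) => h; rewrite ?normr0// ger0_norm.
have cont K' (y : Y) w : outer w -> rcont_at (fun w => pospow K' (g w)) w.
  move=> ow; apply: (@rcont_comp _ _ (pospow K') g); first exact: continuous_pospow.
  exact: (Sym_cont y (sg 0%N) ow).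
elim: k K => [|k IH] K kK.
  by split=> // y w ow; exact: cont.
case: K kK => [//|[//|K]] kK; apply: SymS => //; first by move=> y w ow; exact: cont.
move=> i; have [g' [dg sg']] := Sym_deriv i (sg k.+1).
exists (fun y w => (K.+2%:R * pospow K.+1 (g w)) * g' y w); split.
  move=> y w ow; apply: (@haspd_comp _ _ _ (pospow K.+2) g).
    exact: is_derive_pospow.
  exact: dg.
rewrite -[0%N]addn0; apply: (SymM r0) => //; apply: (SymZ r0); exact: IH.
Qed.

(* Vanishes near the origin and has finitely many derivatives only; the gain is
   that [1 - cutoff K = O(|w|^-2n)] is integrable by inspection. *)
Definition cutoff K (w : T) : R :=
  if dotp w w < 2^-1 then 0 else pospow K (1 + -1 * (2^-1 * r2inv w) ^+ n).

Lemma cutoff_Amp k K : (k < K)%N -> Amp r k 0 (fun _ => cutoff K).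
Proof.
move=> kK; split; last by move=> y w iw; rewrite /cutoff iw.
pose g (w : T) : R := 1 + -1 * (2^-1 * r2inv w) ^+ n.
have x0 (w : T) : 0 <= 2^-1 * r2inv w.
  by rewrite mulr_ge0// /r2inv invr_ge0 dotp_ge0.
apply: (@Sym_eq _ _ _ r k 0 (fun _ w => pospow K (g w))).
  move=> y w ow; rewrite /cutoff; case: ifPn => // iw.
  (* On the overlap 1/(2|w|^2) is at least 1, so the formula already gives 0. The case split in
     [cutoff] matters only at the origin, where [r2inv] takes the default value 0. *)
  rewrite /pospow max_l ?expr0n; first by case: (K) kK.
  rewrite /g mulN1r subr_le0 exprn_ege1//.
  rewrite /r2inv -invfM invr_ge1 ?unitfE ?gt_eqF//.
  - by have := dotp_gt0 (outer_neq0 ow); move: iw; lra.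
  - by rewrite mulr_gt0// dotp_gt0//; exact: outer_neq0.
  - by rewrite mulr_gt0// dotp_gt0//; exact: outer_neq0.
apply: pospow_Sym => // [w|k'].
  by rewrite /g mulN1r gerBl exprn_ge0.
apply: SymD; first exact: Sym_cst.
apply: (SymZ r0).
have sr : Sym k' 0 (fun _ w => 2^-1 * r2inv w).
  apply: (SymZ r0); apply: (@Hom_Sym _ _ _ _ _ k' (-2)) => [w /ltW//||].
    by rewrite oppr_le0.
  exact: Hom_r2inv.
suff H N : Sym k' 0 (fun _ w => (2^-1 * r2inv w) ^+ N) by exact: H.
elim: N => [|N IH].
  by under eq_fun do under eq_fun do rewrite expr0; exact: Sym_cst.
under eq_fun do under eq_fun do rewrite exprS.
by rewrite -[0%N]addn0; exact: (SymM r0).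
Qed.

Lemma bernoulli_le (x : R) K : 0 <= x <= 1 -> 1 - (1 - x) ^+ K <= K%:R * x.
Proof.
move=> /andP[x0 x1]; elim: K => [|K IH]; first by rewrite expr0 subrr mul0r.
rewrite exprS -natr1; have p0 : 0 <= (1 - x) ^+ K by rewrite exprn_ge0// subr_ge0.
have p1 : (1 - x) ^+ K <= 1 by rewrite exprn_ile1 ?subr_ge0// gerBl.
by move: IH p0 p1; move: ((1 - x) ^+ K) (K%:R) => p k; nra.
Qed.

Lemma inv_wt_le_dotp (w : T) : (wt w)^-1 <= (1 + dotp w w) ^+ n.
Proof.
rewrite /wt -prodfV -[X in _ ^+ X](card_ord n) -prodr_const.
apply: ler_prod => i _; rewrite /wt1 invrK addr_ge0 ?sqr_ge0//=.
by rewrite lerD2l /dotp (bigD1 i)//= -expr2 lerDl sumr_ge0// => j _; rewrite -expr2 sqr_ge0.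
Qed.

(** Bernoulli's inequality bounds 1 - (1 - x)^K by K x, here with x = (2|w|^2)^(-n), which decays as
    fast as [wt] is required to allow. *)
Lemma cutoff_compl K : exists2 C, 0 <= C & forall w, `|1 - cutoff K w| <= C * wt w.
Proof.
have C0 : 0 <= (3 / 2) ^+ n :> R by rewrite exprn_ge0// divr_ge0.
(* The number 3/2 bounds 1 + |w|^2 where |w|^2 < 1/2, and (1 + |w|^2) / (2|w|^2) elsewhere; [K.+1]
   is at least 1, as the inner region needs. *)
exists (K.+1%:R * (3 / 2) ^+ n); first by rewrite mulr_ge0.
move=> w; rewrite -ler_pdivrMr ?wt_gt0//.
apply: (@le_trans _ _ (`|1 - cutoff K w| * (1 + dotp w w) ^+ n)).
  by rewrite ler_wpM2l// inv_wt_le_dotp.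
rewrite /cutoff; case: ifPn => iw.
  rewrite subr0 normr1 mul1r; apply: (@le_trans _ _ ((3 / 2) ^+ n)).
    rewrite lerXn2r ?nnegrE ?divr_ge0 ?addr_ge0 ?dotp_ge0//.
    by move: iw; lra.
  by rewrite ler_peMl// ler1n.
rewrite -leNgt in iw; have s0 : 0 < dotp w w by rewrite (lt_le_trans _ iw)// invr_gt0.
set x := (2^-1 * r2inv w) ^+ n.
have b0 : 0 <= 2^-1 * r2inv w by rewrite mulr_ge0// /r2inv invr_ge0 ltW.
have b1 : 2^-1 * r2inv w <= 1.
  rewrite /r2inv -invfM invf_le1 ?mulr_gt0//; move: iw; lra.
have x0 : 0 <= x by exact: exprn_ge0.
have x1 : x <= 1 by exact: exprn_ile1.
rewrite mulN1r /pospow max_r ?subr_ge0//.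
rewrite ger0_norm; last by rewrite subr_ge0 exprn_ile1 ?subr_ge0// gerBl.
apply: (@le_trans _ _ (K.+1%:R * x * (1 + dotp w w) ^+ n)).
  rewrite ler_wpM2r ?exprn_ge0 ?addr_ge0 ?dotp_ge0//.
  rewrite (le_trans (bernoulli_le K _)) ?x0//.
  by rewrite ler_wpM2r// ler_nat.
rewrite -mulrA ler_wpM2l// /x -exprMn lerXn2r ?nnegrE ?divr_ge0 ?mulr_ge0 ?addr_ge0 ?dotp_ge0//.
  by rewrite /r2inv invr_ge0 dotp_ge0.
rewrite /r2inv mulrAC ler_pdivrMr//; move: iw; lra.
Qed.

End Cutoff.

Section RintegralSum.
Variables (R : realType) (n : nat).
Local Notation T := (n.-tuple R).

Lemma Rintegral_sum I (s : seq I) (f : I -> T -> R) :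
  (forall i, (mleb R n).-integrable setT (EFin \o f i)) ->
  (mleb R n).-integrable setT (EFin \o (fun x => \sum_(i <- s) f i x)) /\
  \int[mleb R n]_x (\sum_(i <- s) f i x) = \sum_(i <- s) \int[mleb R n]_x f i x.
Proof.
move=> fi; elim: s => [|i s [IHi IHe]].
  rewrite big_nil; under eq_fun do rewrite big_nil; split.
    exact: integrable0.
  by rewrite /Rintegral integral0.
rewrite big_cons; under eq_fun do rewrite big_cons; split.
  have -> : EFin \o (fun x => f i x + \sum_(j <- s) f j x) =
    (EFin \o f i) \+ (EFin \o (fun x => \sum_(j <- s) f j x)) by apply/funext.
  exact: integrableD.
by rewrite RintegralD// IHe.
Qed.

(** The convolution of [wt] with itself, evaluated at z - p since [wt] is even. *)
Definition conv (p z : T) : R := \int[mleb R n]_w (wt (vsub w p) * wt (vsub w z)).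

Lemma integrable_conv (p z : T) :
  (mleb R n).-integrable setT (EFin \o (fun w => wt (vsub w p) * wt (vsub w z))).
Proof.
apply: (@integrable_wt_shift _ _ 1 z) => [|w].
  by apply: measurable_funM; exact: measurable_wt_shift.
by rewrite mul1r ger0_norm ?mulr_ge0 ?wt_ge0// ler_piMl ?wt_ge0// wt_le1.
Qed.

Lemma conv_ge0 p z : 0 <= conv p z.
Proof. by apply: Rintegral_ge0 => w _; rewrite mulr_ge0// wt_ge0. Qed.

Lemma le_norm_Rintegral_conv (f : T -> R) (s : seq T) (C : R) (z : T) :
  measurable_fun [set: T] f ->
  (forall w, `|f w| <= C * (\sum_(p <- s) wt (vsub w p)) * wt (vsub w z)) ->
  `|\int[mleb R n]_w f w| <= C * \sum_(p <- s) conv p z.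
Proof.
move=> mf bf.
have [gi ge] := Rintegral_sum s (fun p => integrable_conv p z).
have gi' : (mleb R n).-integrable setT
    (EFin \o (fun w => C * \sum_(p <- s) wt (vsub w p) * wt (vsub w z))).
  rewrite (_ : EFin \o _ = (fun w => C%:E *
    (EFin \o (fun w => (\sum_(p <- s) wt (vsub w p) * wt (vsub w z))%R)) w)%E).
    exact: integrableZl.
  by apply/funext => w; rewrite /= EFinM.
have fi : (mleb R n).-integrable setT (EFin \o f).
  apply: le_integrable gi' => //; first exact/measurable_EFinP.
  move=> w _; rewrite /= lee_fin (le_trans (bf w))// -mulrA mulr_suml.
  exact: ler_norm.
rewrite (le_trans (le_normr_Rintegral _ fi))// /conv -ge -RintegralZl//.
apply: le_Rintegral => //.
  by have := integrable_norm fi.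
by move=> w _; rewrite (le_trans (bf w))// -mulrA mulr_suml.
Qed.

End RintegralSum.

Section Phase.
Variables (R : realType) (n : nat) (mu : n.-tuple R -> R) (m : R).
Local Notation T := (n.-tuple R).
Hypothesis m_ge2 : 2 <= m.
Hypothesis smu : smooth_off0 mu.
Hypothesis hmu : forall (lam : R) (x : T), 0 < lam -> x <> vzero R n ->
  mu (vscale lam x) = lam `^ m * mu x.
Hypothesis nondeg : forall x : T, enorm x = 1 -> \det (hessian mu x) != 0.

Definition m1 (j : 'I_n) : T -> R := rdpart [:: j] mu.
Definition m2 (j k : 'I_n) : T -> R := rdpart [:: k; j] mu.

Lemma haspd_mu j w : w <> vzero R n -> haspd j mu w (m1 j w).
Proof. exact: (haspd_rdpart [::]). Qed.

Lemma haspd_m1 j k w : w <> vzero R n -> haspd k (m1 j) w (m2 j k w).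
Proof. exact: haspd_rdpart. Qed.

Lemma Hom_mu k : Hom k m mu.
Proof. by have := smooth_Hom k [::] smu hmu; rewrite subr0. Qed.

Lemma Hom_m1 k j : Hom k (m - 1) (m1 j).
Proof. exact: (smooth_Hom k [:: j] smu hmu). Qed.

Lemma Hom_m2 l j k : Hom l (m - 2) (m2 j k).
Proof. exact: (smooth_Hom l [:: k; j] smu hmu). Qed.

Local Notation u := (grad_scaled m m1).
Local Notation r := (resr u).
Local Notation v := (resv u).
Local Notation e := (rese u).
Local Notation Om := (@outer R n).
Local Notation Sym := (Sym Om r).
Local Notation Amp := (Amp r).

Let r0 := resr_ge0 u.
Let r1 := resr_le1 u.

Lemma resr_weight : exists (s : seq T) (C : R), 0 <= C /\ forall y, exists z : T -> T,
  forall w, w <> vzero R n -> r y w ^+ (2 * n) <= C * \sum_(om <- s) wt (vsub w (z om)).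
Proof.
apply: (resolvent_weight m_ge2 haspd_m1).
- by move=> j k w; exact: (Hom_cont (Hom_m2 0 j k)).
- by move=> j k lam w; exact: (Hom_hom (Hom_m2 0 j k)).
(* [m2 j k] differentiates first in direction j, so its matrix is the transposed Hessian; taking the
   determinant avoids appealing to the symmetry of second derivatives. *)
- move=> om om1; rewrite (_ : \matrix_(j, k) _ = (hessian mu om)^T).
    by rewrite det_tr; exact: nondeg.
  by apply/matrixP => j k; rewrite !mxE.
Qed.

Lemma Hom_theta k : Hom k (2 - m) (theta (n := n) m).
Proof.
apply: (@Hom_exp _ _ _ (2 * ((2 - m) / 2))); last exact: Hom_dotp_powR.
by field.
Qed.

Let Om_half w : Om w -> 2^-1 <= enorm w. Proof. exact: ltW. Qed.

Let thetam : 2 - m <= 0. Proof. by rewrite subr_le0. Qed.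

(** The p and q of the overview: [qq] is the logarithmic derivative of [theta], of degree -1, and
    [pp] is the scaled Hessian, of degree 0. *)
Definition pp (j k : 'I_n) (w : T) : R := theta m w * m2 j k w.
Definition qq (k : 'I_n) (w : T) : R := (2 - m) * (tnth w k * r2inv w).

Lemma Sym_theta k : Sym k 0 (fun _ => theta m).
Proof. exact: (@Hom_Sym _ _ _ _ _ k (2 - m) _ Om_half thetam (Hom_theta k)). Qed.

Lemma Sym_pp l j k : Sym l 0 (fun _ => pp j k).
Proof.
apply: (@Hom_Sym _ _ _ _ _ l 0 _ Om_half (lexx 0)); apply: (@Hom_exp _ _ _ (2 - m + (m - 2))); first by ring.
by apply: HomM; [exact: Hom_theta|exact: Hom_m2].
Qed.

Lemma Sym_qq l k : Sym l 0 (fun _ => qq k).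
Proof.
apply: (@Hom_Sym _ _ _ _ _ l (-1) _ Om_half); first by rewrite oppr_le0.
apply: HomZ; apply: (@Hom_exp _ _ _ (1 + -2)); first by ring.
by apply: HomM; [exact: Hom_coord|exact: Hom_r2inv].
Qed.

Lemma rcont_u j y w : w <> vzero R n -> rcont_at (u j y) w.
Proof.
move=> w0; apply: rcontM; first exact: (Hom_cont (Hom_theta 0)).
apply: rcontD; last exact: rcont_cst.
exact: (Hom_cont (Hom_m1 0 j)).
Qed.

Lemma haspd_u j k y w : w <> vzero R n ->
  haspd k (u j y) w (pp j k w + qq k w * u j y w).
Proof.
move=> w0.
have h1 := @haspd_dotp_powR _ _ ((2 - m) / 2) k w w0.
have h2 := haspdD (haspd_m1 j k w0) (haspd_cst k (tnth y j) w).
apply: haspd_eq (haspdM h1 h2) _.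
rewrite /pp /qq /grad_scaled /theta; move: (_ `^ _) => t.
by field.
Qed.

Lemma Sym_ve k : Sym k 1 v /\ forall j, Sym k 1 (e j).
Proof.
apply: (@Sym_resolvent _ _ _ Om u pp qq).
- by move=> j l y w /outer_neq0; exact: haspd_u.
- by move=> j y w /outer_neq0; exact: rcont_u.
- by move=> l i j; exact: Sym_pp.
- by move=> l i; exact: Sym_qq.
Qed.

(** The coefficient of the j-th integration by parts: multiplied by the j-th derivative of the phase
    it gives u_j e_j (see [aaE]). *)
Definition aa j (y w : T) : R := theta m w * e j y w.

Lemma Sym_aa k j : Sym k 1 (aa j).
Proof.
rewrite -[1%N]add0n; apply: (SymM r0); first exact: Sym_theta.
by have [_] := Sym_ve k.
Qed.

Definition phase (y w : T) : R := mu w + dotp y w.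
Definition osc (tau : R) (y w : T) : R := cos (2 * pi * phase y w + tau).
Definition ee j (y w : T) : R := u j y w * e j y w.

Lemma aaE j y w : w <> vzero R n -> (m1 j w + tnth y j) * aa j y w = ee j y w.
Proof. by move=> w0; rewrite /aa /ee /grad_scaled; ring. Qed.

Lemma norm_ee_le1 j y w : `|ee j y w| <= 1.
Proof.
rewrite /ee mulrC.
have h0 i : 0 <= u i y w * e i y w.
  by rewrite /rese mulrA -expr2 mulr_ge0 ?sqr_ge0// ltW// resv_gt0.
rewrite mulrC ger0_norm// (@le_trans _ _ (\sum_i u i y w * e i y w))//.
  by rewrite (bigD1 j)//= lerDl sumr_ge0.
by rewrite sum_urese gerBl ltW// resv_gt0.
Qed.

Lemma rcont_ee j y w : w <> vzero R n -> rcont_at (ee j y) w.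
Proof.
move=> w0; apply: rcontM; first exact: rcont_u.
apply: rcontM; first exact: rcont_u.
apply: rcontV.
  by rewrite gt_eqF// ltr_pwDl// sumr_ge0// => i _; exact: sqr_ge0.
apply: rcontD; first exact: rcont_cst.
by apply: rcont_sum => i; apply: rcontM; exact: rcont_u.
Qed.

Lemma haspd_phase j y w : w <> vzero R n ->
  haspd j (phase y) w (m1 j w + tnth y j).
Proof. by move=> w0; apply: haspdD; [exact: haspd_mu|exact: haspd_dotp]. Qed.

Lemma rcont_phase y w : w <> vzero R n -> rcont_at (phase y) w.
Proof.
by move=> w0; apply: rcontD; [exact: (Hom_cont (Hom_mu 0))|exact: rcont_dotp].
Qed.

Lemma rcont_osc tau y w : w <> vzero R n -> rcont_at (osc tau y) w.
Proof. by move=> w0; apply: rcont_cos; exact: rcont_phase. Qed.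

Lemma norm_osc_le1 tau y w : `|osc tau y w| <= 1.
Proof. exact: norm_cos_le1. Qed.

End Phase.

Section IntegrationByParts.
Variables (R : realType) (n : nat) (mu : n.-tuple R -> R) (m : R).
Local Notation T := (n.-tuple R).
Hypothesis m_ge2 : 2 <= m.
Hypothesis smu : smooth_off0 mu.
Hypothesis hmu : forall (lam : R) (x : T), 0 < lam -> x <> vzero R n ->
  mu (vscale lam x) = lam `^ m * mu x.
Hypothesis nondeg : forall x : T, enorm x = 1 -> \det (hessian mu x) != 0.

Local Notation u := (grad_scaled m (m1 mu)).
Local Notation r := (resr u).
Local Notation v := (resv u).
Local Notation e := (rese u).
Local Notation Om := (@outer R n).
Local Notation Sym := (Sym Om r).
Local Notation Amp := (Amp r).
Local Notation osc := (osc mu).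
Local Notation aa := (aa mu m).
Local Notation ee := (ee mu m).

Let r0 := resr_ge0 u.
Let r1 := resr_le1 u.

Definition osI tau (c : T -> T -> R) (G : T -> R) (y z : T) : R :=
  \int[mleb R n]_w (osc tau y w * (c y w * G (vsub w z))).

Lemma amp_rcont k N k' c G (f : T -> R) y z :
  (forall w, w <> vzero R n -> rcont_at f w) -> Amp k N c -> Wreg k' G ->
  forall w, rcont_at (fun w => f w * (c y w * G (vsub w z))) w.
Proof.
move=> cf ac wG w.
rewrite (_ : (fun w => _) = (fun w => f w * G (vsub w z) * c y w)); last first.
  by apply/funext => x; ring.
apply: (Amp_rcontM y ac) => w0; apply: rcontM; first exact: cf.
by apply: rcont_shift; exact: Wreg_cont wG _.
Qed.

Lemma amp_bound k N k' c G : Amp k N c -> Wreg k' G -> exists2 C, 0 <= C &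
  forall (f : T -> R) y z w, `|f w| <= 1 ->
    `|f w * (c y w * G (vsub w z))| <= C * wt (vsub w z).
Proof.
move=> ac wG; have [C C0 hC] := Amp_bound1 r0 r1 ac; have [D hD] := Wreg_bound wG.
exists (C * `|D|); first by rewrite mulr_ge0.
move=> f y z w f1; rewrite !normrM (@le_trans _ _ (1 * (`|c y w| * `|G (vsub w z)|)))//.
  by rewrite ler_wpM2r// mulr_ge0.
by rewrite mul1r -mulrA ler_pM// (le_trans (hD _))// ler_wpM2r ?ler_norm// wt_ge0.
Qed.

Lemma amp_integrable k N k' c G (f : T -> R) y z :
  (forall w, w <> vzero R n -> rcont_at f w) -> (forall w, `|f w| <= 1) ->
  Amp k N c -> Wreg k' G ->
  (mleb R n).-integrable setT (EFin \o (fun w => f w * (c y w * G (vsub w z)))).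
Proof.
move=> cf f1 ac wG; have [C C0 hC] := amp_bound ac wG.
apply: (@integrable_wt_shift _ _ C z); last by move=> w; exact: hC.
by apply: measurable_rcont; exact: (amp_rcont y z cf ac wG).
Qed.

(** Integrate the j-th derivative of [osc (tau - pi / 2)] times the amplitude times G. A derivative
    on the phase restores the shift [tau] and produces 2 pi [ee j]; the two other terms have an
    amplitude with one more power of r. *)
Lemma osc_by_parts k N k' k'' c b' G G' j tau y z :
  Amp k N c -> (forall y w, haspd j (fun w => aa j y w * c y w) w (b' y w)) ->
  Amp k N.+1 (fun y w => aa j y w * c y w) -> Amp k N.+1 b' ->
  (forall x, haspd j G x (G' x)) -> Wreg k' G -> Wreg k'' G' ->
  \int[mleb R n]_w (osc tau y w * ee j y w * (c y w * G (vsub w z))) =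
  - (2 * pi)^-1 * (osI (tau - pi / 2) b' G y z +
     osI (tau - pi / 2) (fun y w => aa j y w * c y w) G' y z).
Proof.
move=> ac db ab ab' dG wG wG'.
pose b y w := aa j y w * c y w.
have pi20 : 0 < 2 * pi :> R by rewrite mulr_gt0// pi_gt0.
have cosc t w : w <> vzero R n -> rcont_at (osc t y) w by exact: (rcont_osc smu hmu).
have oscb t w : `|osc t y w| <= 1 by exact: norm_osc_le1.
pose f0 w := osc tau y w * ee j y w.
have cf0 w : w <> vzero R n -> rcont_at f0 w.
  by move=> w0; apply: rcontM; [exact: cosc|exact: (rcont_ee smu hmu)].
have f01 w : `|f0 w| <= 1.
  by rewrite normrM mulr_ile1// norm_ee_le1.
pose F w := osc (tau - pi / 2) y w * (b y w * G (vsub w z)).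
pose F1 w := osc tau y w * ee j y w * (c y w * G (vsub w z)).
pose F2 w := osc (tau - pi / 2) y w * (b' y w * G (vsub w z)).
pose F3 w := osc (tau - pi / 2) y w * (b y w * G' (vsub w z)).
have iF1 := amp_integrable y z cf0 f01 ac wG.
have iF2 := amp_integrable y z (cosc (tau - pi / 2)) (oscb _) ab' wG.
have iF3 := amp_integrable y z (cosc (tau - pi / 2)) (oscb _) ab wG'.
pose F' w := 2 * pi * F1 w + (F2 w + F3 w).
have dF w : haspd j F w (F' w).
  pose h z' := osc (tau - pi / 2) y z' * G (vsub z' z).
  pose dh z' := 2 * pi * (m1 mu j z' + tnth y j) * osc tau y z' * G (vsub z' z) +
    osc (tau - pi / 2) y z' * G' (vsub z' z).
  have hh w' : w' <> vzero R n -> haspd j h w' (dh w').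
    move=> w0; apply: haspdM; last by apply: haspd_shift; exact: dG.
    apply: haspd_eq (haspd_cos _ _ (haspd_phase smu j y w0)) _.
    rewrite (addrA (2 * pi * phase mu y w')) sinBpihalf /osc mulNr mulrN opprK.
    by [].
  have := Amp_haspdM ab ab' (db y) (@hh w).
  rewrite (_ : (fun z0 => h z0 * (aa j y z0 * c y z0)) = F); last first.
    by apply/funext => x; rewrite /h /F /b; ring.
  move=> H; apply: haspd_eq H _.
  (* The phase has no usable derivative at the origin, but there all amplitudes vanish. *)
  have [->|w0] := pselect (w = vzero R n).
    have [_ c0] := ac; have [_ b'0] := ab'.
    by rewrite /F' /F1 /F2 /F3 /b c0 ?inner0// b'0 ?inner0//; ring.
  rewrite /dh /h /F' /F1 /F2 /F3 /b -(aaE mu m j y w0); ring.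
have [C1 C10 hC1] := amp_bound ac wG; have [C2 C20 hC2] := amp_bound ab' wG.
have [C3 C30 hC3] := amp_bound ab wG'; have [C4 C40 hC4] := amp_bound ab wG.
have cF w : rcont_at F' w.
  apply: rcontD.
    apply: rcontM; first exact: rcont_cst.
    exact: (amp_rcont y z cf0 ac wG).
  by apply: rcontD; [exact: (amp_rcont y z (cosc _) ab' wG)|
    exact: (amp_rcont y z (cosc _) ab wG')].
pose M := C4 + (2 * pi * C1 + (C2 + C3)).
have := @integral_haspd0 _ _ j F F' M z dF.
have iF1' : (mleb R n).-integrable setT (EFin \o (fun w => 2 * pi * F1 w)).
  rewrite (_ : EFin \o _ = (fun w => (2 * pi)%:E * (EFin \o F1) w)%E).
    exact: integrableZl.
  by apply/funext => w; rewrite /= EFinM.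
have iF23 : (mleb R n).-integrable setT (EFin \o (fun w => F2 w + F3 w)).
  rewrite (_ : EFin \o _ = (EFin \o F2) \+ (EFin \o F3)); last by apply/funext.
  exact: integrableD.
have -> : (\int[mleb R n]_w (F' w)%:E)%E = (2 * pi * (\int[mleb R n]_w F1 w)%R +
   (osI (tau - pi / 2) b' G y z + osI (tau - pi / 2) b G' y z))%:E.
  rewrite -[LHS]fineK; last first.
    apply: integrable_fin_num => //.
    rewrite (_ : (fun w => _) = (EFin \o (fun w => (2 * pi * F1 w)%R)) \+
      (EFin \o (fun w => F2 w + F3 w)%R)); last by apply/funext.
    exact: integrableD.
  congr EFin; rewrite -/(Rintegral _ _ F') /F' RintegralD// RintegralZl//.
  by rewrite [X in _ + X]RintegralD.
move=> H.
suff : 2 * pi * (\int[mleb R n]_w F1 w)%R +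
   (osI (tau - pi / 2) b' G y z + osI (tau - pi / 2) b G' y z) = 0.
  rewrite -/F1 => /eqP; rewrite addr_eq0 => /eqP h.
  by rewrite mulNr -mulrN -h mulKf// gt_eqF.
apply: EFin_inj; apply: H.
- by move=> x t; apply: (@rcont_line _ _ F'); exact: cF.
- exact: measurable_rcont.
- move=> w; rewrite (le_trans (hC4 _ _ _ _ (oscb _ w)))// ler_wpM2r ?wt_ge0// /M.
  by rewrite lerDl !addr_ge0// !mulr_ge0// pi_ge0.
- move=> w; rewrite /F' (le_trans (ler_normD _ _))//.
  rewrite (@le_trans _ _ ((2 * pi * C1 + (C2 + C3)) * wt (vsub w z)))//.
    rewrite [leRHS]mulrDl lerD//.
      rewrite normrM (gtr0_norm pi20) -[X in _ <= X]mulrA ler_wpM2l ?(ltW pi20)//.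
      exact: (hC1 f0 y z w (f01 w)).
    rewrite [leRHS]mulrDl (le_trans (ler_normD _ _))// lerD//; [exact: (hC2 _ _ _ _ (oscb _ w))|exact: (hC3 _ _ _ _ (oscb _ w))].
  by rewrite ler_wpM2r ?wt_ge0// /M lerDr.
Qed.

End IntegrationByParts.

Section Decay.
Variables (R : realType) (n : nat) (mu : n.-tuple R -> R) (m : R).
Local Notation T := (n.-tuple R).
Hypothesis m_ge2 : 2 <= m.
Hypothesis smu : smooth_off0 mu.
Hypothesis hmu : forall (lam : R) (x : T), 0 < lam -> x <> vzero R n ->
  mu (vscale lam x) = lam `^ m * mu x.
Hypothesis nondeg : forall x : T, enorm x = 1 -> \det (hessian mu x) != 0.

Local Notation u := (grad_scaled m (m1 mu)).
Local Notation r := (resr u).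
Local Notation v := (resv u).
Local Notation e := (rese u).
Local Notation Om := (@outer R n).
Local Notation Sym := (Sym Om r).
Local Notation Amp := (Amp r).
Local Notation osc := (osc mu).
Local Notation aa := (aa mu m).
Local Notation ee := (ee mu m).
Local Notation osI := (osI mu).

Let r0 := resr_ge0 u.
Let r1 := resr_le1 u.

Lemma osI_split k N k' c G tau y z : Amp k N c -> Amp k N.+1 (fun y w => v y w * c y w) ->
  Wreg k' G ->
  osI tau c G y z = osI tau (fun y w => v y w * c y w) G y z +
    \sum_(j < n) \int[mleb R n]_w (osc tau y w * ee j y w * (c y w * G (vsub w z))).
Proof.
move=> ac avc wG.
have cosc t w : w <> vzero R n -> rcont_at (osc t y) w by exact: (rcont_osc smu hmu).
have oscb t w : `|osc t y w| <= 1 by exact: norm_osc_le1.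
have ij j : (mleb R n).-integrable setT (EFin \o
    (fun w => osc tau y w * ee j y w * (c y w * G (vsub w z)))).
  apply: (amp_integrable y z _ _ ac wG) => [w w0|w].
    by apply: rcontM; [exact: cosc|exact: (rcont_ee smu hmu)].
  by rewrite normrM mulr_ile1// norm_ee_le1.
have iv := amp_integrable y z (cosc tau) (oscb tau) avc wG.
have [isum <-] := Rintegral_sum (index_enum 'I_n) ij.
rewrite /osI -RintegralD//; apply: eq_Rintegral => w _.
rewrite -mulr_suml -mulr_sumr sum_urese; ring.
Qed.

(** Induction on the remaining budget k: a step spends one derivative of the amplitude and of G and
    earns one power of r, so N + k stays 2n. The centres are fixed beforehand and serve all
    amplitudes. *)
Lemma decay : exists (s : seq T) (zz : T -> T -> T), forall k N c G,
  (N + k = 2 * n)%N -> Amp k N c -> Wreg k G -> exists2 C, 0 <= C &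
  forall tau y z, `|osI tau c G y z| <= C * \sum_(p <- s) conv (zz y p) z.
Proof.
have [s [C0 [C00 hC0]]] := resr_weight m_ge2 smu hmu nondeg.
have /choice[zz hzz] := hC0.
exists s, zz; elim=> [|k IH] N c G Nk ac wG.
- have [C1 C10 hC1] := Amp_bound r0 ac; have [D hD] := Wreg_bound wG.
  rewrite addn0 in Nk.
  exists (C1 * C0 * `|D|); first by rewrite !mulr_ge0.
  move=> tau y z; rewrite -(big_map (zz y) xpredT (fun p => conv p z)).
  apply: le_norm_Rintegral_conv.
    apply: measurable_rcont; apply: (amp_rcont y z _ ac wG).
    exact: (rcont_osc smu hmu).
  move=> w; rewrite big_map normrM (le_trans (ler_piMl _ (norm_osc_le1 _ _ _ _)))//.
  (* [resr_weight] says nothing at the origin, where the amplitude vanishes. *)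
  have [->|w0] := pselect (w = vzero R n).
    have [_ c0] := ac; rewrite c0 ?inner0// mul0r normr0 mulr_ge0 ?wt_ge0// mulr_ge0//.
      by rewrite !mulr_ge0.
    by apply: sumr_ge0 => p _; exact: wt_ge0.
  have hDw : `|G (vsub w z)| <= `|D| * wt (vsub w z).
    by rewrite (le_trans (hD _))// ler_wpM2r ?wt_ge0// ler_norm.
  rewrite normrM (le_trans (ler_pM _ _ (hC1 y w) hDw))//.
  have := hzz y w w0; rewrite -Nk; move: (\sum_(j <- s) _) (wt_ge0 (vsub w z)) => S.
  move: (wt _) (r y w ^+ N) => W q W0 hq.
  have -> : C1 * q * (`|D| * W) = C1 * `|D| * W * q by ring.
  have -> : C1 * C0 * `|D| * S * W = C1 * `|D| * W * (C0 * S) by ring.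
  by rewrite ler_wpM2l// !mulr_ge0.
- have [s1v s1e] := Sym_ve smu hmu k.+1.
  have avc : Amp k.+1 N.+1 (fun y w => v y w * c y w) by rewrite -add1n; exact: (AmpM r0 s1v ac).
  have aac j : Amp k.+1 N.+1 (fun y w => aa j y w * c y w).
    by rewrite -add1n; exact: (AmpM r0 (Sym_aa m_ge2 smu hmu k.+1 j) ac).
  have Nk' : (N.+1 + k = 2 * n)%N by rewrite addSnnS.
  have wGk : Wreg k G by exact: Reg_le wG.
  have [Cv Cv0 hCv] := IH _ _ G Nk' (Amp_le r0 r1 (leqnSn k) avc) wGk.
  have /choice[K hK] : forall j : 'I_n, exists K : R, 0 <= K /\ forall tau y z,
      `|\int[mleb R n]_w (osc tau y w * ee j y w * (c y w * G (vsub w z)))| <=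
      K * \sum_(p <- s) conv (zz y p) z.
    move=> j; have [b' [db ab']] := Amp_deriv j (aac j).
    have [G' [dG wG']] := Wreg_deriv j wG.
    have [C1 C10 hC1] := IH _ _ G Nk' ab' wGk.
    have [C2 C20 hC2] := IH _ _ G' Nk' (Amp_le r0 r1 (leqnSn k) (aac j)) wG'.
    exists ((2 * pi)^-1 * (C1 + C2)); split.
      by rewrite mulr_ge0 ?addr_ge0// invr_ge0 mulr_ge0// pi_ge0.
    move=> tau y z.
    rewrite (osc_by_parts smu hmu tau y z (Amp_le r0 r1 (leqnSn k) ac) db (Amp_le r0 r1 (leqnSn k) (aac j)) ab' dG wG wG').
    have p0 : 0 <= (2 * pi)^-1 :> R by rewrite invr_ge0 mulr_ge0// pi_ge0.
    rewrite normrM normrN (ger0_norm p0) -[leRHS]mulrA ler_wpM2l//.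
    by rewrite [leRHS]mulrDl (le_trans (ler_normD _ _))// lerD.
  exists (Cv + \sum_j K j).
    by rewrite addr_ge0// sumr_ge0// => j _; case: (hK j).
  move=> tau y z; rewrite (osI_split tau y z ac avc wG) [leRHS]mulrDl.
  rewrite (le_trans (ler_normD _ _))// lerD//.
  rewrite (le_trans (ler_norm_sum _ _ _))// mulr_suml; apply: ler_sum => j _.
  by have [_] := hK j.
Qed.

End Decay.

Section TupleMeasurability.
Context d (X : measurableType d) (R : realType) (n : nat).
Local Notation T := (n.-tuple R).

Lemma measurable_vsub2 (p q : X -> T) : measurable_fun setT p -> measurable_fun setT q ->
  measurable_fun setT (fun x => vsub (p x) (q x)).
Proof.
move=> mp mq; apply/measurable_fun_tnthP => i.
rewrite (_ : _ \o _ = fun x => tnth (p x) i - tnth (q x) i); last first.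
  by apply/funext => x; rewrite /= tnth_vsub.
by apply: measurable_funB;
  [exact: (measurableT_comp (measurable_tnth i) mp)|
   exact: (measurableT_comp (measurable_tnth i) mq)].
Qed.

Lemma measurable_dotp2 (p q : X -> T) : measurable_fun setT p -> measurable_fun setT q ->
  measurable_fun setT (fun x => dotp (p x) (q x)).
Proof.
move=> mp mq; apply: measurable_sum => i.
by apply: measurable_funM;
  [exact: (measurableT_comp (measurable_tnth i) mp)|
   exact: (measurableT_comp (measurable_tnth i) mq)].
Qed.

End TupleMeasurability.

Section ConvIntegral.
Variables (R : realType) (n : nat).
Local Notation T := (n.-tuple R).

Let mconv2 (p : T) : measurable_fun [set: T * T]
  (fun x : T * T => (wt (vsub x.2 p) * wt (vsub x.2 x.1))%:E).
Proof.
apply/measurable_EFinP; apply: measurable_funM.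
  apply: (measurableT_comp (@measurable_wt R n)).
  by apply: measurable_vsub2 => //; exact: measurable_snd.
apply: (measurableT_comp (@measurable_wt R n)).
by apply: measurable_vsub2; [exact: measurable_snd|exact: measurable_fst].
Qed.

Lemma EFin_conv (p z : T) :
  (conv p z)%:E = (\int[mleb R n]_w (wt (vsub w p) * wt (vsub w z))%:E)%E.
Proof.
by rewrite /conv /Rintegral fineK//; exact: integrable_fin_num (integrable_conv p z).
Qed.

Lemma measurable_conv (p : T) : measurable_fun [set: T] (conv p).
Proof.
apply/measurable_EFinP.
rewrite (_ : EFin \o _ = fubini_F (mleb R n)
  (fun x : T * T => (wt (vsub x.2 p) * wt (vsub x.2 x.1))%:E)); last first.
  by apply/funext => z; rewrite /= EFin_conv.
apply: (measurable_fun_fubini_tonelli_F _ (mconv2 p)).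
by move=> x; rewrite lee_fin mulr_ge0// wt_ge0.
Qed.

(** By Tonelli the mass is a product of two translation invariant integrals. Its independence of p
    is what removes the dependence on y at the end. *)
Lemma integral_conv (p : T) :
  (\int[mleb R n]_z (conv p z)%:E = (pi ^+ n * pi ^+ n)%:E)%E.
Proof.
under eq_integral do rewrite EFin_conv.
rewrite (@fubini_tonelli _ _ _ _ _ _ _
  (fun x : T * T => (wt (vsub x.2 p) * wt (vsub x.2 x.1))%:E)) /=; last 2 first.
- exact: mconv2.
- by move=> x; rewrite lee_fin mulr_ge0// wt_ge0.
under eq_integral => w _.
  under eq_integral => z _ do rewrite wt_sym EFinM wt_sym (wt_sym w z).
  rewrite ge0_integralZl//; last 3 first.
  - by apply/measurable_EFinP; exact: measurable_wt_shift.
  - by move=> z _; rewrite lee_fin wt_ge0.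
  - by rewrite lee_fin wt_ge0.
  rewrite integral_wt_shift muleC; over.
rewrite ge0_integralZl//; last 3 first.
- by apply/measurable_EFinP; exact: measurable_wt_shift.
- by move=> z _; rewrite lee_fin wt_ge0.
- by rewrite lee_fin exprn_ge0// pi_ge0.
by rewrite integral_wt_shift.
Qed.

End ConvIntegral.

Section OscDecay.
Variables (R : realType) (n : nat) (mu : n.-tuple R -> R) (m : R).
Local Notation T := (n.-tuple R).
Hypothesis m_ge2 : 2 <= m.
Hypothesis smu : smooth_off0 mu.
Hypothesis hmu : forall (lam : R) (x : T), 0 < lam -> x <> vzero R n ->
  mu (vscale lam x) = lam `^ m * mu x.
Hypothesis nondeg : forall x : T, enorm x = 1 -> \det (hessian mu x) != 0.

Local Notation u := (grad_scaled m (m1 mu)).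
Let r0 := resr_ge0 u.
Let r1 := resr_le1 u.

Lemma measurable_osc tau y : measurable_fun [set: T] (osc mu tau y).
Proof. by apply: measurable_rcont_off0 => w; exact: (rcont_osc smu hmu). Qed.

Lemma integrable_osc k G tau y z : Wreg k G ->
  (mleb R n).-integrable setT (EFin \o (fun w => osc mu tau y w * G (vsub w z))).
Proof.
move=> wG; have [C hC] := Wreg_bound wG.
apply: (@integrable_wt_shift _ _ C z) => [|w].
  apply: measurable_funM; first exact: measurable_osc.
  apply: (measurableT_comp _ (measurable_vsub z)).
  exact: measurable_rcont (Wreg_cont wG).
by rewrite normrM (le_trans (ler_piMl _ (norm_osc_le1 _ _ _ _))).
Qed.

(** The cut off part is handled by [decay] from order N = 0. In the remainder the factor 1 - chi is
    itself bounded by the weight, which adds the origin to the list of centres. *)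
Lemma osc_decay : exists (s : seq T) (zz : T -> T -> T), forall G,
  (forall k, Wreg k G) -> exists2 C, 0 <= C &
  forall tau y z, `|\int[mleb R n]_w (osc mu tau y w * G (vsub w z))| <=
    C * \sum_(p <- vzero R n :: map (zz y) s) conv p z.
Proof.
have [s [zz hd]] := decay m_ge2 smu hmu nondeg; exists s, zz => G wG.
(* One more than the 2n derivatives that [decay] consumes. *)
pose K := (2 * n).+1; pose chi := cutoff K : T -> R.
have aK : Amp (resr u) (2 * n) 0 (fun _ : T => chi) by exact: cutoff_Amp.
have [C1 C10 hC1] := hd _ _ _ _ (add0n _) aK (wG _).
have [C2 C20 hC2] := @cutoff_compl R n K.
have [D hD] := Wreg_bound (wG 0%N).
exists (C1 + C2 * `|D|); first by rewrite addr_ge0// mulr_ge0.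
move=> tau y z.
have cosc w : w <> vzero R n -> rcont_at (osc mu tau y) w by exact: (rcont_osc smu hmu).
have ia := amp_integrable y z cosc (norm_osc_le1 mu tau y) aK (wG 0%N).
have ig := integrable_osc tau y z (wG 0%N).
have -> : \int[mleb R n]_w (osc mu tau y w * G (vsub w z)) = osI mu tau (fun _ => chi) G y z +
    \int[mleb R n]_w (osc mu tau y w * G (vsub w z) - osc mu tau y w * (chi w * G (vsub w z))).
  by rewrite RintegralB// addrC subrK.
have p0 p : 0 <= conv p z by exact: conv_ge0.
have S0 : 0 <= \sum_(p <- map (zz y) s) conv p z by rewrite big_seq sumr_ge0.
rewrite [leRHS]mulrDl (le_trans (ler_normD _ _))// lerD//.
  rewrite (le_trans (hC1 _ _ _))// big_cons big_map ler_wpM2l//.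
  by rewrite -[leLHS]add0r lerD.
apply: (@le_trans _ _ (C2 * `|D| * \sum_(p <- [:: vzero R n]) conv p z)); last first.
  by rewrite ler_wpM2l ?mulr_ge0// big_seq1 big_cons lerDl.
apply: le_norm_Rintegral_conv.
  by have /measurable_int/measurable_EFinP := integrableB measurableT ig ia.
move=> w; rewrite big_seq1 vsub0.
have -> : osc mu tau y w * G (vsub w z) - osc mu tau y w * (chi w * G (vsub w z)) =
  osc mu tau y w * ((1 - chi w) * G (vsub w z)) by ring.
rewrite normrM (le_trans (ler_piMl _ (norm_osc_le1 _ _ _ _)))// normrM.
have hDw : `|G (vsub w z)| <= `|D| * wt (vsub w z).
  by rewrite (le_trans (hD _))// ler_wpM2r ?wt_ge0// ler_norm.
rewrite (le_trans (ler_pM _ _ (hC2 w) hDw))//.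
by rewrite le_eqVlt; apply/orP; left; apply/eqP; ring.
Qed.

End OscDecay.

(** * The Fourier transform of the localized distribution *)

Section ComplexFacts.
Variable R : realType.

Lemma cabsM (a b : R[i]) : cabs (a * b) = cabs a * cabs b.
Proof.
case: a b => [a1 a2] [b1 b2]; rewrite /cabs /= -sqrtrM ?addr_ge0 ?sqr_ge0//.
by congr Num.sqrt; ring.
Qed.

Lemma cabs_expi (t : R) : cabs (expi t) = 1.
Proof. by rewrite /cabs /= cos2Dsin2 sqrtr1. Qed.

Lemma cabs_ge0 (z : R[i]) : 0 <= cabs z. Proof. exact: sqrtr_ge0. Qed.

Lemma expiD (s t : R) : expi (s + t) = expi s * expi t.
Proof. by rewrite /expi cosD sinD; apply/eqP; rewrite eq_complex /= eqxx addrC eqxx. Qed.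

End ComplexFacts.

Section ComplexMeasurable.
Context d (X : measurableType d) (R : realType).

Definition cmeas (f : X -> R[i]) : Prop :=
  measurable_fun setT (fun x => complex.Re (f x)) /\
  measurable_fun setT (fun x => complex.Im (f x)).

Lemma cmeasM f g : cmeas f -> cmeas g -> cmeas (fun x => f x * g x).
Proof.
move=> [f1 f2] [g1 g2]; split.
  rewrite (_ : (fun x => _) = (fun x => complex.Re (f x) * complex.Re (g x) -
    complex.Im (f x) * complex.Im (g x))); last first.
    by apply/funext => x; case: (f x) (g x) => [? ?] [].
  by apply: measurable_funB; exact: measurable_funM.
rewrite (_ : (fun x => _) = (fun x => complex.Re (f x) * complex.Im (g x) +
  complex.Im (f x) * complex.Re (g x))); last first.
  by apply/funext => x; case: (f x) (g x) => [? ?] [].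
by apply: measurable_funD; exact: measurable_funM.
Qed.

Lemma cmeas_expi (a : X -> R) : measurable_fun setT a -> cmeas (fun x => expi (a x)).
Proof.
move=> ma; split; apply: measurableT_comp ma; apply: continuous_measurable_fun.
  exact: continuous_cos.
exact: continuous_sin.
Qed.

Lemma measurable_cabs f : cmeas f -> measurable_fun setT (fun x => cabs (f x)).
Proof.
move=> [f1 f2]; apply: (measurableT_comp (f := Num.sqrt : R -> R)).
  by apply: continuous_measurable_fun => x; exact: sqrt_continuous.
by apply: measurable_funD; exact: measurable_funX.
Qed.

End ComplexMeasurable.

Lemma cmeas_comp d d' (X : measurableType d) (Y : measurableType d') (R : realType)
  (f : Y -> R[i]) (p : X -> Y) : cmeas f -> measurable_fun setT p ->
  cmeas (fun x => f (p x)).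
Proof. by move=> [f1 f2] mp; split; [exact: (measurableT_comp f1)|exact: (measurableT_comp f2)]. Qed.

Section RealFubini.
Variables (R : realType) (n : nat).
Local Notation T := (n.-tuple R).

(** The kernel is split into positive and negative parts because measurability of partial integrals
    is available for nonnegative kernels without integrability. *)
Lemma measurable_Rintegral_param (K : T * T -> R) : measurable_fun setT K ->
  measurable_fun setT (fun z => \int[mleb R n]_x K (x, z)).
Proof.
move=> mK; apply: (measurableT_comp (f := fine) (g := fubini_G (mleb R n) (EFin \o K))).
  exact: fine_measurable.
have mK' : measurable_fun setT (EFin \o K) by exact/measurable_EFinP.
rewrite (_ : fubini_G _ _ = fubini_G (mleb R n) (EFin \o K)^\+ \- fubini_G (mleb R n) (EFin \o K)^\-)%E.
  apply: emeasurable_funB; apply: measurable_fun_fubini_tonelli_G => //.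
    exact: measurable_funepos.
  exact: measurable_funeneg.
apply/funext => x; rewrite /fubini_G [LHS]integralE.
congr (_ - _)%E; apply: eq_integral => y _ /=.
  by rewrite (funepos_comp (EFin \o K) (fun y => (y, x))).
by rewrite (funeneg_comp (EFin \o K) (fun y => (y, x))).
Qed.

(** The centre of the dominating weight may move with z, as the integral over x is pi^n wherever it
    sits. It is used with a constant centre and with centre z. *)
Lemma Rintegral_swap (K : T * T -> R) (p : T -> T) (C : R) : measurable_fun setT K ->
  (forall x z, `|K (x, z)| <= C * (wt (vsub x (p z)) * wt z)) ->
  \int[mleb R n]_x \int[mleb R n]_z K (x, z) =
  \int[mleb R n]_z \int[mleb R n]_x K (x, z).
Proof.
move=> mK bK; have mK' : measurable_fun setT (EFin \o K) by exact/measurable_EFinP.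
have C0 : 0 <= C.
  have := le_trans (normr_ge0 _) (bK (vzero R n) (vzero R n)).
  by rewrite pmulr_lge0// mulr_gt0// wt_gt0.
have i1 x : (mleb R n).-integrable setT (EFin \o (fun z => K (x, z))).
  apply: (@integrable_wt_shift _ _ C (vzero R n)) => [|z].
    exact: (measurableT_comp mK (measurable_pair1 x)).
  by rewrite vsub0 (le_trans (bK _ _))// ler_wpM2l// ler_piMl ?wt_ge0// wt_le1.
have i2 z : (mleb R n).-integrable setT (EFin \o (fun x => K (x, z))).
  apply: (@integrable_wt_shift _ _ (C * wt z) (p z)) => [|x].
    exact: (measurableT_comp mK (measurable_pair2 z)).
  by rewrite (le_trans (bK _ _))// mulrAC mulrA.
congr fine.
under eq_integral => x _ do rewrite (fineK (integrable_fin_num measurableT (i1 x))).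
under [RHS]eq_integral => z _ do rewrite (fineK (integrable_fin_num measurableT (i2 z))).
apply: (@Fubini _ _ _ _ _ _ _ (EFin \o K)).
apply/integrable21ltyP => //.
apply: (@le_lt_trans _ _ (\int[mleb R n]_z (C * pi ^+ n * wt z)%:E)%E).
  apply: ge0_le_integral => //.
  - by move=> z _; exact: integral_ge0.
  - apply: (measurable_fun_fubini_tonelli_G (abse \o (EFin \o K))).
      exact: measurableT_comp.
    by move=> x; exact: abse_ge0.
  - by apply/measurable_EFinP; apply: measurable_funM => //; exact: measurable_wt.
  - move=> z _; rewrite mulrAC EFinM -(integral_wt_shift (p z)) -ge0_integralZl//; last 3 first.
    + by apply/measurable_EFinP; exact: measurable_wt_shift.
    + by move=> x _; rewrite lee_fin wt_ge0.
    + by rewrite lee_fin mulr_ge0// wt_ge0.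
    apply: ge0_le_integral => //.
    + have /measurable_int := i2 z; exact: measurableT_comp.
    + by apply: measurable_funeM; apply/measurable_EFinP; exact: measurable_wt_shift.
    + by move=> x _; rewrite /= lee_fin (le_trans (bK _ _))// mulrAC mulrA.
under eq_integral do rewrite EFinM.
rewrite ge0_integralZl//; first by rewrite integral_wt ltry.
- by apply/measurable_EFinP; exact: measurable_wt.
- by move=> x _; rewrite lee_fin wt_ge0.
- by rewrite lee_fin mulr_ge0// exprn_ge0// pi_ge0.
Qed.

End RealFubini.

Section ComplexIntegral.
Variables (R : realType) (n : nat).
Local Notation T := (n.-tuple R).

Lemma cintE (f : T -> R[i]) :
  cint f = Complex (\int[mleb R n]_x complex.Re (f x)) (\int[mleb R n]_x complex.Im (f x)).
Proof. by rewrite /cint lebE. Qed.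

Lemma eq_cint (f g : T -> R[i]) : (forall x, f x = g x) -> cint f = cint g.
Proof. by move=> fg; congr cint; apply/funext. Qed.

Lemma cint_shift (f : T -> R[i]) a : cmeas f -> cint (fun x => f (vsub x a)) = cint f.
Proof.
move=> [f1 f2]; rewrite !cintE; apply: f_equal2; congr fine.
  by apply: (integral_shift (f := fun x => (complex.Re (f x))%:E)); exact/measurable_EFinP.
by apply: (integral_shift (f := fun x => (complex.Im (f x))%:E)); exact/measurable_EFinP.
Qed.

Definition cdom (f : T -> R[i]) (a : T) : Prop :=
  cmeas f /\ exists C, forall x, cabs (f x) <= C * wt (vsub x a).

Lemma cdom_integrable f a : cdom f a ->
  (mleb R n).-integrable setT (EFin \o (fun x => complex.Re (f x))) /\
  (mleb R n).-integrable setT (EFin \o (fun x => complex.Im (f x))).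
Proof.
move=> [[f1 f2] [C hC]]; split; apply: (@integrable_wt_shift _ _ C a) => // x.
  exact: le_trans (Re_le_cabs _) (hC x).
exact: le_trans (Im_le_cabs _) (hC x).
Qed.

Lemma cintZ c f a : cdom f a -> cint (fun x => c * f x) = c * cint f.
Proof.
move=> /cdom_integrable[i1 i2]; case: c => c1 c2; rewrite !cintE.
have iZ b (h : T -> R) : (mleb R n).-integrable setT (EFin \o h) ->
    (mleb R n).-integrable setT (EFin \o (fun x => b * h x)).
  move=> ih; rewrite (_ : EFin \o _ = (fun w => b%:E * (EFin \o h) w)%E).
    exact: integrableZl.
  by apply/funext => w; rewrite /= EFinM.
apply/eqP; rewrite eq_complex /=; apply/andP; split; apply/eqP.
  rewrite -!RintegralZl// -RintegralB ?iZ//; try exact: iZ.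
  by apply: eq_Rintegral => x _; case: (f x).
rewrite -!RintegralZl// -RintegralD ?iZ//; try exact: iZ.
by apply: eq_Rintegral => x _; case: (f x).
Qed.

Lemma cmeas_cint (K : T * T -> R[i]) : cmeas K -> cmeas (fun z => cint (fun x => K (x, z))).
Proof.
move=> [K1 K2]; split.
  under eq_fun do rewrite cintE /=.
  exact: (measurable_Rintegral_param K1).
under eq_fun do rewrite cintE /=.
exact: (measurable_Rintegral_param K2).
Qed.

Lemma cint_swap (K : T * T -> R[i]) (p : T -> T) (C : R) : cmeas K ->
  (forall x z, cabs (K (x, z)) <= C * (wt (vsub x (p z)) * wt z)) ->
  cint (fun x => cint (fun z => K (x, z))) = cint (fun z => cint (fun x => K (x, z))).
Proof.
move=> [K1 K2] bK; rewrite !cintE; apply: f_equal2.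
  under [LHS]eq_Rintegral do rewrite cintE /=.
  under [RHS]eq_Rintegral do rewrite cintE /=.
  apply: (Rintegral_swap (p := p) (C := C) K1) => x z.
  exact: le_trans (Re_le_cabs _) (bK _ _).
under [LHS]eq_Rintegral do rewrite cintE /=.
under [RHS]eq_Rintegral do rewrite cintE /=.
apply: (Rintegral_swap (p := p) (C := C) K2) => x z.
exact: le_trans (Im_le_cabs _) (bK _ _).
Qed.

End ComplexIntegral.

Section Dominated.
Variables (R : realType) (n : nat).
Local Notation T := (n.-tuple R).

Lemma cdom_shift (f : T -> R[i]) a : cdom f (vzero R n) -> cdom (fun x => f (vsub x a)) a.
Proof.
move=> [mf [C hC]]; split.
  by apply: cmeas_comp mf _; exact: measurable_vsub.
by exists C => x; rewrite -[X in wt X]vsub0.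
Qed.

Lemma cdomM (b f : T -> R[i]) a : cmeas b -> (forall x, cabs (b x) = 1) ->
  cdom f a -> cdom (fun x => b x * f x) a.
Proof.
move=> mb b1 [mf [C hC]]; split; first exact: cmeasM.
by exists C => x; rewrite cabsM b1 mul1r.
Qed.

Lemma Wreg_cdom k (f : T -> R[i]) : Wreg k (fun x => complex.Re (f x)) ->
  Wreg k (fun x => complex.Im (f x)) -> cdom f (vzero R n).
Proof.
move=> w1 w2; have [C1 h1] := Wreg_bound w1; have [C2 h2] := Wreg_bound w2.
split; first by split; apply: measurable_rcont; [exact: Wreg_cont w1|exact: Wreg_cont w2].
exists (C1 + C2) => x; rewrite vsub0 (le_trans (cabs_le _))// [leRHS]mulrDl.
exact: lerD.
Qed.

Lemma WregD k (f g : T -> R) : Wreg k f -> Wreg k g -> Wreg k (fun x => f x + g x).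
Proof.
apply: RegD => j f1 f2 [C1 h1] [C2 h2]; exists (C1 + C2) => y x.
by rewrite (le_trans (ler_normD _ _))// [leRHS]mulrDl lerD.
Qed.

Lemma schwartz_cdom (g : T -> R[i]) : schwartz g -> cdom g (vzero R n).
Proof.
by move=> /(schwartz_Rap 0)[/Rap_Wreg g1 /Rap_Wreg g2]; exact: Wreg_cdom g1 g2.
Qed.

Lemma ifourier_FT (g : T -> R[i]) : schwartz g ->
  (fun x => complex.Re (ifourier g x)) = (fun x =>
    FT 0 (fun x => complex.Re (g x)) x + FT (pi / 2) (fun x => complex.Im (g x)) x) /\
  (fun x => complex.Im (ifourier g x)) = (fun x =>
    FT 0 (fun x => complex.Im (g x)) x + FT (- (pi / 2)) (fun x => complex.Re (g x)) x).
Proof.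
move=> /(schwartz_Rap 0)[/Rap_Wreg g1 /Rap_Wreg g2]; split; apply/funext => x.
  rewrite /ifourier cintE /= -(RintegralD measurableT (integrable_cosM _ _ g1) (integrable_cosM _ _ g2)).
  by apply: eq_Rintegral => xi _; rewrite addr0 cosDpihalf mulNr; case: (g xi).
rewrite /ifourier cintE /= -(RintegralD measurableT (integrable_cosM _ _ g2) (integrable_cosM _ _ g1)).
by apply: eq_Rintegral => xi _; rewrite addr0 cosBpihalf addrC; case: (g xi) => a b /=; ring.
Qed.

Lemma ifourier_Wreg (g : T -> R[i]) : schwartz g -> forall k,
  Wreg k (fun x => complex.Re (ifourier g x)) /\ Wreg k (fun x => complex.Im (ifourier g x)).
Proof.
move=> sg k; have [-> ->] := ifourier_FT sg.
by have [g1 g2] := schwartz_Rap n.*2.+1 sg; split; apply: WregD; exact: FT_Wreg.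
Qed.

End Dominated.

Section FourierIdentity.
Variables (R : realType) (n : nat) (mu : n.-tuple R -> R).
Local Notation T := (n.-tuple R).
Hypothesis mmu : measurable_fun [set: T] mu.

Lemma dotp_vsubl (x y z : T) : dotp (vsub x y) z = dotp x z - dotp y z.
Proof. by rewrite /dotp -sumrB; apply: eq_bigr => i _; rewrite tnth_vsub mulrBl. Qed.

Lemma cmeas_character d (X : measurableType d) (p q : X -> T) (c : R) :
  measurable_fun setT p -> measurable_fun setT q ->
  cmeas (fun x => expi (c * dotp (p x) (q x))).
Proof. by move=> mp mq; apply: cmeas_expi; apply: measurable_funM => //; exact: measurable_dotp2. Qed.

Let cm_fst (f : T -> R[i]) : cmeas f -> cmeas (fun p : T * T => f p.1).
Proof. by move=> mf; apply: (cmeas_comp (p := fst)) mf _; exact: measurable_fst. Qed.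
Let cm_snd (f : T -> R[i]) : cmeas f -> cmeas (fun p : T * T => f p.2).
Proof. by move=> mf; apply: (cmeas_comp (p := snd)) mf _; exact: measurable_snd. Qed.
Let cm_sub (f : T -> R[i]) : cmeas f -> cmeas (fun p : T * T => f (vsub p.1 p.2)).
Proof.
move=> mf; apply: (cmeas_comp (p := fun p : T * T => vsub p.1 p.2)) mf _.
by apply: measurable_vsub2; [exact: measurable_fst|exact: measurable_snd].
Qed.

(** A product becomes a convolution and the translation of g a modulation: exchange the integrals
    over xi and z, then substitute xi + y for xi. *)
Lemma ifourier_mul_fourier (g phi : T -> R[i]) (x y : T) :
  cdom g (vzero R n) -> cdom phi (vzero R n) ->
  ifourier (fun xi => g (vsub xi y) * fourier phi xi) x =
  cint (fun z => phi z * (expi (2 * pi * dotp y (vsub x z)) * ifourier g (vsub x z))).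
Proof.
move=> dg dphi; have [mg [Cg hg]] := dg; have [mphi [Cp hp]] := dphi.
pose K (p : T * T) := expi (2 * pi * dotp p.1 x) * g (vsub p.1 y) *
  (expi (- (2 * pi) * dotp p.1 p.2) * phi p.2).
have mK : cmeas K.
  apply: cmeasM; apply: cmeasM.
  - by apply: cmeas_character; [exact: measurable_fst|exact: measurable_cst].
  - by apply: (cm_fst (f := fun x => g (vsub x y))); apply: cmeas_comp mg _; exact: measurable_vsub.
  - by apply: cmeas_character; [exact: measurable_fst|exact: measurable_snd].
  - exact: cm_snd.
transitivity (cint (fun xi => cint (fun z => K (xi, z)))).
  apply: eq_cint => xi; rewrite mulrA /fourier -(@cintZ _ _ _ _ (vzero R n)).
    by apply: eq_cint => z; rewrite /K /= mulNr.
  apply: cdomM => // [|z]; last exact: cabs_expi.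
  rewrite (_ : (fun z => _) = (fun z => expi (- (2 * pi) * dotp xi (id z)))).
    by apply: cmeas_character; [exact: measurable_cst|exact: measurable_id].
  by apply/funext => z; rewrite mulNr.
rewrite (@cint_swap _ _ K (fun _ => y) (Cg * Cp)) //; last first.
  move=> xi z; rewrite /K /= !cabsM !cabs_expi !mul1r mulrACA.
  rewrite ler_pM ?cabs_ge0//.
    by have := hg (vsub xi y); rewrite vsub0.
  by have := hp z; rewrite vsub0.
apply: eq_cint => z.
pose F xi := expi (2 * pi * dotp xi (vsub x z)) * g xi.
have dF : cdom F (vzero R n).
  apply: cdomM => // [|xi]; last exact: cabs_expi.
  by apply: cmeas_character; [exact: measurable_id|exact: measurable_cst].
rewrite /ifourier -/F -(cint_shift y dF.1) mulrA -(cintZ _ (cdom_shift y dF)).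
apply: eq_cint => xi; rewrite /K /F /=.
(* The first term cancels against the kernel of [fourier phi], the second is the modulation, the
   third the kernel of [ifourier g] after translation. *)
have -> : dotp xi x = dotp xi z + dotp y (vsub x z) + dotp (vsub xi y) (vsub x z).
  by rewrite dotp_vsubl (dotpC xi (vsub x z)) dotp_vsubl (dotpC x xi) (dotpC z xi); ring.
rewrite !(mulrDr (2 * pi)) !expiD mulNr.
have e1 : expi (2 * pi * dotp xi z) * expi (- (2 * pi * dotp xi z)) = 1 :> R[i].
  by rewrite -expiD subrr /expi cos0 sin0.
move: e1; move: (expi (2 * pi * dotp xi z)) => a; move: (expi (- _)) => b.
move: (expi _) => c; move: (expi _) => d; move: (g _) (phi _) => gg p ab.
have -> : a * c * d * gg * (b * p) = (a * b) * (p * c * (d * gg)) by ring.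
by rewrite ab mul1r.
Qed.

Definition hatmul (g : T -> R[i]) (y z : T) : R[i] :=
  cint (fun x => Fmu mu x * (expi (2 * pi * dotp y (vsub x z)) * ifourier g (vsub x z))).

Let K2 g y (p : T * T) :=
  Fmu mu p.1 * (expi (2 * pi * dotp y (vsub p.1 p.2)) * ifourier g (vsub p.1 p.2)).

Let mK2 g y : cdom (ifourier g) (vzero R n) -> cmeas (K2 g y).
Proof.
move=> dG; have [mG _] := dG; apply: cmeasM; last apply: cmeasM.
- apply: (cm_fst (f := Fmu mu)); apply: cmeas_expi; apply: measurable_funM => //; exact: measurable_cst.
- apply: (cm_sub (f := fun v => expi (2 * pi * dotp y v))).
  by apply: cmeas_character; [exact: measurable_cst|exact: measurable_id].
- exact: cm_sub.
Qed.

Lemma cmeas_hatmul g y : cdom (ifourier g) (vzero R n) -> cmeas (hatmul g y).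
Proof. by move=> dG; apply: (@cmeas_cint _ _ (K2 g y)); exact: mK2. Qed.

(** All transforms are moved onto the test function, where [ifourier_mul_fourier] applies; a last
    exchange of integrals isolates the factor of phi, which is the h_y of the overview. Of phi only
    measurability and the weight bound enter. *)
Lemma tfourier_Emu (g phi : T -> R[i]) (y : T) : cdom g (vzero R n) ->
  cdom (ifourier g) (vzero R n) -> cdom phi (vzero R n) ->
  tfourier (tmul (fun x => g (vsub x y)) (Emu mu)) phi =
  cint (fun z => hatmul g y z * phi z).
Proof.
move=> dg dG dphi; have [mG [CG hG]] := dG; have [mphi [Cp hp]] := dphi.
rewrite /tfourier /tmul /Emu /tifourier /tdist_of_fun.
pose K (p : T * T) := phi p.2 * K2 g y p.
have mK : cmeas K by apply: cmeasM; [exact: cm_snd|exact: mK2].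
have dM (x : T) : cdom (fun z => phi z *
    (expi (2 * pi * dotp y (vsub x z)) * ifourier g (vsub x z))) (vzero R n).
  split.
    apply: cmeasM => //; apply: cmeasM.
      apply: cmeas_character => //; apply: measurable_vsub2 => //; exact: measurable_id.
    apply: (cmeas_comp (p := fun z => vsub x z)) mG _.
    by apply: measurable_vsub2 => //; exact: measurable_id.
  exists (`|Cp| * `|CG|) => z; rewrite !cabsM cabs_expi mul1r.
  rewrite vsub0 mulrAC; apply: ler_pM; rewrite ?cabs_ge0//.
    have := hp z; rewrite vsub0 => /le_trans; apply.
    by rewrite ler_wpM2r ?wt_ge0 ?ler_norm.
  rewrite (le_trans (hG _))// (@le_trans _ _ (`|CG| * wt (vsub (vsub x z) (vzero R n))))//.
    by rewrite ler_wpM2r ?wt_ge0 ?ler_norm.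
  by rewrite ler_piMr// wt_le1.
transitivity (cint (fun x => cint (fun z => K (x, z)))).
  apply: eq_cint => x; rewrite ifourier_mul_fourier// -(cintZ _ (dM x)).
  by apply: eq_cint => z; rewrite mulrCA.
rewrite (@cint_swap _ _ K id (Cp * CG)) //; last first.
  move=> x z; rewrite /K /K2 /= !cabsM !cabs_expi !mul1r.
  rewrite [X in Cp * CG * X]mulrC mulrACA ler_pM ?cabs_ge0//.
    by have := hp z; rewrite vsub0.
  by have := hG (vsub x z); rewrite vsub0.
apply: eq_cint => z; rewrite mulrC /hatmul -(@cintZ _ _ _ _ z)//.
apply: cdomM => // [|x|].
- by apply: cmeas_expi; apply: measurable_funM => //; exact: measurable_cst.
- exact: cabs_expi.
apply: (cdom_shift z (f := fun v => expi (2 * pi * dotp y v) * ifourier g v)).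
apply: cdomM => // [|x]; last exact: cabs_expi.
by apply: cmeas_character; [exact: measurable_cst|exact: measurable_id].
Qed.

End FourierIdentity.

Section UniformBound.
Variables (R : realType) (n : nat) (mu : n.-tuple R -> R) (m : R).
Local Notation T := (n.-tuple R).
Hypothesis m_ge2 : 2 <= m.
Hypothesis smu : smooth_off0 mu.
Hypothesis hmu : forall (lam : R) (x : T), 0 < lam -> x <> vzero R n ->
  mu (vscale lam x) = lam `^ m * mu x.
Hypothesis nondeg : forall x : T, enorm x = 1 -> \det (hessian mu x) != 0.
Variable g : T -> R[i].
Hypothesis sg : schwartz g.

Let G1 x := complex.Re (ifourier g x).
Let G2 x := complex.Im (ifourier g x).
Let osI tau (G : T -> R) y z := \int[mleb R n]_w (osc mu tau y w * G (vsub w z)).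

(** The exponent is mu(w) + y.(w - z), so the part -y.z is constant in w and goes into [tau]; this
    is why the decay estimates are uniform in [tau]. The sine is the cosine delayed by pi/2. *)
Lemma hatmulE y z : let tau := - (2 * pi * dotp y z) in
  hatmul mu g y z = Complex (osI tau G1 y z - osI (tau - pi / 2) G2 y z)
                            (osI tau G2 y z + osI (tau - pi / 2) G1 y z).
Proof.
move=> tau; have [w1 w2] := ifourier_Wreg sg 0.
have i1 t := integrable_osc smu hmu t y z w1; have i2 t := integrable_osc smu hmu t y z w2.
have e w : Fmu mu w * (expi (2 * pi * dotp y (vsub w z)) * ifourier g (vsub w z)) =
    expi (2 * pi * phase mu y w + tau) * ifourier g (vsub w z).
  rewrite mulrA -expiD; congr (expi _ * _).
  by rewrite dotpC dotp_vsubl (dotpC w) (dotpC z) /phase /tau; ring.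
have s w : osc mu (tau - pi / 2) y w = sin (2 * pi * phase mu y w + tau).
  by rewrite /osc addrA cosBpihalf.
rewrite /hatmul (eq_cint e) cintE; apply: f_equal2.
  rewrite /osI -RintegralB ?i1 ?i2//.
  by apply: eq_Rintegral => w _; rewrite s /G1 /G2; case: (ifourier _ _).
rewrite /osI -RintegralD ?i1 ?i2//.
by apply: eq_Rintegral => w _; rewrite s /G1 /G2; case: (ifourier _ _).
Qed.

Lemma integral_cabs_hatmul : exists B : R, forall y : T,
  (\int[mleb R n]_z (cabs (hatmul mu g y z))%:E <= B%:E)%E.
Proof.
have [s [zz hd]] := osc_decay m_ge2 smu hmu nondeg.
have [C1 C10 h1] := hd G1 (fun k => (ifourier_Wreg sg k).1).
have [C2 C20 h2] := hd G2 (fun k => (ifourier_Wreg sg k).2).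
(* Real and imaginary part together contain four integrals, two with [G1] and two with [G2]. *)
pose M := 2 * (C1 + C2); have M0 : 0 <= M by rewrite mulr_ge0// addr_ge0.
have mmu : measurable_fun [set: T] mu.
  by apply: measurable_rcont_off0 => w; exact: (Hom_cont (Hom_mu smu hmu 0)).
have [w1 w2] := ifourier_Wreg sg 0.
(* There are [(size s).+1] centres, the origin included; they depend on y, but each contributes the
   same mass. *)
exists (M * ((size s).+1%:R * (pi ^+ n * pi ^+ n))) => y.
pose l := vzero R n :: map (zz y) s.
have S0 z : 0 <= \sum_(p <- l) conv p z by rewrite sumr_ge0// => p _; exact: conv_ge0.
have mS : measurable_fun [set: T] (fun z => \sum_(p <- l) conv p z).
  by apply: measurable_sum => p; exact: measurable_conv.
have -> : (M * ((size s).+1%:R * (pi ^+ n * pi ^+ n)))%:E =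
    (\int[mleb R n]_z (M * \sum_(p <- l) conv p z)%:E)%E.
  under eq_integral do rewrite EFinM.
  rewrite ge0_integralZl//; last 2 first.
  - exact/measurable_EFinP.
  - by move=> z _; rewrite lee_fin.
  rewrite EFinM; congr (_ * _)%E.
  under eq_integral do rewrite -sumEFin.
  rewrite ge0_integral_sum//; last 2 first.
  - by move=> p; apply/measurable_EFinP; exact: measurable_conv.
  - by move=> p z _; rewrite lee_fin conv_ge0.
  under eq_bigr do rewrite integral_conv.
  rewrite sumEFin; congr EFin.
  by rewrite big_const_seq count_predT iter_addr_0 /= size_map mulr_natl.
apply: ge0_le_integral => //.
- by move=> z _; rewrite lee_fin cabs_ge0.
- apply/measurable_EFinP/measurable_cabs/cmeas_hatmul => //.
  exact: Wreg_cdom w1 w2.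
- by apply/measurable_EFinP; exact: measurable_funM.
move=> z _; rewrite lee_fin (le_trans (cabs_le _))// hatmulE /=.
rewrite (le_trans (lerD (ler_normB _ _) (ler_normD _ _)))//.
have := h1 (- (2 * pi * dotp y z)) y z; have := h1 (- (2 * pi * dotp y z) - pi / 2) y z.
have := h2 (- (2 * pi * dotp y z)) y z; have := h2 (- (2 * pi * dotp y z) - pi / 2) y z.
rewrite -/l /osI /M; move: (\sum_(p <- l) _) => S.
by move=> a1 a2 a3 a4; lra.
Qed.

End UniformBound.

Theorem theorem1p1 (R : realType) (d : nat) (hd : (0 < d)%N)
  (mu : d.-tuple R -> R) (m : R) (hm : 2 <= m)
  (hsmooth : smooth_off0 mu)
  (hhom : forall (lam : R) (x : d.-tuple R), 0 < lam -> x <> vzero R d ->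
            mu (vscale lam x) = lam `^ m * mu x)
  (hhess : forall x : d.-tuple R, enorm x = 1 -> \det (hessian mu x) != 0)
  (g : d.-tuple R -> R[i]) (hg : schwartz g) :
  (ereal_sup [set FL1norm (tmul (fun x => g (vsub x y)) (Emu mu)) | y in [set: d.-tuple R]]
     < +oo)%E.
Proof.
have [B hB] := integral_cabs_hatmul hm hsmooth hhom hhess hg.
have mmu : measurable_fun [set: d.-tuple R] mu.
  by apply: measurable_rcont_off0 => w; exact: (Hom_cont (Hom_mu hsmooth hhom 0)).
have dG : cdom (ifourier g) (vzero R d).
  by have [w1 w2] := ifourier_Wreg hg 0; exact: Wreg_cdom w1 w2.
apply: (@le_lt_trans _ _ B%:E); last exact: ltry.
apply: ge_ereal_sup => _ [y _ <-]; apply: le_trans (hB y).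
(* The norm is an infimum over representing functions, so exhibiting [hatmul mu g y] as one of them
   bounds it. *)
apply: ereal_inf_lbound; exists (hatmul mu g y); last by rewrite lebE.
split; last first.
  by move=> phi sphi; apply: tfourier_Emu => //; exact: schwartz_cdom.
have [h1 h2] := cmeas_hatmul mmu y dG; split=> //; split=> //.
by rewrite lebE (le_lt_trans (hB y))// ltry.
Qed.
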